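(* Let $n\geq 1$, and let $N, M\geq 1$ be integers. Suppose $f_1,\ldots,f_N$ and $g_1,\ldots,g_M$ are bounded measurable radial functions on $\mathbb{B}_n$, none of which is the zero function (i.e. none of them is zero almost everywhere). Suppose $f\in L^2(\mathbb{B}_n,\mathrm{d}\nu_n)$ is such that the operator $T_{f_1}\cdots T_{f_N}T_{f}T_{g_1}\cdots T_{g_M}$ (which is densely defined on $A^2$) is the zero operator. Then $f$ is the zero function, i.e. $f(z)=0$ for almost every $z\in\mathbb{B}_n$.
   Context: $\mathbb{B}_n=\{z\in\mathbb{C}^n: |z|<1\}$ is the open unit ball, where $|z|=\sqrt{|z_1|^2+\cdots+|z_n|^2}$, and $\nu_n$ is Lebesgue measure on $\mathbb{B}_n$ normalized so that $\nu_n(\mathbb{B}_n)=1$. Write $L^2=L^2(\mathbb{B}_n,\mathrm{d}\nu_n)$. The Bergman space $A^2$ is the closed subspace of $L^2$ consisting of all functions in $L^2$ that are holomorphic in $\mathbb{B}_n$, and $P$ is the orthogonal projection from $L^2$ onto $A^2$. For $f\in L^2$, the Toeplitz operator $T_f$ with symbol $f$ is densely defined on $A^2$ by $T_f\varphi=P(f\varphi)$ for all bounded holomorphic functions $\varphi$ on $\mathbb{B}_n$. If $f$ is bounded, then $T_f$ extends to a bounded operator on all of $A^2$, given by $T_f\varphi=P(f\varphi)$ for all $\varphi\in A^2$. A function $f$ on $\mathbb{B}_n$ is called radial if there is a function $\tilde f$ on $[0,1)$ such that $f(z)=\tilde f(|z|)$ for all $z\in\mathbb{B}_n$. If $g$ is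 bounded and radial, $T_g$ is diagonal with respect to the orthogonal basis of monomials $z^m=z_1^{m_1}\cdots z_n^{m_n}$, where $m=(m_1,\ldots,m_n)$ ranges over the $n$-tuples of non-negative integers; in particular it maps holomorphic polynomials to holomorphic polynomials. The product $T_{f_1}\cdots T_{f_N}T_{f}T_{g_1}\cdots T_{g_M}$ is a composition of operators, defined on those $\varphi\in A^2$ for which $T_{g_1}\cdots T_{g_M}\varphi$ is a bounded holomorphic function; this domain contains all holomorphic polynomials. Being the zero operator means that it sends every $\varphi$ in this domain to $0$. *)

(* Defs.v *)
From HB Require Import structures.
From mathcomp Require Import all_boot all_order all_algebra.
From mathcomp Require Import complex.
From mathcomp Require Import all_classical all_reals all_analysis.
From mathcomp Require Import measurable_realfun ring lra.

Set Implicit Arguments.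
Unset Strict Implicit.
Unset Printing Implicit Defensive.

Import Order.TTheory GRing.Theory Num.Theory.
Import numFieldNormedType.Exports.

Local Open Scope classical_set_scope.
Local Open Scope ring_scope.

(* R[i] with the topology and norm of its modulus *)
HB.instance Definition _ (R : rcfType) := NormedModule.copy R[i] R[i]^o.
HB.instance Definition _ (R : rcfType) := isPointed.Build R[i] 0.

Section measurable_Cn.
Context {R : realType} {n : nat}.

Local Notation R2 := (measurableTypeR R * measurableTypeR R)%type.

Definition coordR2 (j : 'I_n) (z : 'rV[R[i]]_n) : R2 :=
  (complex.Re (z 0 j), complex.Im (z 0 j)).

(* The product sigma-algebra of C^n = R^(2n), i.e., its Borel sigma-algebra *)
Let Cn_measurable : set (set 'rV[R[i]]_n) := g_sigma_preimage coordR2.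

Let Cn_measurable0 : Cn_measurable set0.
Proof. exact: sigma_algebra0. Qed.

Let Cn_measurableC A : Cn_measurable A -> Cn_measurable (~` A).
Proof. exact: sigma_algebraC. Qed.

Let Cn_measurable_bigcup (F : (set 'rV[R[i]]_n)^nat) :
  (forall i, Cn_measurable (F i)) -> Cn_measurable (\bigcup_i F i).
Proof. exact: sigma_algebra_bigcup. Qed.

HB.instance Definition _ := @isMeasurable.Build default_measure_display
  'rV[R[i]]_n Cn_measurable Cn_measurable0 Cn_measurableC Cn_measurable_bigcup.

Lemma measurable_coordR2 (j : 'I_n) :
  measurable_fun [set: 'rV[R[i]]_n] (coordR2 j).
Proof.
move=> _ Y mY; rewrite setTI; apply: sub_sigma_algebra => /=.
rewrite -bigcup_seq/=; exists j => /=; first by rewrite mem_index_enum.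
by exists Y => //; rewrite setTI.
Qed.

Lemma measurable_fun_Cn d (T : measurableType d) (f : T -> 'rV[R[i]]_n) :
  (forall j, measurable_fun [set: T] (coordR2 j \o f)) ->
  measurable_fun [set: T] f.
Proof.
move=> mf.
have : g_sigma_preimage (fun j => coordR2 j \o f) `<=` measurable.
  apply: smallest_sub; first exact: sigma_algebra_measurable.
  rewrite -bigcup_seq; apply: bigcup_sub => j _ A [B mB <-].
  exact: mf.
rewrite g_sigma_preimage_comp => h _ A mA.
by apply: h; exists A.
Qed.

End measurable_Cn.

Lemma sigma_finite_product d1 d2 (T1 : measurableType d1)
    (T2 : measurableType d2) (R : realType)
    (m1 : {sigma_finite_measure set T1 -> \bar R})
    (m2 : {sigma_finite_measure set T2 -> \bar R}) :
  sigma_finite setT (m1 \x m2)%E.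
Proof.
have /sigma_finiteP[F [TF ndF Foo]] := sigma_finiteT m1.
have /sigma_finiteP[G [TG ndG Goo]] := sigma_finiteT m2.
exists (fun n => F n `*` G n).
  rewrite -setXTT TF TG predeqE => -[x y]; split.
    move=> [/= [n _ Fnx] [k _ Gky]]; exists (maxn n k) => //; split.
    - by move: x Fnx; exact/subsetPset/ndF/leq_maxl.
    - by move: y Gky; exact/subsetPset/ndG/leq_maxr.
  by move=> [n _ []/= ? ?]; split; exists n.
move=> k; have [? ?] := Foo k; have [? ?] := Goo k.
split; first exact: measurableX.
by rewrite product_measure1E// lte_mul_pinfty// ge0_fin_numE.
Qed.

Section lebesgue_Cn.
Context {R : realType}.

Local Notation R2 := (measurableTypeR R * measurableTypeR R)%type.

Definition leb2 : set R2 -> \bar R :=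
  (lebesgue_measure \x lebesgue_measure)%E.

HB.instance Definition _ := Measure.on leb2.
HB.instance Definition _ := Measure_isSigmaFinite.Build _ _ _ leb2
  (sigma_finite_product lebesgue_measure lebesgue_measure).

Section cons.
Context {n : nat}.

Definition consC (p : R2 * 'rV[R[i]]_n) : 'rV[R[i]]_n.+1 :=
  \row_j if unlift ord0 j is Some k then p.2 0 k else Complex p.1.1 p.1.2.

Definition unconsC (z : 'rV[R[i]]_n.+1) : R2 * 'rV[R[i]]_n :=
  (coordR2 ord0 z, \row_k z 0 (lift ord0 k)).

Lemma unconsCK : cancel unconsC consC.
Proof.
move=> z; apply/rowP => j; rewrite mxE /=.
by case: unliftP => [k ->|->]; [rewrite mxE|case: (z 0 ord0)].
Qed.

Lemma consCK : cancel consC unconsC.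
Proof.
move=> [[x y] z]; rewrite /unconsC /coordR2 !mxE unlift_none /=; congr pair.
by apply/rowP => k; rewrite !mxE liftK.
Qed.

Lemma measurable_consC : measurable_fun setT consC.
Proof.
apply: measurable_fun_Cn => j.
case: (unliftP ord0 j) => [k ->|->].
  rewrite (_ : _ \o _ = coordR2 k \o snd).
    by apply: measurableT_comp => //; exact: measurable_coordR2.
  by apply/funext => p; rewrite /coordR2 /= mxE liftK.
rewrite (_ : _ \o _ = fst) //.
by apply/funext => -[[x y] z]; rewrite /coordR2 /= mxE unlift_none.
Qed.

Lemma measurable_unconsC : measurable_fun setT unconsC.
Proof.
apply: measurable_fun_pair; first exact: measurable_coordR2.
apply: measurable_fun_Cn => j.
rewrite (_ : _ \o _ = coordR2 (lift ord0 j)); first exact: measurable_coordR2.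
by apply/funext => z; rewrite /coordR2 /= mxE.
Qed.

End cons.

Section step.
Local Open Scope ereal_scope.
Variables (n : nat) (m : {sigma_finite_measure set 'rV[R[i]]_n -> \bar R}).

Let m2 : {measure set (R2 * 'rV[R[i]]_n)%type -> \bar R} := leb2 \x m.

Definition leb_cons : set 'rV[R[i]]_n.+1 -> \bar R := pushforward (leb2 \x m) consC.

Let mpre A : measurable A -> measurable (consC (n := n) @^-1` A).
Proof. by move=> mA; rewrite -[X in measurable X]setTI; exact: measurable_consC. Qed.

Let leb_cons0 : leb_cons set0 = 0.
Proof. by rewrite /leb_cons /pushforward preimage_set0 (measure0 m2). Qed.

Let leb_cons_ge0 A : 0 <= leb_cons A.
Proof. exact: (measure_ge0 m2). Qed.

Let leb_cons_sigma_additive : semi_sigma_additive leb_cons.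
Proof.
move=> F mF tF mUF; rewrite /leb_cons /pushforward preimage_bigcup.
apply: (@measure_semi_sigma_additive _ _ _ m2).
- by move=> k; exact: mpre.
- apply/trivIsetP => /= i j _ _ ij; rewrite -preimage_setI.
  by move/trivIsetP : tF => /(_ _ _ _ _ ij) ->//; rewrite preimage_set0.
- by rewrite -preimage_bigcup; exact: mpre.
Qed.

HB.instance Definition _ := isMeasure.Build _ _ _ leb_cons
  leb_cons0 leb_cons_ge0 leb_cons_sigma_additive.

Let leb_cons_sigma_finite : sigma_finite setT leb_cons.
Proof.
have [F FT Foo] := sigma_finite_product leb2 m.
exists (fun k => unconsC @^-1` F k); first by rewrite -preimage_bigcup -FT.
move=> k; have [mF Fk] := Foo k; split.
  by rewrite -[X in measurable X]setTI; exact: measurable_unconsC.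
rewrite /leb_cons /pushforward -comp_preimage.
by rewrite (_ : unconsC \o consC = id) //; apply/funext => p; exact: consCK.
Qed.

HB.instance Definition _ := Measure_isSigmaFinite.Build _ _ _ leb_cons
  leb_cons_sigma_finite.

End step.

(* Lebesgue measure on C^n = R^2 * C^(n-1) *)
Fixpoint leb (n : nat) : {sigma_finite_measure set 'rV[R[i]]_n -> \bar R} :=
  match n with
  | 0 => dirac (0 : 'rV[R[i]]_0)
  | n'.+1 => leb_cons (leb n')
  end.

End lebesgue_Cn.

Section ball.
Context {R : realType}.

Local Notation normc := ComplexField.Normc.normc.

(* |z|; the norm `|z| of the library on row vectors is the sup norm *)
Definition enorm (n : nat) (z : 'rV[R[i]]_n) : R :=
  Num.sqrt (\sum_j normc (z 0 j) ^+ 2).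

Definition uball (n : nat) : set 'rV[R[i]]_n := [set z | enorm z < 1].

Arguments uball n _ : clear implicits.

Lemma enormE n (z : 'rV[R[i]]_n) :
  enorm z = Num.sqrt (\sum_j ((coordR2 j z).1 ^+ 2 + (coordR2 j z).2 ^+ 2)).
Proof.
congr Num.sqrt; apply: eq_bigr => j _; rewrite /coordR2 /=.
by case: (z 0 j) => x y /=; rewrite sqr_sqrtr// addr_ge0// sqr_ge0.
Qed.

Lemma uballE n : uball n = [set z : 'rV[R[i]]_n |
  \sum_j ((coordR2 j z).1 ^+ 2 + (coordR2 j z).2 ^+ 2) < 1].
Proof.
have sqrt_lt1 (a : R) : (Num.sqrt a < 1) = (a < 1).
  by rewrite -[in LHS](sqrtr1 R) ltr_sqrt.
by apply/funext => z; rewrite /uball /= enormE sqrt_lt1.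
Qed.

Lemma measurable_uball n : measurable (uball n).
Proof.
pose F (z : 'rV[R[i]]_n) : R :=
  \sum_j ((coordR2 j z).1 ^+ 2 + (coordR2 j z).2 ^+ 2).
have mF : measurable_fun setT F.
  apply: measurable_sum => j.
  have mj := @measurable_coordR2 R n j.
  by apply: measurable_funD; apply: measurable_funX; apply: measurableT_comp.
rewrite uballE (_ : [set z | _] = F @^-1` `]-oo, 1[).
  by rewrite -[X in measurable X]setTI; exact: mF.
by apply/seteqP; split => z /=; rewrite in_itv.
Qed.

Definition cube n (r : R) : set 'rV[R[i]]_n :=
  [set z | forall j, (`]- r, r[ `*` `]- r, r[)%classic (coordR2 j z)].

Arguments cube n r _ : clear implicits.

Lemma leb_cube n r : 0 < r ->
  measurable (cube n r) /\ leb n (cube n r) = ((4 * r ^+ 2) ^+ n)%:E.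
Proof.
move=> r0; elim: n => [|n [mn IHn]].
  have -> : cube 0 r = setT by apply/seteqP; split => // z _ [].
  by rewrite /= diracT expr0.
have cE : consC @^-1` cube n.+1 r =
    (`]- r, r[ `*` `]- r, r[)%classic `*` cube n r.
  apply/seteqP; split => [[p z] h|[p z] [hp hz] j].
    split => [|j]; [have := h ord0|have := h (lift ord0 j)].
      by rewrite /coordR2 mxE unlift_none; case: p {h}.
    by rewrite /coordR2 mxE liftK.
  case: (unliftP ord0 j) => [k ->|->]; rewrite /coordR2 mxE.
    by rewrite liftK; exact: hz.
  by rewrite unlift_none; case: p hp {hz}.
split.
  have -> : cube n.+1 r = unconsC @^-1` (consC @^-1` cube n.+1 r).
    by apply/seteqP; split => z /=; rewrite unconsCK.
  rewrite cE -[X in measurable X]setTI; apply: measurable_unconsC => //.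
  by apply: measurableX => //; apply: measurableX.
transitivity ((leb2 \x leb n)%E (consC @^-1` cube n.+1 r)); first by [].
have mI : measurable (`]- r, r[%classic : set (measurableTypeR R)).
  exact: measurable_itv.
have h := @product_measure1E _ _ _ _ R leb2 (leb n) _ _ (measurableX mI mI) mn.
have muI : lebesgue_measure (`]- r, r[%classic : set (measurableTypeR R))
    = (r + r)%:E.
  by rewrite lebesgue_measure_itv/= lte_fin gtrN// -EFinB opprK.
have h2 : leb2 (`]- r, r[ `*` `]- r, r[)%classic = ((r + r) * (r + r))%:E.
  rewrite EFinM -muI.
  exact: (@product_measure1E _ _ _ _ R lebesgue_measure lebesgue_measure).
rewrite cE [LHS]h IHn [X in (X * _)%E]h2 -!EFinM.
by rewrite [in RHS]exprS; congr (_%:E); congr (_ * _); ring.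
Qed.

Lemma cube_uball n : cube n (n.*2.+1%:R)^-1 `<=` uball n.
Proof.
move=> z h; rewrite uballE /=.
set r : R := _^-1 in h.
have r0 : 0 < r by rewrite invr_gt0 ltr0n.
have r1 : r <= 1 by rewrite invf_le1 ?ltr0n// ler1n.
have sq x : `]- r, r[%classic x -> x ^+ 2 <= r.
  by rewrite /= in_itv /= => /andP[? ?]; nra.
apply: (@le_lt_trans _ _ (\sum_(j < n) (r *+ 2))).
  by apply: ler_sum => j _; have [h1 h2] := h j; rewrite mulr2n lerD ?sq.
rewrite sumr_const card_ord -mulrnA mul2n -mulr_natr.
by rewrite mulrC ltr_pdivrMr ?ltr0n// mul1r ltr_nat.
Qed.

Lemma uball_cube n : uball n `<=` cube n 1.
Proof.
move=> z; rewrite uballE /= => h j.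
have {}h : (coordR2 j z).1 ^+ 2 + (coordR2 j z).2 ^+ 2 < 1.
  apply: le_lt_trans h; rewrite [leRHS](bigD1 j)//= lerDl.
  by apply: sumr_ge0 => k _; rewrite addr_ge0// sqr_ge0.
have sq (x : R) : x ^+ 2 < 1 -> `]- 1, 1[%classic x.
  by move=> x1; rewrite /= in_itv /=; apply/andP; split; nra.
by split; apply: sq; apply: le_lt_trans h; rewrite ?lerDl ?lerDr sqr_ge0.
Qed.

Lemma leb_uball_gt0 n : (0 < leb n (uball n))%E.
Proof.
have r0 : 0 < (n.*2.+1%:R : R)^-1 by rewrite invr_gt0 ltr0n.
have [mc cE] := leb_cube n r0.
apply: lt_le_trans (le_measure _ _ _ (@cube_uball n)); rewrite ?inE//.
  by rewrite [ltRHS]cE lte_fin exprn_gt0// mulr_gt0// exprn_gt0.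
exact: measurable_uball.
Qed.

Lemma leb_uball_lty n : (leb n (uball n) < +oo)%E.
Proof.
have [mc cE] := leb_cube n (@ltr01 R).
apply: le_lt_trans (le_measure _ _ _ (@uball_cube n)) _; rewrite ?inE//.
  exact: measurable_uball.
by rewrite [ltLHS]cE ltry.
Qed.

Definition volB n : {nonneg R} :=
  NngNum (fine_ge0 (measure_ge0 (leb n) (uball n))).

(* Lebesgue measure on the ball, normalized to have total mass 1 *)
Definition nu n : {measure set 'rV[R[i]]_n -> \bar R} :=
  mscale ((volB n)%:num^-1)%:nng (mrestr (leb n) (@measurable_uball n)).

Lemma nu_uball n : nu n (uball n) = 1%E.
Proof.
transitivity ((volB n)%:num^-1%:E * leb n (uball n `&` uball n))%E; first by [].
rewrite setIid -[X in (_ * X)%E]fineK.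
  by rewrite -EFinM mulVf// gt_eqF// fine_gt0// leb_uball_gt0 leb_uball_lty.
by rewrite ge0_fin_numE// leb_uball_lty.
Qed.

End ball.

Arguments uball {R} n _.
Arguments cube {R} n r _.

Section bergman.
Context {R : realType} {n : nat}.
Implicit Types f g h u v phi : 'rV[R[i]]_n -> R[i].

Local Notation normc := ComplexField.Normc.normc.

(* Measurability with respect to the completion of the Borel sigma-algebra;
   nu n vanishes off the ball, so the values of f there are irrelevant. The
   integrals below do not depend on the choice of a representative modulo nu n,
   since the integral of a nonnegative function is a supremum over simple
   functions. *)
Definition lebesgue_measurable f := exists g,
  [/\ measurable_fun setT (fun z => complex.Re (g z)),
      measurable_fun setT (fun z => complex.Im (g z)) &
      {ae nu n, forall z, f z = g z}].

Definition L2 f := lebesgue_measurable f /\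
  (\int[nu n]_z (normc (f z) ^+ 2)%:E < +oo)%E.

Definition inner f g : R[i] :=
  Complex (\int[nu n]_z complex.Re (f z * conjc (g z)))
          (\int[nu n]_z complex.Im (f z * conjc (g z))).

(* Complex Frechet differentiability (the scalars are R[i]) at each point
   of the ball *)
Definition holomorphic f :=
  forall z, uball n z -> differentiable f z.

Definition bounded_on_ball f :=
  exists K : R, forall z, uball n z -> normc (f z) <= K.

Definition A2 f := holomorphic f /\ L2 f.

Definition is_proj_A2 h u :=
  A2 u /\ forall v, A2 v -> inner (fun z => h z - u z) v = 0.

(* For h in L2, the restriction of bergman_proj h to the ball is uniquely determined,
   and exists since A2 is a closed subspace of L2 *)
Definition bergman_proj h : 'rV[R[i]]_n -> R[i] := xget (fun=> 0) (is_proj_A2 h).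

Definition toeplitz f phi : 'rV[R[i]]_n -> R[i] :=
  bergman_proj (fun z => f z * phi z).

(* T_(F 0) \o T_(F 1) \o ... \o T_(F (k - 1)) *)
Definition toeplitz_prod k (F : 'I_k -> 'rV[R[i]]_n -> R[i]) phi :=
  foldr (fun i => toeplitz (F i)) phi (enum 'I_k).

Definition radial f :=
  exists ft : R -> R[i], forall z, uball n z -> f z = ft (enorm z).

Definition zero_ae f := {ae nu n, forall z, f z = 0}.

End bergman.

(* Main.v *)
From HB Require Import structures.
From mathcomp Require Import all_boot all_order all_algebra.
From mathcomp Require Import complex.
From mathcomp Require Import all_classical all_reals all_analysis.
From mathcomp Require Import measurable_realfun ring lra.
Require Import Defs.

(** Let [c z^m] be the image of a monomial [z^m] under the product of the operators with
   symbols [G j]. These operators are diagonal on the monomials: the eigenvalue of a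
   radial symbol on [z^m] depends only on the degree [l] of [z^m] and is the mean of
   the symbol for the weight [|z|^(2l)] ([eigen]). The operators with symbols [F i]
   likewise multiply the coefficient [<u, z^k>] of any [u] in A^2 by eigenvalues. As
   the whole product kills [z^m], pairing the result with [z^k] gives
   [<f z^m, z^k> = 0] unless one of the eigenvalues involved vanishes, in degree
   [|k|] for the [F i] or in degree [|m|] for the [G j].

   The degrees in which the eigenvalue of a nonzero radial symbol vanishes are
   sparse: the sum of their reciprocals converges ([eigen_zeros_sparse]). Otherwise
   Müntz's theorem ([muntz]) would make [|z|^(2q)] a uniform limit of combinations of
   the [|z|^(2l)] over those degrees [l], and the symbol would have zero mean for each
   weight [|z|^(2q)] with [q >= 1]; together with invariance under rotations this kills
   all moments of the symbol times [|z|^2], and bounded functions are determined by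
   their moments ([moments_eq0]).

   Sparse sets of degrees are stable under unions and shifts. Hence, for given [m]
   and [k], the degrees [l] for which neither [|m| + l] nor [|k| + l] is exceptional
   still have a divergent sum of reciprocals. For such [l], expanding
   [|z|^(2l) = (z_1 conj(z_1) + ... + z_n conj(z_n))^l] gives
   [<f |z|^(2l) z^m, z^k> = 0] ([epow_moment_eq0]), and Müntz's theorem with [q = 1]
   gives [<f |z|^2 z^m, z^k> = 0]. As [m] and [k] are arbitrary, [f |z|^2 = 0] almost
   everywhere, by [moments_eq0] again.

   Three facts about the Bergman space support this. The projection exists
   ([bergman_projP]), because point evaluations are locally bounded ([local_bound]) and
   locally bounded pointwise limits of holomorphic functions are holomorphic
   ([hdiff_limit]); the latter rests on Cauchy's theorem for circles
   ([circint_homogeneous], from [goursat] in logarithmic coordinates). Radial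
   multipliers act on Taylor coefficients through the weight [|z|^(2l)]
   ([radial_meanE]): averaging over rotations and dilating, the integral of
   [v conj(z^m)] over the ball of radius [t] is proportional to [t^(2n+2|m|)], exactly
   as that of [|z|^(2|m|)]. Finally, a Lebesgue measurable radial function has a
   version that is a Borel function of [|z|] ([radial_borel]). *)

Set Implicit Arguments.
Unset Strict Implicit.
Unset Printing Implicit Defensive.

Import Order.TTheory GRing.Theory Num.Theory.
Import numFieldNormedType.Exports.

Local Open Scope classical_set_scope.
Local Open Scope ring_scope.

Local Notation Re := complex.Re.
Local Notation Im := complex.Im.
Local Notation normc := ComplexField.Normc.normc.

(** * The modulus of complex numbers *)

Section complex_modulus.
Context {R : realType}.
Implicit Types x y : R[i].

Lemma normc_ge0 x : 0 <= normc x.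
Proof. by case: x => a b; exact: sqrtr_ge0. Qed.

Lemma sqr_normcE x : normc x ^+ 2 = Re x ^+ 2 + Im x ^+ 2.
Proof. by case: x => a b /=; rewrite sqr_sqrtr// addr_ge0// sqr_ge0. Qed.

Lemma normcE x : normc x = Num.sqrt (Re x ^+ 2 + Im x ^+ 2).
Proof. by case: x. Qed.

Lemma normrCE x : `|x| = (normc x)%:C%C.
Proof. by rewrite normc_def normcE. Qed.

Lemma le_Re_normc x : `|Re x| <= normc x.
Proof.
rewrite -(ler_pXn2r (n := 2))// ?nnegrE ?normc_ge0// sqr_normcE.
by rewrite real_normK ?num_real// lerDl sqr_ge0.
Qed.

Lemma le_Im_normc x : `|Im x| <= normc x.
Proof.
rewrite -(ler_pXn2r (n := 2))// ?nnegrE ?normc_ge0// sqr_normcE.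
by rewrite real_normK ?num_real// lerDr sqr_ge0.
Qed.

Lemma normc_leD x : normc x <= `|Re x| + `|Im x|.
Proof.
rewrite -(ler_pXn2r (n := 2))// ?nnegrE ?normc_ge0 ?addr_ge0// sqr_normcE.
rewrite sqrrD !real_normK ?num_real// lerD2r lerDl.
by rewrite pmulrn_lge0// mulr_ge0.
Qed.

Lemma RecD x y : Re (x + y) = Re x + Re y.
Proof. by case: x; case: y. Qed.
Lemma ImcD x y : Im (x + y) = Im x + Im y.
Proof. by case: x; case: y. Qed.
Lemma RecN x : Re (- x) = - Re x. Proof. by case: x. Qed.
Lemma ImcN x : Im (- x) = - Im x. Proof. by case: x. Qed.
Lemma RecM x y : Re (x * y) = Re x * Re y - Im x * Im y.
Proof. by case: x; case: y. Qed.
Lemma ImcM x y : Im (x * y) = Re x * Im y + Im x * Re y.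
Proof. by case: x; case: y. Qed.
Lemma Rec_conj x : Re (conjc x) = Re x. Proof. by case: x. Qed.
Lemma Imc_conj x : Im (conjc x) = - Im x. Proof. by case: x. Qed.

Lemma normc_conj x : normc (conjc x) = normc x.
Proof. by case: x => a b /=; rewrite sqrrN. Qed.

Lemma normcB x y : normc (x - y) <= normc x + normc y.
Proof. by rewrite -[normc y]normcN; exact: le_normcD. Qed.

Lemma normc_distC x y : normc (x - y) = normc (y - x).
Proof. by rewrite -normcN opprB. Qed.

Lemma normcX x k : normc (x ^+ k) = normc x ^+ k.
Proof.
elim: k => [|k IH]; first by rewrite !expr0 ComplexField.Normc.normc1.
by rewrite !exprS ComplexField.Normc.normcM IH.
Qed.

Lemma normc_real (r : R) : normc r%:C%C = `|r|.
Proof. by rewrite normcE /= expr0n addr0 sqrtr_sqr. Qed.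

Lemma normc_eq0 x : (normc x == 0) = (x == 0).
Proof.
apply/eqP/eqP => [|->]; first exact: ComplexField.Normc.eq0_normc.
exact: ComplexField.Normc.normc0.
Qed.

Lemma complex_eq x y : Re x = Re y -> Im x = Im y -> x = y.
Proof. by case: x; case: y => a b c d /= -> ->. Qed.

End complex_modulus.

Local Notation normcM := ComplexField.Normc.normcM.

(** * Integrals of complex-valued functions *)

Section cmeasurable.
Context {d} {T : measurableType d} {R : realType}.
Implicit Types (D : set T) (f g : T -> R[i]).

Definition cmeasurable D f := measurable_fun D (fun x => Re (f x)) /\
  measurable_fun D (fun x => Im (f x)).

Lemma cmeasurable_cst D (c : R[i]) : cmeasurable D (fun=> c).
Proof. by split; exact: measurable_cst. Qed.

Lemma cmeasurableD D f g :
  cmeasurable D f -> cmeasurable D g -> cmeasurable D (fun x => f x + g x).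
Proof.
move=> [f1 f2] [g1 g2]; split.
  by under eq_fun do rewrite RecD; exact: measurable_funD.
by under eq_fun do rewrite ImcD; exact: measurable_funD.
Qed.

Lemma cmeasurableM D f g :
  cmeasurable D f -> cmeasurable D g -> cmeasurable D (fun x => f x * g x).
Proof.
move=> [f1 f2] [g1 g2]; split.
  under eq_fun do rewrite RecM.
  by apply: measurable_funB; exact: measurable_funM.
under eq_fun do rewrite ImcM.
by apply: measurable_funD; exact: measurable_funM.
Qed.

Lemma cmeasurableB D f g :
  cmeasurable D f -> cmeasurable D g -> cmeasurable D (fun x => f x - g x).
Proof.
move=> mf mg.
have := cmeasurableD mf (cmeasurableM (cmeasurable_cst D (-1)) mg).
by under eq_fun do rewrite mulN1r.
Qed.

Lemma cmeasurable_conj D f :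
  cmeasurable D f -> cmeasurable D (fun x => conjc (f x)).
Proof.
move=> [f1 f2]; split; first by under eq_fun do rewrite Rec_conj.
by under eq_fun do rewrite Imc_conj; exact: measurableT_comp.
Qed.

Lemma cmeasurableX D f k :
  cmeasurable D f -> cmeasurable D (fun x => f x ^+ k).
Proof.
move=> mf; elim: k => [|k IH].
  by under eq_fun do rewrite expr0; exact: cmeasurable_cst.
by under eq_fun do rewrite exprS; exact: cmeasurableM.
Qed.

Lemma cmeasurable_prod D (I : Type) (r : seq I) (h : I -> T -> R[i]) :
  (forall i, cmeasurable D (h i)) ->
  cmeasurable D (fun x => \prod_(i <- r) h i x).
Proof.
move=> mh; elim: r => [|i r IH].
  by under eq_fun do rewrite big_nil; exact: cmeasurable_cst.
by under eq_fun do rewrite big_cons; exact: cmeasurableM.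
Qed.

Lemma cmeasurable_real D (h : T -> R) :
  measurable_fun D h -> cmeasurable D (fun x => (h x)%:C%C).
Proof. by move=> mh; split => //=; exact: measurable_cst. Qed.

Lemma measurable_sqr_normc D f :
  cmeasurable D f -> measurable_fun D (fun x => normc (f x) ^+ 2).
Proof.
move=> [f1 f2]; under eq_fun do rewrite sqr_normcE.
by apply: measurable_funD; exact: measurable_funX.
Qed.

Lemma measurable_normc D f :
  cmeasurable D f -> measurable_fun D (fun x => normc (f x)).
Proof.
move=> mf; have m2 := measurable_sqr_normc mf.
rewrite (_ : (fun x => _) = (fun x => Num.sqrt (normc (f x) ^+ 2))); last first.
  by apply/funext => x; rewrite sqrtr_sqr ger0_norm// normc_ge0.
apply: measurableT_comp => //; apply: continuous_measurable_fun.
exact: sqrt_continuous.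
Qed.

End cmeasurable.

Lemma cmeasurable_comp d d' (T : measurableType d) (T' : measurableType d')
    (R : realType) (h : T' -> T) (f : T -> R[i]) :
  measurable_fun setT h -> cmeasurable setT f -> cmeasurable setT (f \o h).
Proof.
move=> mh [f1 f2]; split.
  by rewrite (_ : (fun x => _) = (fun x => Re (f x)) \o h)//; exact: measurableT_comp.
by rewrite (_ : (fun x => _) = (fun x => Im (f x)) \o h)//; exact: measurableT_comp.
Qed.

Section cintegral.
Context {d} {T : measurableType d} {R : realType}.
Variable mu : {measure set T -> \bar R}.
Implicit Types (D : set T) (f g : T -> R[i]).

Definition cintegrable D f := mu.-integrable D (EFin \o (fun x => Re (f x))) /\
  mu.-integrable D (EFin \o (fun x => Im (f x))).

Definition cint D f : R[i] :=
  Complex (\int[mu]_(x in D) Re (f x)) (\int[mu]_(x in D) Im (f x)).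

Lemma eq_cint D f g : {in D, f =1 g} -> cint D f = cint D g.
Proof.
by move=> fg; congr Complex; apply: eq_Rintegral => x xD; rewrite fg.
Qed.

Section fixed_domain.
Variable D : set T.
Hypothesis mD : measurable D.

Lemma cintegrable_measurable f : cintegrable D f -> cmeasurable D f.
Proof. by move=> [/measurable_int f1 /measurable_int f2]; split; exact/measurable_EFinP. Qed.

Lemma cintegrable_normc f : cintegrable D f ->
  mu.-integrable D (EFin \o (fun x => normc (f x))).
Proof.
move=> fi; have [f1 f2] := fi; have mf := cintegrable_measurable fi.
apply: (le_integrable mD _ _ (integrableD mD (integrable_abse f1) (integrable_abse f2))).
  by apply/measurable_EFinP; exact: measurable_normc.
move=> x _ /=; rewrite lee_fin ger0_norm ?normc_ge0//.
by rewrite [leRHS]ger0_norm ?addr_ge0// normc_leD.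
Qed.

Lemma le_cintegrable f (h : T -> R) : cmeasurable D f ->
  (forall x, D x -> normc (f x) <= h x) -> mu.-integrable D (EFin \o h) ->
  cintegrable D f.
Proof.
move=> [m1 m2] fh hi; split.
  apply: (le_integrable mD _ _ hi); first exact/measurable_EFinP.
  move=> x Dx /=; rewrite lee_fin (le_trans (le_Re_normc _))//.
  by rewrite (le_trans (fh _ Dx))// ler_norm.
apply: (le_integrable mD _ _ hi); first exact/measurable_EFinP.
move=> x Dx /=; rewrite lee_fin (le_trans (le_Im_normc _))//.
by rewrite (le_trans (fh _ Dx))// ler_norm.
Qed.

Lemma cintegrableD f g : cintegrable D f -> cintegrable D g ->
  cintegrable D (fun x => f x + g x).
Proof.
move=> [f1 f2] [g1 g2]; split.
  apply: eq_integrable (integrableD mD f1 g1) => // x _ /=.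
  by rewrite RecD.
apply: eq_integrable (integrableD mD f2 g2) => // x _ /=.
by rewrite ImcD.
Qed.

Lemma cintD f g : cintegrable D f -> cintegrable D g ->
  cint D (fun x => f x + g x) = cint D f + cint D g.
Proof.
move=> [f1 f2] [g1 g2]; apply: complex_eq => /=.
  by rewrite -RintegralD//; apply: eq_Rintegral => x _; rewrite RecD.
by rewrite -RintegralD//; apply: eq_Rintegral => x _; rewrite ImcD.
Qed.

Lemma cintegrableZ (c : R[i]) f : cintegrable D f ->
  cintegrable D (fun x => c * f x).
Proof.
move=> [f1 f2]; split.
  apply: eq_integrable (integrableB mD (integrableZl mD (Re c) f1)
    (integrableZl mD (Im c) f2)) => // x _ /=.
  by rewrite RecM EFinB.
apply: eq_integrable (integrableD mD (integrableZl mD (Re c) f2)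
    (integrableZl mD (Im c) f1)) => // x _ /=.
by rewrite ImcM EFinD.
Qed.

Lemma cintZ (c : R[i]) f : cintegrable D f ->
  cint D (fun x => c * f x) = c * cint D f.
Proof.
move=> [f1 f2].
have Z (r : R) (h : T -> R) : mu.-integrable D (EFin \o h) ->
    mu.-integrable D (EFin \o (fun x => r * h x)).
  by move=> hi; apply: eq_integrable (integrableZl mD r hi) => // x _.
apply: complex_eq => /=.
  rewrite RecM /= -!RintegralZl// -RintegralB//; try exact: Z.
  by apply: eq_Rintegral => x _; rewrite RecM.
rewrite ImcM /= -!RintegralZl// -RintegralD//; try exact: Z.
by apply: eq_Rintegral => x _; rewrite ImcM.
Qed.

Lemma cintegrableB f g : cintegrable D f -> cintegrable D g ->
  cintegrable D (fun x => f x - g x).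
Proof.
move=> fi gi; have := cintegrableD fi (cintegrableZ (-1) gi).
by under eq_fun do rewrite mulN1r.
Qed.

Lemma cintB f g : cintegrable D f -> cintegrable D g ->
  cint D (fun x => f x - g x) = cint D f - cint D g.
Proof.
move=> fi gi; have := cintD fi (cintegrableZ (-1) gi).
by rewrite cintZ// mulN1r; under eq_fun do rewrite mulN1r.
Qed.

Lemma cintegrable_conj f : cintegrable D f ->
  cintegrable D (fun x => conjc (f x)).
Proof.
move=> [f1 f2]; split.
  by apply: eq_integrable f1 => // x _ /=; rewrite Rec_conj.
apply: eq_integrable (integrableN f2) => // x _ /=.
by rewrite Imc_conj.
Qed.

Lemma cint_conj f : cintegrable D f ->
  cint D (fun x => conjc (f x)) = conjc (cint D f).
Proof.
move=> [f1 f2]; apply: complex_eq => /=.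
  by apply: eq_Rintegral => x _; rewrite Rec_conj.
rewrite -mulN1r -RintegralZl//.
by apply: eq_Rintegral => x _; rewrite Imc_conj mulN1r.
Qed.

Lemma normc_cint f : cintegrable D f ->
  normc (cint D f) <= 2 * \int[mu]_(x in D) normc (f x).
Proof.
move=> fi; have ni := cintegrable_normc fi; have [f1 f2] := fi.
have N1 := integrable_norm f1; have N2 := integrable_norm f2.
apply: le_trans (normc_leD _) _ => /=; rewrite mulr2n mulrDl mul1r lerD//.
  apply: le_trans (le_normr_Rintegral mD f1) _; apply: le_Rintegral => //.
  by move=> x _; exact: le_Re_normc.
apply: le_trans (le_normr_Rintegral mD f2) _; apply: le_Rintegral => //.
by move=> x _; exact: le_Im_normc.
Qed.

Lemma cintegrable_real (h : T -> R) : mu.-integrable D (EFin \o h) ->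
  cintegrable D (fun x => (h x)%:C%C).
Proof. by move=> hi; split => //=; exact: integrable0. Qed.

Lemma cint_real (h : T -> R) : mu.-integrable D (EFin \o h) ->
  cint D (fun x => (h x)%:C%C) = (\int[mu]_(x in D) h x)%:C%C.
Proof.
move=> hi; apply: complex_eq => //=.
by rewrite Rintegral_cst// mul0r.
Qed.

Lemma cint_sum (I : Type) (r : seq I) (h : I -> T -> R[i]) :
  (forall i, cintegrable D (h i)) ->
  cintegrable D (fun x => \sum_(i <- r) h i x) /\
  cint D (fun x => \sum_(i <- r) h i x) = \sum_(i <- r) cint D (h i).
Proof.
move=> hi; elim: r => [|i r [IH1 IH2]].
  under [X in cintegrable D X]eq_fun do rewrite big_nil.
  under [X in cint D X]eq_fun do rewrite big_nil.
  split; first by split => /=; exact: integrable0.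
  by rewrite big_nil; apply: complex_eq => /=; rewrite Rintegral_cst// mul0r.
under [X in cintegrable D X]eq_fun do rewrite big_cons.
under [X in cint D X]eq_fun do rewrite big_cons.
by rewrite big_cons cintD// IH2; split => //; exact: cintegrableD.
Qed.

End fixed_domain.

Section finite_domain.
Variable D : set T.
Hypotheses (mD : measurable D) (Doo : (mu D < +oo)%E).

Lemma cintegrable_bounded f (K : R) : cmeasurable D f ->
  (forall x, D x -> normc (f x) <= K) -> cintegrable D f.
Proof.
move=> mf fK; apply: (@le_cintegrable D mD f (fun=> K)) => //.
apply: measurable_bounded_integrable => //.
by exists `|K|; split; [exact: num_real|move=> M KM x Dx /=; exact: ltW].
Qed.

End finite_domain.

End cintegral.

(** * Cauchy's theorem on circles *)

Section segments.
Context {R : realType}.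
Local Notation mu := (@lebesgue_measure R).
Implicit Types (g : R -> R[i]) (a b : R).

Definition ccontinuous_at g (x : R) := forall e : R, 0 < e ->
  exists2 d : R, 0 < d & forall h, `|h| < d -> normc (g (x + h) - g x) <= e.

Lemma ccontinuous_Re g x : ccontinuous_at g x ->
  {for x, continuous (fun t => Re (g t))}.
Proof.
move=> gc; apply/cvgrPdist_le => e e0; have [d d0 hd] := gc _ e0.
near=> t; have tx : `|t - x| < d.
  by rewrite distrC; near: t; apply: cvgr_dist_lt.
have := hd _ tx; rewrite subrKC; apply: le_trans.
by rewrite -RecN -RecD normc_distC le_Re_normc.
Unshelve. all: by end_near. Qed.

Lemma ccontinuous_Im g x : ccontinuous_at g x ->
  {for x, continuous (fun t => Im (g t))}.
Proof.
move=> gc; apply/cvgrPdist_le => e e0; have [d d0 hd] := gc _ e0.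
near=> t; have tx : `|t - x| < d.
  by rewrite distrC; near: t; apply: cvgr_dist_lt.
have := hd _ tx; rewrite subrKC; apply: le_trans.
by rewrite -ImcN -ImcD normc_distC le_Im_normc.
Unshelve. all: by end_near. Qed.

Definition segint g a b : R[i] := cint mu `[a, b] g.

Lemma cintegrable_segment g a b : {in `[a, b], forall x, ccontinuous_at g x} ->
  cintegrable mu `[a, b] g.
Proof.
move=> gc; split; apply: continuous_compact_integrable;
  try exact: segment_compact; apply: continuous_in_subspaceT => x;
  rewrite inE => /gc; [exact: ccontinuous_Re|exact: ccontinuous_Im].
Qed.

Lemma segint_cat g a b c : a <= b -> b <= c ->
  {in `[a, c], forall x, ccontinuous_at g x} ->
  segint g a c = segint g a b + segint g b c.
Proof.
move=> ab bc gc; have [g1 g2] := cintegrable_segment gc.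
have H (f : R -> R) : mu.-integrable `[a, c] (EFin \o f) ->
    \int[mu]_(x in `[a, c]) f x =
    \int[mu]_(x in `[a, b]) f x + \int[mu]_(x in `[b, c]) f x.
  move=> fi; apply/eqP; rewrite addrC -subr_eq; apply/eqP.
  rewrite Rintegral_itvB ?bnd_simp// Rintegral_itv_obnd_cbnd//.
  apply: integrableS fi => //; apply: subset_itvr; by rewrite bnd_simp.
by apply: complex_eq; rewrite ?RecD ?ImcD /= H.
Qed.

Lemma lebesgue_segment a b : a <= b -> mu `[a, b] = (b - a)%:E.
Proof.
rewrite le_eqVlt => /predU1P[->|ab].
  by rewrite set_itv1 lebesgue_measure_set1 subrr.
by rewrite lebesgue_measure_itv /= lte_fin ab EFinB.
Qed.

Lemma segint_cst (c : R[i]) a b : a <= b ->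
  segint (fun=> c) a b = (b - a)%:C%C * c.
Proof.
move=> ab; have E (r : R) : \int[mu]_(x in `[a, b]) r = (b - a) * r.
  rewrite Rintegral_cst//= /fine mulrC; congr (_ * _).
  by rewrite lebesgue_segment.
apply: complex_eq; rewrite /segint /cint [LHS]/= E.

  by rewrite RecM /= mul0r subr0.
by rewrite ImcM /= mul0r addr0.
Qed.

Lemma normc_segint g a b (K : R) : a <= b -> cintegrable mu `[a, b] g ->
  {in `[a, b], forall x, normc (g x) <= K} ->
  normc (segint g a b) <= 2 * (b - a) * K.
Proof.
move=> ab gi gK; apply: le_trans (normc_cint _ gi) _ => //.
rewrite -mulrA ler_pM2l//.
have -> : (b - a) * K = \int[mu]_(x in `[a, b]) K.
  by rewrite Rintegral_cst//= mulrC; congr (_ * _); rewrite lebesgue_segment.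
apply: le_Rintegral => //.
- exact: cintegrable_normc.
- have oo : (mu `[a, b] < +oo)%E by rewrite lebesgue_segment// ltry.
  apply: measurable_bounded_integrable => //.
  by exists `|K|; split; [exact: num_real|move=> M KM x Dx /=; exact: ltW].
Qed.

End segments.

Section complex_derivative.
Context {R : realType}.
Implicit Types (F G : R[i] -> R[i]) (p q A B h : R[i]).

Definition cder F p A := forall e : R, 0 < e -> exists2 d : R, 0 < d &
  forall h, normc h < d -> normc (F (p + h) - F p - A * h) <= e * normc h.

Lemma cder_lip F p A : cder F p A -> exists2 d : R, 0 < d &
  forall h, normc h < d -> normc (F (p + h) - F p) <= (normc A + 1) * normc h.
Proof.
move=> /(_ 1 ltr01)[d d0 hd]; exists d => // h /hd H.
rewrite -[X in normc X](subrK (A * h)) (le_trans (le_normcD _ _))//.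
by rewrite mulrDl addrC lerD// normcM.
Qed.

Lemma cder_continuous F p A (u : R -> R[i]) (x : R) : u x = p ->
  (forall h : R, normc (u (x + h) - u x) <= `|h|) -> cder F p A ->
  ccontinuous_at (F \o u) x.
Proof.
move=> ux lu /cder_lip[d d0 hd] e e0.
have A1 : 0 < normc A + 1 by rewrite ltr_wpDl// normc_ge0.
exists (Num.min d (e / (normc A + 1))).
  by rewrite lt_min d0 divr_gt0.
move=> h; rewrite lt_min => /andP[h1 h2] /=.
have := hd (u (x + h) - u x); rewrite ux subrKC => H.
apply: le_trans (H _) _; first by rewrite -ux (le_lt_trans (lu h)).
by rewrite mulrC -ler_pdivlMr// -ux (le_trans (lu h))// ltW.
Qed.

Lemma cder_cst (c p : R[i]) : cder (fun=> c) p 0.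
Proof.
move=> e e0; exists 1 => // h _.
by rewrite subrr mul0r subr0 ComplexField.Normc.normc0 mulr_ge0 ?normc_ge0// ltW.
Qed.

Lemma ler_div_succM (e k x : R) : 0 <= e -> 0 < k -> 0 <= x ->
  e / (k * (x + 1)) * x <= e / k.
Proof.
move=> e0 k0 x0; have x1 : 0 < x + 1 by rewrite ltr_wpDl.
rewrite invfM mulrA -mulrA; apply: ler_piMr; first by rewrite divr_ge0// ltW.
by rewrite mulrC ler_pdivrMr// mul1r lerDl.
Qed.

Lemma cderM F G p A B : cder F p A -> cder G p B ->
  cder (fun z => F z * G z) p (A * G p + F p * B).
Proof.
move=> dF dG e e0.
set NF := normc (F p); set NG := normc (G p); set K := normc B + 1.
have [d1 d10 h1] := cder_lip dG.
have NA : 0 <= normc A by exact: normc_ge0.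
have NF0 : 0 <= NF by exact: normc_ge0.
have NG0 : 0 <= NG by exact: normc_ge0.
have K0 : 0 < K by rewrite ltr_wpDl// normc_ge0.
have e1 : 0 < e / (3 * (NG + 1)) by rewrite divr_gt0// mulr_gt0// ltr_wpDl.
have e2 : 0 < e / (3 * (NF + 1)) by rewrite divr_gt0// mulr_gt0// ltr_wpDl.
have [d2 d20 h2] := dF _ e1; have [d3 d30 h3] := dG _ e2.
have [d4 d40 h4] := cder_lip dF.
set r := e / (3 * (K * (normc A + 1))).
have r0 : 0 < r by rewrite divr_gt0// mulr_gt0// mulr_gt0// ltr_wpDl.
exists (Num.min (Num.min d1 d2) (Num.min (Num.min d3 d4) r)).
  by rewrite !lt_min d10 d20 d30 d40 r0.
move=> h; rewrite !lt_min => /andP[/andP[l1 l2] /andP[/andP[l3 l4] l5]].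
set f := F (p + h) - F p; set g := G (p + h) - G p.
have -> : F (p + h) * G (p + h) - F p * G p - (A * G p + F p * B) * h =
    (f - A * h) * G p + F p * (g - B * h) + f * g by rewrite /f /g; ring.
have H1 := h1 _ l1; have H2 := h2 _ l2; have H3 := h3 _ l3; have H4 := h4 _ l4.
rewrite -/g -/K in H1; rewrite -/f in H2; rewrite -/g in H3; rewrite -/f in H4.
have nh := normc_ge0 h.
apply: le_trans (le_normcD _ _) _.
apply: (@le_trans _ _ ((e / 3 * normc h + e / 3 * normc h) + e / 3 * normc h)); last first.
  by rewrite -!mulrDl (_ : (e + e + e) / 3 = e)//; field.
apply: lerD; first apply: le_trans (le_normcD _ _) _; first apply: lerD.
- rewrite normcM; apply: le_trans (ler_wpM2r NG0 H2) _.
  by rewrite mulrAC ler_wpM2r// ler_div_succM// ltW.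
- rewrite normcM; apply: le_trans (ler_wpM2l NF0 H3) _.
  by rewrite mulrA ler_wpM2r// mulrC ler_div_succM// ltW.
- rewrite normcM; apply: le_trans (ler_pM _ _ H4 H1) _; rewrite ?normc_ge0//.
  rewrite mulrA ler_wpM2r//.
  have -> : (normc A + 1) * normc h * K = normc h * (K * (normc A + 1)) by ring.
  rewrite -ler_pdivlMr ?mulr_gt0 ?ltr_wpDl//.
  apply: ltW; apply: lt_le_trans l5 _.
  by rewrite /r invfM mulrA.
exact: normc_ge0.
Qed.

Lemma cder_comp F G p A B : cder G p B -> cder F (G p) A ->
  cder (F \o G) p (A * B).
Proof.
move=> dG dF e e0.
have [d1 d10 h1] := cder_lip dG.
set K := normc B + 1; have K0 : 0 < K by rewrite ltr_wpDl// normc_ge0.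
have NA : 0 <= normc A by exact: normc_ge0.
have e1 : 0 < e / (2 * K) by rewrite divr_gt0// mulr_gt0.
have e2 : 0 < e / (2 * (normc A + 1)) by rewrite divr_gt0// mulr_gt0// ltr_wpDl.
have [d2 d20 h2] := dF _ e1; have [d3 d30 h3] := dG _ e2.
exists (Num.min (Num.min d1 d3) (d2 / K)); first by rewrite !lt_min d10 d30 divr_gt0.
move=> h; rewrite !lt_min => /andP[/andP[l1 l3] l2] /=.
set g := G (p + h) - G p.
have H1 := h1 _ l1; have H3 := h3 _ l3.
rewrite -/g -/K in H1; rewrite -/g in H3.
have H2 : normc (F (G p + g) - F (G p) - A * g) <= e / (2 * K) * normc g.
  by apply: h2; apply: le_lt_trans H1 _; rewrite mulrC -ltr_pdivlMr.
rewrite (_ : G p + g = G (p + h)) in H2; last by rewrite /g subrKC.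
rewrite (_ : _ - _ = (F (G (p + h)) - F (G p) - A * g) + A * (g - B * h)); last by ring.
apply: le_trans (le_normcD _ _) _.
apply: (@le_trans _ _ (e / 2 * normc h + e / 2 * normc h)); last first.
  by rewrite -mulrDl -splitr.
have nh := normc_ge0 h.
apply: lerD.
  apply: le_trans H2 _; apply: le_trans (ler_wpM2l _ H1) _; first exact: ltW.
  rewrite mulrA ler_wpM2r// (_ : e / (2 * K) * K = e / 2)//.
  by field; exact: lt0r_neq0.
rewrite normcM; apply: le_trans (ler_wpM2l NA H3) _.
by rewrite mulrA ler_wpM2r// mulrC ler_div_succM// ltW.
Qed.

End complex_derivative.

Section goursat.
Context {R : realType}.
Variable H : R[i] -> R[i].
Implicit Types a b c d x y : R.

Definition rect a b c d (p : R[i]) := a <= Re p <= b /\ c <= Im p <= d.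

Definition cder_on (S : R[i] -> Prop) := forall p, S p -> exists A, cder H p A.

Definition rectint a b c d : R[i] :=
  segint (fun x => H (Complex x c)) a b - segint (fun x => H (Complex x d)) a b
  + Complex 0 1 * (segint (fun y => H (Complex b y)) c d -
                   segint (fun y => H (Complex a y)) c d).

Arguments rectint : simpl never.

Lemma rect_sub a b c d a' b' c' d' p : a <= a' -> b' <= b -> c <= c' -> d' <= d ->
  rect a' b' c' d' p -> rect a b c d p.
Proof.
move=> aa bb cc dd [/andP[h1 h2] /andP[h3 h4]]; split; apply/andP; split.
- exact: le_trans aa h1.
- exact: le_trans h2 bb.
- exact: le_trans cc h3.
- exact: le_trans h4 dd.
Qed.

Lemma horizontal_continuous a b c d y : c <= y <= d -> cder_on (rect a b c d) ->
  {in `[a, b], forall x, ccontinuous_at (fun x => H (Complex x y)) x}.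
Proof.
move=> cyd dH x; rewrite in_itv /= => axb.
have [A hA] : exists A, cder H (Complex x y) A by apply: dH; split.
apply: (cder_continuous (u := fun x => Complex x y) _ _ hA) => // h.
by rewrite normcE /= subrr expr0n addr0 sqrtr_sqr addrAC subrr add0r.
Qed.

Lemma vertical_continuous a b c d x : a <= x <= b -> cder_on (rect a b c d) ->
  {in `[c, d], forall y, ccontinuous_at (fun y => H (Complex x y)) y}.
Proof.
move=> axb dH y; rewrite in_itv /= => cyd.
have [A hA] : exists A, cder H (Complex x y) A by apply: dH; split.
apply: (cder_continuous (u := fun y => Complex x y) _ _ hA) => // h.
by rewrite normcE /= subrr expr0n add0r sqrtr_sqr addrAC subrr add0r.
Qed.

Lemma rectint_split a b c d m m' : a <= m <= b -> c <= m' <= d ->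
  cder_on (rect a b c d) ->
  rectint a b c d = rectint a m c m' + rectint m b c m' +
                    rectint a m m' d + rectint m b m' d.
Proof.
move=> /andP[am mb] /andP[cm md] dH.
have ab := le_trans am mb; have cd := le_trans cm md.
have h y : c <= y <= d -> segint (fun x => H (Complex x y)) a b =
    segint (fun x => H (Complex x y)) a m + segint (fun x => H (Complex x y)) m b.
  by move=> cyd; apply: segint_cat => //; exact: (horizontal_continuous cyd dH).
have v x : a <= x <= b -> segint (fun y => H (Complex x y)) c d =
    segint (fun y => H (Complex x y)) c m' + segint (fun y => H (Complex x y)) m' d.
  by move=> axb; apply: segint_cat => //; exact: (vertical_continuous axb dH).
rewrite /rectint (h c) ?lexx// (h d) ?lexx ?andbT// (v a) ?lexx// (v b) ?lexx ?andbT//.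
set i := Complex 0 1; ring.
Qed.

(** An affine function has zero contour integral, so only the remainder of the
   first-order expansion contributes. *)
Lemma rectint_estimate a b c d p A e : a <= b -> c <= d -> 0 <= e ->
  cder_on (rect a b c d) -> rect a b c d p ->
  (forall q, rect a b c d q -> normc (H q - H p - A * (q - p)) <= e * normc (q - p)) ->
  normc (rectint a b c d) <= 4 * e * ((b - a) + (d - c)) ^+ 2.
Proof.
move=> ab cd e0 dH pQ HA.
set w := b - a; set l := d - c.
have w0 : 0 <= w by rewrite subr_ge0.
have l0 : 0 <= l by rewrite subr_ge0.
have diam q : rect a b c d q -> normc (q - p) <= w + l.
  move: pQ => [/andP[? ?] /andP[? ?]] [/andP[? ?] /andP[? ?]].
  apply: le_trans (normc_leD _) _; rewrite RecD RecN ImcD ImcN /w /l.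
  by rewrite lerD// ler_norml; apply/andP; split; lra.
have HA' q : rect a b c d q -> normc (H q - H p - A * (q - p)) <= e * (w + l).
  by move=> qQ; apply: le_trans (HA _ qQ) _; rewrite ler_wpM2l// diam.
have cdd : c <= d <= d by rewrite cd lexx.
have ccd : c <= c <= d by rewrite cd lexx.
have abb : a <= b <= b by rewrite ab lexx.
have aab : a <= a <= b by rewrite ab lexx.
have two q q' k : rect a b c d q -> rect a b c d q' -> q' - q = k ->
    normc (H q' - H q - A * k) <= 2 * (e * (w + l)).
  move=> qQ q'Q <-.
  have -> : H q' - H q - A * (q' - q) = (H q' - H p - A * (q' - p)) -
    (H q - H p - A * (q - p)) by ring.
  by apply: le_trans (normcB _ _) _; rewrite mulr2n mulrDl mul1r lerD// HA'.
have ci g u v : {in `[u, v], forall x, ccontinuous_at g x} ->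
    cintegrable lebesgue_measure `[u, v] g by exact: cintegrable_segment.
have cc (k : R[i]) u v : cintegrable lebesgue_measure `[u, v] (fun=> k).
  apply: ci => x _ r r0; exists 1 => // h _.
  by rewrite subrr ComplexField.Normc.normc0 ltW.
have mI (u v : R) : measurable (`[u, v]%classic : set (measurableTypeR R)).
  exact: measurable_itv.
pose k := Complex 0 (c - d); pose k' := Complex (b - a) 0.
have -> : rectint a b c d =
  segint (fun x => H (Complex x c) - H (Complex x d) - A * k) a b +
  Complex 0 1 * segint (fun y => H (Complex b y) - H (Complex a y) - A * k') c d.
  rewrite /rectint /segint !cintB//;
    try (do ?[apply: cintegrableB => //]; apply: ci;
         by [exact: (vertical_continuous _ dH)|exact: (horizontal_continuous _ dH)]).
  rewrite -!/(segint _ _ _) !segint_cst//.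
  have Z : w%:C%C * (A * k) + Complex 0 1 * (l%:C%C * (A * k')) = 0.
    have -> : k = - (Complex 0 1 * l%:C%C).
      by apply: complex_eq; rewrite /= /l; ring.
    have -> : k' = w%:C%C by [].
    ring.
  by rewrite -[LHS]subr0 -Z -/w -/l; ring.
have Kw : normc (segint (fun x => H (Complex x c) - H (Complex x d) - A * k) a b)
    <= 2 * w * (2 * (e * (w + l))).
  apply: normc_segint => //.
    by do 2 apply: cintegrableB => //; apply: ci; exact: (horizontal_continuous _ dH).
  move=> x; rewrite in_itv /= => axb; apply: two; [by split|by split|].
  by apply: complex_eq => /=; [rewrite subrr|].
have Kl : normc (segint (fun y => H (Complex b y) - H (Complex a y) - A * k') c d)
    <= 2 * l * (2 * (e * (w + l))).
  apply: normc_segint => //.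
    by do 2 apply: cintegrableB => //; apply: ci; exact: (vertical_continuous _ dH).
  move=> x; rewrite in_itv /= => axb; apply: two; [by split|by split|].
  by apply: complex_eq => /=; [|rewrite subrr].
apply: le_trans (le_normcD _ _) _; rewrite normcM.
have -> : normc (Complex 0 1 : R[i]) = 1 by rewrite normcE /= expr0n add0r expr1n sqrtr1.
rewrite mul1r; apply: le_trans (lerD Kw Kl) _.
by rewrite le_eqVlt; apply/orP; left; apply/eqP; ring.
Qed.

Lemma pow2_small (s d : R) : 0 < d -> exists k, s / 2 ^+ k < d.
Proof.
move=> d0; exists (Num.truncn (`|s| / d)).+1.
have H1 : `|s| / d < (2 ^+ (Num.truncn (`|s| / d)).+1).
  apply: lt_le_trans (truncnS_gt _) _.
  by rewrite -natrX ler_nat ltnW// ltn_expl.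
rewrite ltr_pdivrMr ?exprn_gt0//; apply: le_lt_trans (ler_norm _) _.
by rewrite mulrC -ltr_pdivrMr.
Qed.

Lemma nested_point (u : nat -> R) (w : R) : 0 <= w ->
  (forall k, u k <= u k.+1 /\ u k.+1 + w / 2 ^+ k.+1 <= u k + w / 2 ^+ k) ->
  exists p, forall k, u k <= p <= u k + w / 2 ^+ k.
Proof.
move=> w0 hu.
have wk k : 0 <= w / 2 ^+ k by rewrite divr_ge0// exprn_ge0.
have up j k : (j <= k)%N -> u j <= u k.
  move=> /subnK <-; elim: (k - j)%N => // m IH.
  by rewrite addSn (le_trans IH)//; have [] := hu (m + j)%N.
have dn j k : (j <= k)%N -> u k + w / 2 ^+ k <= u j + w / 2 ^+ j.
  move=> /subnK <-; elim: (k - j)%N => // m IH.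
  by rewrite addSn; apply: le_trans IH; have [] := hu (m + j)%N.
have bd j k : u j <= u k + w / 2 ^+ k.
  have [jk|/ltnW kj] := leqP j k.
    by rewrite (le_trans (up _ _ jk))// lerDl.
  by apply: le_trans (dn _ _ kj); rewrite lerDl.
have hub : has_ubound (range u).
  by exists (u 0 + w / 2 ^+ 0) => _ [j _ <-]; exact: bd.
exists (sup (range u)) => k; apply/andP; split.
  by apply: ub_le_sup => //; exists k.
apply: ge_sup; first by exists (u 0); exists 0.
by move=> _ [j _ <-]; exact: bd.
Qed.

(** Goursat: bisecting both sides, some quarter carries at least a quarter of
   the contour integral; at the common point of the resulting nested rectangles
   the first-order expansion makes the integral too small. *)
Lemma goursat a b c d : a <= b -> c <= d -> cder_on (rect a b c d) ->
  rectint a b c d = 0.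
Proof.
move=> ab cd dH; set w := b - a; set l := d - c.
have w0 : 0 <= w by rewrite subr_ge0.
have l0 : 0 <= l by rewrite subr_ge0.
pose Wk k : R := w / 2 ^+ k; pose Lk k : R := l / 2 ^+ k.
have Wk0 k : 0 <= Wk k by rewrite divr_ge0// exprn_ge0.
have Lk0 k : 0 <= Lk k by rewrite divr_ge0// exprn_ge0.
have half (s : R) k : s / 2 ^+ k = s / 2 ^+ k.+1 + s / 2 ^+ k.+1.
  by rewrite exprS; field; rewrite expf_neq0.
have [I IE] : exists I : R * R * nat -> R, forall s,
    I s = normc (rectint s.1.1 (s.1.1 + Wk s.2) s.1.2 (s.1.2 + Lk s.2)) by eexists.
pose inside (s : R * R * nat) :=
  [/\ a <= s.1.1, s.1.1 + Wk s.2 <= b, c <= s.1.2 & s.1.2 + Lk s.2 <= d].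
pose step (s t : R * R * nat) := inside s ->
  [/\ inside t, t.2 = s.2.+1,
    s.1.1 <= t.1.1 /\ t.1.1 + Wk t.2 <= s.1.1 + Wk s.2,
    s.1.2 <= t.1.2 /\ t.1.2 + Lk t.2 <= s.1.2 + Lk s.2 & I s <= 4 * I t].
have exstep s : exists t, step s t.
  have [ins|] := pselect (inside s); last by move=> nins; exists s.
  case: s ins => -[x y] k [/= h1 h2 h3 h4].
  have hW := half w k; have hL := half l k; rewrite -!/(Wk _) in hW; rewrite -!/(Lk _) in hL.
  have W1 := Wk0 k.+1; have L1 := Lk0 k.+1.
  have dQ : cder_on (rect x (x + Wk k) y (y + Lk k)).
    by move=> p pQ; apply: dH; exact: (rect_sub _ _ _ _ pQ).
  have hx' : x + Wk k = x + Wk k.+1 + Wk k.+1 by rewrite hW addrA.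
  have hy' : y + Lk k = y + Lk k.+1 + Lk k.+1 by rewrite hL addrA.
  have E : rectint x (x + Wk k) y (y + Lk k) =
      rectint x (x + Wk k.+1) y (y + Lk k.+1) +
      rectint (x + Wk k.+1) (x + Wk k.+1 + Wk k.+1) y (y + Lk k.+1) +
      rectint x (x + Wk k.+1) (y + Lk k.+1) (y + Lk k.+1 + Lk k.+1) +
      rectint (x + Wk k.+1) (x + Wk k.+1 + Wk k.+1) (y + Lk k.+1) (y + Lk k.+1 + Lk k.+1).
    by rewrite -hx' -hy'; apply: rectint_split => //; apply/andP; split; lra.
  pose s1 := (x, y, k.+1); pose s2 := (x + Wk k.+1, y, k.+1).
  pose s3 := (x, y + Lk k.+1, k.+1); pose s4 := (x + Wk k.+1, y + Lk k.+1, k.+1).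
  have E4 : I (x, y, k) <= I s1 + I s2 + I s3 + I s4.
    rewrite !IE [X in normc X <= _]E; apply: le_trans (le_normcD _ _) _; rewrite lerD2r.
    apply: le_trans (le_normcD _ _) _; rewrite lerD2r; exact: le_normcD.
  have mk u v : x <= u -> u + Wk k.+1 <= x + Wk k -> y <= v ->
      v + Lk k.+1 <= y + Lk k -> I (x, y, k) <= 4 * I (u, v, k.+1) ->
      [/\ inside (u, v, k.+1), k.+1 = k.+1, x <= u /\ u + Wk k.+1 <= x + Wk k,
        y <= v /\ v + Lk k.+1 <= y + Lk k & I (x, y, k) <= 4 * I (u, v, k.+1)].
    move=> i1 i2 i3 i4 i5; split=> //; split => /=.
    - exact: le_trans h1 i1.
    - exact: le_trans i2 h2.
    - exact: le_trans h3 i3.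
    - exact: le_trans i4 h4.
  have [t1|t1] := leP (I (x, y, k)) (4 * I s1).
    by exists s1 => _; apply: mk => /=; lra.
  have [t2|t2] := leP (I (x, y, k)) (4 * I s2).
    by exists s2 => _; apply: mk => /=; lra.
  have [t3|t3] := leP (I (x, y, k)) (4 * I s3).
    by exists s3 => _; apply: mk => /=; lra.
  have t4 : I (x, y, k) <= 4 * I s4 by lra.
  by exists s4 => _; apply: mk => /=; lra.
have [f fP] := choice exstep.
pose S k := iter k f (a, c, 0%N).
have in0 : inside (a, c, 0%N) by rewrite /inside /Wk /Lk /= expr0 !divr1 /w /l !subrKC.
have inS k : inside (S k) by elim: k => // k /fP[].
have S2 k : (S k).2 = k.
  by elim: k => // k IH; have [_ E _ _ _] := fP _ (inS k); rewrite /= -/(S k) E IH.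
have [px hx] : exists p, forall k, (S k).1.1 <= p <= (S k).1.1 + w / 2 ^+ k.
  apply: nested_point => // k; have [_ _ [E1 E2] _ _] := fP _ (inS k).
  by move: E2; rewrite (_ : f (S k) = S k.+1)// /Wk !S2; split.
have [py hy] : exists p, forall k, (S k).1.2 <= p <= (S k).1.2 + l / 2 ^+ k.
  apply: nested_point => // k; have [_ _ _ [E1 E2] _] := fP _ (inS k).
  by move: E2; rewrite (_ : f (S k) = S k.+1)// /Lk !S2; split.
have IS k : I (S 0) <= 4 ^+ k * I (S k).
  elim: k => [|k IH]; first by rewrite expr0 mul1r.
  apply: le_trans IH _; rewrite exprSr -mulrA ler_wpM2l ?exprn_ge0//.
  by have [_ _ _ _ ?] := fP _ (inS k).
have I0 : I (S 0) = normc (rectint a b c d).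
  by rewrite IE /= /Wk /Lk expr0 !divr1 /w /l !subrKC.
apply/eqP; rewrite -normc_eq0 eq_le normc_ge0 andbT; rewrite leNgt; apply/negP => I0gt.
pose p := Complex px py.
have [A hA] : exists A, cder H p A.
  apply: dH; have := hx 0%N; have := hy 0%N; rewrite /= !expr0 !divr1 !subrKC.
  by split.
set D := (w + l) ^+ 2.
have D0 : 0 <= D by rewrite exprn_ge0// addr_ge0.
set N0 := normc (rectint a b c d) in I0gt I0.
pose e := N0 / (5 * (D + 1)).
have e0 : 0 < e by rewrite divr_gt0// mulr_gt0// ltr_wpDl.
have [dl dl0 hd] := hA _ e0.
have [k hk] := pow2_small (w + l) dl0.
have [q1 q2 q3 q4] := inS k; rewrite S2 in q2 q4.
have Ik : I (S k) <= 4 * e * (Wk k + Lk k) ^+ 2.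
  have := @rectint_estimate (S k).1.1 ((S k).1.1 + Wk k) (S k).1.2 ((S k).1.2 + Lk k) p A e.
  rewrite IE !S2 ![_ + _ - _]addrAC !subrr !add0r; apply.
  - by rewrite lerDl.
  - by rewrite lerDl.
  - exact: ltW.
  - by move=> q qQ; apply: dH; exact: (rect_sub _ _ _ _ qQ).
  - by split; [exact: hx|exact: hy].
  move=> q qQ; rewrite -[q in H q](subrKC p); apply: hd.
  apply: le_lt_trans hk; rewrite mulrDl -/(Wk k) -/(Lk k).
  have /andP[hx1 hx2] := hx k; have /andP[hy1 hy2] := hy k.
  case: qQ => /andP[? ?] /andP[? ?].
  apply: le_trans (normc_leD _) _; rewrite RecD RecN ImcD ImcN.
  rewrite -!/(Wk _) -!/(Lk _) in hx2 hy2.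
  by rewrite lerD// ler_norml /=; apply/andP; split; lra.
have := IS k; rewrite I0; apply/negP; rewrite -ltNge.
apply: le_lt_trans (ler_wpM2l _ Ik) _; first by rewrite exprn_ge0.
have -> : 4 ^+ k * (4 * e * (Wk k + Lk k) ^+ 2) = 4 * e * D.
  rewrite /Wk /Lk -mulrDl expr_div_n -/D -exprM mulnC exprM.
  have -> : (2 ^+ 2 : R) = 4 by ring.
  by field; rewrite expf_neq0.
have D1 : 0 < D + 1 by rewrite ltr_wpDl.
have -> : 4 * e * D = 4 * N0 * D / (5 * (D + 1)).
  by rewrite /e; field; exact: lt0r_neq0.
rewrite ltr_pdivrMr ?mulr_gt0//.
have ND : 0 <= N0 * D by rewrite mulr_ge0// ltW.
by lra.
Qed.

Lemma rectint_periodic a b c d : (forall x, H (Complex x d) = H (Complex x c)) ->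
  rectint a b c d = Complex 0 1 * (segint (fun y => H (Complex b y)) c d -
                                   segint (fun y => H (Complex a y)) c d).
Proof.
move=> per; have E : (fun x => H (Complex x d)) = (fun x => H (Complex x c)).
  exact/funext.
rewrite /rectint E; move: (segint _ a b) => s.
by rewrite (subrr s) add0r.
Qed.

End goursat.

Section complex_exponential.
Context {R : realType}.
Implicit Types (x y : R) (w h : R[i]).

Definition cis y : R[i] := Complex (cos y) (sin y).

Definition cexp w : R[i] := (expR (Re w))%:C%C * cis (Im w).

Lemma cis0 : cis 0 = 1.
Proof. by rewrite /cis cos0 sin0. Qed.

Lemma cisD x y : cis (x + y) = cis x * cis y.
Proof. by apply: complex_eq; rewrite ?RecM ?ImcM /= ?cosD ?sinD//; ring. Qed.

Lemma normc_cis y : normc (cis y) = 1.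
Proof. by rewrite normcE /= cos2Dsin2 sqrtr1. Qed.

Lemma cisN y : cis (- y) = conjc (cis y).
Proof. by rewrite /cis cosN sinN. Qed.

Lemma cis_conjK y : cis y * conjc (cis y) = 1.
Proof. by rewrite -cisN -cisD subrr cis0. Qed.

Lemma cis2pi : cis (pi *+ 2) = 1.
Proof. by rewrite /cis cos2pi sin2pi. Qed.

Lemma cexpD w h : cexp (w + h) = cexp w * cexp h.
Proof. by rewrite /cexp RecD ImcD expRD cisD rmorphM; ring. Qed.

Lemma cexpE x y : cexp (Complex x y) = (expR x)%:C%C * cis y.
Proof. by []. Qed.

Lemma is_derive0_small (f : R -> R) (l : R) : is_derive (0 : R) (1 : R) f l ->
  forall e : R, 0 < e -> exists2 d : R, 0 < d &
  forall h : R, `|h| < d -> `|f h - f 0 - l * h| <= e * `|h|.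
Proof.
move=> [df fl] e e0; move: (df); rewrite /derivable.
have : h^-1 *: (f (h *: 1 + 0) - f 0) @[h --> (0:R)^'] --> l.
  by rewrite -fl; exact: df.
move=> /cvgrPdist_le /(_ _ e0) /=; rewrite /dnbhs near_withinE => /nbhs_normP[d /= d0 hd] _.
exists d => // h hlt; have [->|h0] := eqVneq h 0.
  by rewrite subrr mulr0 subr0 normr0 mulr0.
have := hd h; rewrite /ball_ /= sub0r normrN => /(_ hlt h0).
rewrite addr0 [h *: 1]mulr1 => H.
have -> : f h - f 0 - l * h = - (h * (l - h^-1 * (f h - f 0))).
  by field.
by rewrite normrN normrM mulrC ler_wpM2r.
Qed.

Lemma cexp_small (e : R) : 0 < e -> exists2 d : R, 0 < d &
  forall h, normc h < d -> normc (cexp h - 1 - h) <= e * normc h.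
Proof.
move=> e0.
have [f f0 [fe f1]] : exists2 f : R, 0 < f & f <= e / 9 /\ f <= 1.
  exists (Num.min (e / 9) 1); first by rewrite lt_min divr_gt0//=.
  by rewrite !ge_min !lexx orbT.
have [d1 d10 h1] := is_derive0_small (is_derive_expR 0) f0.
have [d2 d20 h2] := is_derive0_small (is_derive_cos 0) f0.
have [d3 d30 h3] := is_derive0_small (is_derive_sin 0) f0.
exists (Num.min (Num.min d1 d2) (Num.min d3 f)); first by rewrite !lt_min d10 d20 d30.
move=> h; rewrite !lt_min => /andP[/andP[l1 l2] /andP[l3 l4]].
have nR := le_Re_normc h; have nI := le_Im_normc h.
have H1 := h1 _ (le_lt_trans nR l1).
have H2 := h2 _ (le_lt_trans nI l2).
have H3 := h3 _ (le_lt_trans nI l3).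
move: H1 H2 H3; rewrite expR0 cos0 sin0 !oppr0 !mul1r mul0r !oppr0 !addr0.
set s := Re h in nR l1 *; set t := Im h in nI l2 l3 *; set r := normc h in nR nI l1 l2 l3 l4 *.
move=> H1 H2 H3.
set E := expR s in H1 *.
have E0 : 0 <= E by exact: expR_ge0.
have r0 : 0 <= r by exact: normc_ge0.
have H1' : `|E - 1| <= 2 * r.
  have -> : E - 1 = (E - 1 - s) + s by ring.
  apply: le_trans (ler_normD _ _) _; rewrite mulr2n mulrDl mul1r lerD//.
  by apply: le_trans H1 _; apply: le_trans _ nR; rewrite ler_piMl.
have E3 : E <= 3.
  have -> : E = (E - 1) + 1 by ring.
  by have := ler_norm (E - 1); lra.
rewrite /cexp; apply: le_trans (normc_leD _) _.
have -> : Re ((expR s)%:C%C * cis t - 1 - h) = (E - 1 - s) + E * (cos t - 1).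
  by rewrite !RecD !RecN RecM /= -/s -/E; ring.
have -> : Im ((expR s)%:C%C * cis t - 1 - h) = E * (sin t - t) + t * (E - 1).
  by rewrite !ImcD !ImcN ImcM /= -/t -/E; ring.
have A1 : `|E - 1 - s + E * (cos t - 1)| <= f * r + 3 * (f * r).
  apply: le_trans (ler_normD _ _) _; apply: lerD.
    by apply: le_trans H1 _; rewrite ler_pM2l.
  rewrite normrM (ger0_norm E0); apply: ler_pM => //.
  by apply: le_trans H2 _; rewrite ler_pM2l.
have A2 : `|E * (sin t - t) + t * (E - 1)| <= 3 * (f * r) + 2 * f * r.
  apply: le_trans (ler_normD _ _) _; apply: lerD.
    rewrite normrM (ger0_norm E0); apply: ler_pM => //.
    by apply: le_trans H3 _; rewrite ler_pM2l.
  rewrite normrM.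
  have [->|t0] := eqVneq t 0; first by rewrite normr0 mul0r !mulr_ge0// ltW.
  apply: (@le_trans _ _ (r * `|E - 1|)); first by rewrite ler_wpM2r.
  have -> : 2 * f * r = r * (2 * f) by ring.
  by rewrite ler_wpM2l//; lra.
apply: le_trans (lerD A1 A2) _.
have -> : f * r + 3 * (f * r) + (3 * (f * r) + 2 * f * r) = (9 * f) * r by ring.
by rewrite ler_wpM2r//; lra.
Qed.

End complex_exponential.

Section circles.
Context {R : realType}.
Implicit Types (F : R[i] -> R[i]) (r s y : R) (l : nat) (w p : R[i]).

Lemma cder_cexp w : cder cexp w (cexp w).
Proof.
move=> e e0; have N0 := normc_ge0 (cexp w).
have e1 : 0 < e / (1 * (normc (cexp w) + 1)) by rewrite divr_gt0// mul1r ltr_wpDl.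
have [d d0 hd] := cexp_small e1; exists d => // h /hd H.
have -> : cexp (w + h) - cexp w - cexp w * h = cexp w * (cexp h - 1 - h).
  by rewrite cexpD; ring.
rewrite normcM; apply: le_trans (ler_wpM2l N0 H) _.
rewrite mulrA ler_wpM2r ?normc_ge0// mulrC -[leRHS]divr1.
by apply: ler_div_succM => //; exact: ltW.
Qed.

Lemma cderZ (c : R[i]) w : cder (fun z => c * z) w c.
Proof.
move=> e e0; exists 1 => // h _.
have -> : c * (w + h) - c * w - c * h = 0 by ring.
by rewrite ComplexField.Normc.normc0 mulr_ge0 ?normc_ge0 ?ltW.
Qed.

Lemma cderX F w A l : cder F w A -> exists B, cder (fun z => F z ^+ l) w B.
Proof.
move=> FA; elim: l => [|l [B IH]].
  by exists 0; under eq_fun do rewrite expr0; exact: cder_cst.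
by eexists; under eq_fun do rewrite exprS; exact: (cderM FA IH).
Qed.

(** In logarithmic coordinates [w = log r + i y], the [l]-th Fourier coefficient
   of [F] on the circle of radius [r] is [r ^ l] times the integral of this
   function over a vertical segment. *)
Let logH F l w : R[i] := F (cexp w) * cexp (- 1 * w) ^+ l.

Let logHE F l r y : 0 < r ->
  logH F l (Complex (ln r) y) = (r^-1 ^+ l)%:C%C * (F (r%:C%C * cis y) * conjc (cis y) ^+ l).
Proof.
move=> r0; rewrite /logH cexpE lnK ?posrE//.
have -> : -1 * Complex (ln r) y = Complex (ln r^-1) (- y).
  by rewrite lnV ?posrE//; apply: complex_eq; rewrite ?RecM ?ImcM /=; ring.
rewrite cexpE lnK ?posrE ?invr_gt0// cisN exprMn rmorphXn/=; ring.
Qed.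

Let logH_cder F l w : (exists A, cder F (cexp w) A) -> exists A, cder (logH F l) w A.
Proof.
move=> [A FA]; have [B hB] := cderX l (cder_comp (cderZ (-1) w) (cder_cexp _)).
by eexists; apply: cderM hB; exact: (cder_comp (cder_cexp w) FA).
Qed.

Definition circint F l r : R[i] :=
  segint (fun y => F (r%:C%C * cis y) * conjc (cis y) ^+ l) 0 (pi *+ 2).

Lemma circle_continuous F l r y : 0 < r -> (exists A, cder F (r%:C%C * cis y) A) ->
  ccontinuous_at (fun y => F (r%:C%C * cis y) * conjc (cis y) ^+ l) y.
Proof.
move=> r0 FA.
have [A hA] : exists A, cder (logH (fun z => F (r%:C%C * z)) l) (Complex 0 y) A.
  apply: logH_cder; have [A hA] := FA.
  have -> : cexp (Complex 0 y) = cis y by rewrite cexpE expR0 mul1r.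
  by eexists; exact: (cder_comp (cderZ r%:C%C (cis y)) hA).
have := cder_continuous (u := fun y => Complex 0 y) (x := y) erefl _ hA.
rewrite (_ : _ \o _ = (fun y => F (r%:C%C * cis y) * conjc (cis y) ^+ l)).
  apply => h; rewrite normcE /= subrr expr0n add0r sqrtr_sqr.
  by rewrite addrAC subrr add0r.
apply/funext => z /=; rewrite /logH cexpE expR0 mul1r.
have -> : -1 * Complex 0 z = Complex 0 (- z).
  by apply: complex_eq; rewrite ?RecM ?ImcM /=; ring.
by rewrite cexpE expR0 mul1r cisN.
Qed.

Lemma circle_integrable F l r : 0 < r ->
  (forall y, exists A, cder F (r%:C%C * cis y) A) ->
  cintegrable lebesgue_measure `[0, pi *+ 2]
    (fun y => F (r%:C%C * cis y) * conjc (cis y) ^+ l).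
Proof.
by move=> r0 FA; apply: cintegrable_segment => y _; exact: circle_continuous.
Qed.

Lemma normc_rcis r y : 0 <= r -> normc (r%:C%C * cis y) = r.
Proof. by move=> r0; rewrite normcM normc_cis normc_real mulr1 ger0_norm. Qed.

(** The contour integral over the boundary of the rectangle
   [log r, log s] x [0, 2 pi] vanishes, and periodicity cancels its two
   horizontal sides. *)
Lemma circint_homogeneous F l r s rho : 0 < r -> r <= s -> s < rho ->
  (forall p, normc p < rho -> exists A, cder F p A) ->
  (s ^+ l)%:C%C * circint F l r = (r ^+ l)%:C%C * circint F l s.
Proof.
move=> r0 rs srho FA; have s0 := lt_le_trans r0 rs.
have pi0 : 0 <= pi *+ 2 :> R by rewrite mulrn_wge0// pi_ge0.
have lnrs : ln r <= ln s by rewrite ler_ln ?posrE.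
have := @goursat _ (logH F l) (ln r) (ln s) 0 (pi *+ 2) lnrs pi0.
have dH : cder_on (logH F l) (rect (ln r) (ln s) 0 (pi *+ 2)).
  case=> x y [/andP[_ xs] _]; apply: logH_cder; apply: FA.
  rewrite cexpE normc_rcis ?expR_ge0//; apply: le_lt_trans srho.
  by rewrite -(lnK (x := s)) ?posrE// ler_expR.
have per x : logH F l (Complex x (pi *+ 2)) = logH F l (Complex x 0).
  rewrite /logH cexpE cis2pi.
  have -> : -1 * Complex x (pi *+ 2) = Complex (- x) (- (pi *+ 2)).
    by apply: complex_eq; rewrite ?RecM ?ImcM /=; ring.
  have -> : -1 * Complex x 0 = Complex (- x) 0.
    by apply: complex_eq; rewrite ?RecM ?ImcM /=; ring.
  by rewrite !cexpE cisN cis2pi cis0 conjc1.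
move=> /(_ dH); rewrite (rectint_periodic _ _ per).
have V q : 0 < q -> q <= s -> segint (fun y => logH F l (Complex (ln q) y)) 0 (pi *+ 2) =
    (q^-1 ^+ l)%:C%C * circint F l q.
  move=> q0 qs; under eq_fun do rewrite (logHE _ _ _ q0).
  rewrite /segint cintZ//; apply: circle_integrable => // y; apply: FA.
  by rewrite normc_rcis ?ltW//; exact: le_lt_trans srho.
rewrite (V s s0 (lexx s)) (V r r0 rs).
move: (circint F l r) (circint F l s) => Cr Cs /eqP; rewrite mulf_eq0 => /orP[|].
  by rewrite eq_complex /= oner_eq0 andbF.
rewrite subr_eq0 => /eqP E.
have rq (q : R) : 0 < q -> (q ^+ l)%:C%C * (q^-1 ^+ l)%:C%C = 1.
  by move=> q0; rewrite -rmorphM -exprMn divff ?expr1n ?rmorph1// gt_eqF.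
rewrite -[Cr]mul1r -(rq _ r0) -[Cs in RHS]mul1r -(rq _ s0).
rewrite -[X in _ * X]mulrA -E; ring.
Qed.

Lemma segint_ext (f g : R -> R[i]) a b : f =1 g -> segint f a b = segint g a b.
Proof. by move=> /funext ->. Qed.

Lemma circint_cis : segint (fun y => conjc (cis y)) 0 (pi *+ 2) = 0 :> R[i].
Proof.
have E q : circint (fun=> 1) 1 q = segint (fun y => conjc (cis y)) 0 (pi *+ 2).
  by apply: segint_ext => y; rewrite expr1 mul1r.
have := @circint_homogeneous (fun=> 1) 1 1 2 3 ltr01.
rewrite !expr1 !E => H; have /eqP : (2%:C%C : R[i]) * segint (fun y => conjc (cis y)) 0 (pi *+ 2)
    = 1%:C%C * segint (fun y => conjc (cis y)) 0 (pi *+ 2).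
  by apply: H; [rewrite ler1n|rewrite ltr_nat|move=> p _; exists 0; exact: cder_cst].
rewrite -subr_eq0 -mulrBl mulf_eq0 => /orP[|/eqP//].
by rewrite -rmorphB /= eq_complex /= eqxx andbT subr_eq0 gt_eqF// ltr1n.
Qed.

(** Letting the radius tend to 0 in [circint_homogeneous]. *)
Lemma circint_der F r rho A : 0 < r -> r < rho ->
  (forall p, normc p < rho -> exists A, cder F p A) -> cder F 0 A ->
  circint F 0 r = (pi *+ 2)%:C%C * F 0 /\
  circint F 1 r = (pi *+ 2)%:C%C * (r%:C%C * A).
Proof.
move=> r0 rrho FA FA0.
have pi0 : 0 < pi *+ 2 :> R by rewrite mulrn_wgt0// pi_gt0.
have small (x : R[i]) (K : R) : 0 < K -> (forall e : R, 0 < e -> normc x <= K * e) -> x = 0.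
  move=> K0 hx; apply/eqP; rewrite -normc_eq0 eq_le normc_ge0 andbT.
  apply/ler_addgt0Pr => e e0; rewrite add0r.
  by have := hx (e / K); rewrite divr_gt0// mulrC divfK ?gt_eqF//; apply.
have int l s : 0 < s -> s <= r -> cintegrable lebesgue_measure `[0, pi *+ 2]
    (fun y => F (s%:C%C * cis y) * conjc (cis y) ^+ l).
  move=> s0 sr; apply: circle_integrable => // y; apply: FA.
  by rewrite normc_rcis ?ltW//; exact: le_lt_trans rrho.
have ccst (k : R[i]) : cintegrable (@lebesgue_measure R) `[0, pi *+ 2] (fun=> k).
  apply: cintegrable_segment => x _ e e0; exists 1 => // h _.
  by rewrite subrr ComplexField.Normc.normc0 ltW.
have ccis : cintegrable (@lebesgue_measure R) `[0, pi *+ 2] (fun y => conjc (cis y)).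
  have := @circle_integrable (fun=> 1) 1 1 ltr01.
  under [X in cintegrable _ _ X]eq_fun do rewrite mul1r expr1.
  by apply => y; exists 0; exact: cder_cst.
have mI : measurable (`[0, pi *+ 2]%classic : set (measurableTypeR R)).
  exact: measurable_itv.
split.
  apply/eqP; rewrite -subr_eq0; apply/eqP; apply: (small _ (2 * (pi *+ 2))).
    by rewrite mulr_gt0.
  move=> e e0; have [d d0 hd] := cder_lip FA0.
  have N1 : 0 < normc A + 1 by rewrite ltr_wpDl// normc_ge0.
  pose s := Num.min r (Num.min (d / 2) (e / (normc A + 1))).
  have s0 : 0 < s by rewrite !lt_min r0 !divr_gt0.
  have sr : s <= r by rewrite ge_min lexx.
  have sd : s < d.
    by apply: (@le_lt_trans _ _ (d / 2)); [rewrite !ge_min lexx orbT|lra].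
  have se : s <= e / (normc A + 1) by rewrite !ge_min lexx !orbT.
  have := @circint_homogeneous F 0 s r rho s0 sr rrho FA.
  rewrite !expr0 rmorph1 !mul1r => <-.
  have -> : (pi *+ 2)%:C%C * F 0 = segint (fun=> F 0) 0 (pi *+ 2).
    by rewrite segint_cst ?ltW// subr0.
  have is0 : cintegrable lebesgue_measure `[0, pi *+ 2]
      (fun y => F (s%:C%C * cis y) * conjc (cis y) ^+ 0) by exact: int.
  rewrite /circint /segint -cintB//.
  apply: le_trans (normc_segint (K := e) (ltW pi0) _ _) _.
  - exact: cintegrableB.
  - move=> y _; rewrite expr0 mulr1 -[s%:C%C * _]add0r.
    apply: le_trans (hd _ _) _; rewrite normc_rcis ?(ltW s0)//.
    by rewrite mulrC -ler_pdivlMr.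
  - by rewrite subr0.
apply/eqP; rewrite -subr_eq0; apply/eqP; apply: (small _ (2 * (pi *+ 2) * r)).
  by rewrite !mulr_gt0.
move=> e e0; have [d d0 hd] := FA0 _ e0.
pose s := Num.min r (d / 2).
have s0 : 0 < s by rewrite !lt_min r0 !divr_gt0.
have sr : s <= r by rewrite ge_min lexx.
have sd : s < d.
  by apply: (@le_lt_trans _ _ (d / 2)); [rewrite !ge_min lexx orbT|lra].
have := @circint_homogeneous F 1 s r rho s0 sr rrho FA; rewrite !expr1 => E.
have sN : s%:C%C != 0 :> R[i] by rewrite eq_complex /= eqxx andbT gt_eqF.
have D : s%:C%C * (circint F 1 r - (pi *+ 2)%:C%C * (r%:C%C * A)) =
    r%:C%C * segint (fun y => (F (s%:C%C * cis y) * conjc (cis y) ^+ 1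
      - F 0 * conjc (cis y)) - s%:C%C * A) 0 (pi *+ 2).
  have i1 : cintegrable lebesgue_measure `[0, pi *+ 2]
      (fun y => F (s%:C%C * cis y) * conjc (cis y) ^+ 1) by exact: int.
  have i2 : cintegrable lebesgue_measure `[0, pi *+ 2] (fun y => F 0 * conjc (cis y)).
    exact: cintegrableZ.
  have i3 := cintegrableB mI i1 i2.
  rewrite /segint cintB// cintB// cintZ// -!/(segint _ _ _) circint_cis mulr0 subr0.
  rewrite segint_cst ?ltW// subr0 mulrBr -E -/(circint F 1 s).
  move: (circint F 1 s) => C1; ring.
have B : normc (segint (fun y => (F (s%:C%C * cis y) * conjc (cis y) ^+ 1
      - F 0 * conjc (cis y)) - s%:C%C * A) 0 (pi *+ 2)) <= 2 * (pi *+ 2) * (e * s).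
  apply: le_trans (normc_segint (K := e * s) (ltW pi0) _ _) _.
  - apply: cintegrableB => //; apply: cintegrableB => //; first exact: int.
    exact: cintegrableZ.
  - move=> y _; rewrite expr1.
    have -> : F (s%:C%C * cis y) * conjc (cis y) - F 0 * conjc (cis y) - s%:C%C * A =
       (F (0 + s%:C%C * cis y) - F 0 - A * (s%:C%C * cis y)) * conjc (cis y).
      rewrite add0r !mulrBl; congr (_ - _).
      have -> : A * (s%:C%C * cis y) * conjc (cis y) =
        s%:C%C * A * (cis y * conjc (cis y)) by ring.
      by rewrite cis_conjK mulr1.
    rewrite normcM normc_conj normc_cis mulr1.
    by apply: le_trans (hd _ _) _; rewrite normc_rcis ?(ltW s0).
  - by rewrite subr0.
have NS : normc (s%:C%C : R[i]) = s by rewrite normc_real ger0_norm// ltW.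
have NR : normc (r%:C%C : R[i]) = r by rewrite normc_real ger0_norm// ltW.
move: (segint _ 0 _) B D => SB B D.
move: (circint F 1 r - _) D => X D.
have := congr1 (fun z : R[i] => normc z) D; rewrite [LHS]normcM [RHS]normcM NS NR => D'.
rewrite -(ler_pM2l s0) D'; apply: le_trans (ler_wpM2l (ltW r0) B) _.
by rewrite le_eqVlt; apply/orP; left; apply/eqP; ring.
Qed.

End circles.

(** * The Müntz theorem *)

Section muntz.
Context {R : realType}.
Implicit Types (p : {poly R}) (q l K : nat) (L : pred nat).

(** Maximum principle for the Euler equation [l g - x g' = (l - q) p]: at an
   interior maximum of [g] the derivative vanishes, so [l g = (l - q) p] there. *)
Lemma euler_max p (g : {poly R}) q l (B : R) : (0 < q)%N -> (q < l)%N -> 0 <= B ->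
  (forall x, 0 <= x <= 1 -> `|p.[x]| <= B) ->
  g.[0] = 0 -> g.[1] = 0 ->
  g *+ l - 'X * g^`() = p *+ (l - q) ->
  forall x, 0 <= x <= 1 -> g.[x] <= (1 - q%:R / l%:R) * B.
Proof.
move=> q0 ql B0 pB g0 g1 E x x01.
have l0 : 0 < l%:R :> R by rewrite ltr0n (leq_ltn_trans _ ql).
have qlR : q%:R / l%:R <= 1 :> R by rewrite ler_pdivrMr// mul1r ler_nat ltnW.
have C0 : 0 <= (1 - q%:R / l%:R) * B by rewrite mulr_ge0// subr_ge0.
have [c cI cM] : exists2 c, c \in `[0 : R, 1] &
    forall t, t \in `[0 : R, 1] -> (horner g) t <= (horner g) c.
  apply: EVT_max => //; apply: continuous_subspaceT => y; exact: continuous_horner.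
apply: (@le_trans _ _ g.[c]); first by apply: cM; rewrite in_itv.
move: (cI); rewrite in_itv /= => c01; have /andP[c0 c1] := c01.
have [->|cn0] := eqVneq c 0; first by rewrite g0.
have [->|cn1] := eqVneq c 1; first by rewrite g1.
have cI' : c \in `]0, 1[ by rewrite in_itv /= !lt_neqAle eq_sym cn0 c0 cn1 c1.
have D : is_derive c 1 (horner g) 0.
  apply: (@derive1_at_max _ _ 0 1) => // t.
  rewrite in_itv /= => /andP[/ltW t0 /ltW t1].
  by apply: cM; rewrite in_itv /= t0.
have g'c : (g^`()).[c] = 0.
  by rewrite derivE derive1E; case: D => _ ->.
have := congr1 (horner^~ c) E; rewrite !hornerE /= !hornerMn g'c mulr0 subr0 => Ec.
have -> : g.[c] = (1 - q%:R / l%:R) * p.[c].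
  rewrite -mulr_natl in Ec; apply: (mulfI (lt0r_neq0 l0)); rewrite Ec.
  rewrite -mulr_natr natrB 1?ltnW//.
  by field; exact: lt0r_neq0.
rewrite ler_wpM2l ?subr_ge0//; by apply: le_trans (pB c c01); rewrite ler_norm.
Qed.

(** One step of von Golitschek's construction: in terms of the coefficients, the
   solution of the Euler equation above with [g 1 = 0]. *)
Lemma muntz_step p q l (B : R) : (0 < q)%N -> (q < l)%N -> p`_l = 0 -> p`_0 = 0 ->
  p`_q = 1 -> (forall x, 0 <= x <= 1 -> `|p.[x]| <= B) ->
  exists g : {poly R}, [/\ g`_q = 1, g`_0 = 0,
    forall i, g`_i != 0 -> i = l \/ p`_i != 0 &
    forall x, 0 <= x <= 1 -> `|g.[x]| <= (1 - q%:R / l%:R) * B].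
Proof.
move=> q0 ql pl p0 pq pB.
have l0 : 0 < l%:R :> R by rewrite ltr0n (leq_ltn_trans _ ql).
have B0 : 0 <= B by apply: le_trans (pB 0 _); rewrite ?lexx ?ler01.
pose r : {poly R} := \poly_(i < size p) ((l - q)%:R / (l%:R - i%:R) * p`_i).
pose g : {poly R} := r - r.[1] *: 'X^l.
have rE i : r`_i = (l - q)%:R / (l%:R - i%:R) * p`_i.
  by rewrite coef_poly; case: ltnP => // ?; rewrite nth_default// mulr0.
have gE i : i != l -> g`_i = (l - q)%:R / (l%:R - i%:R) * p`_i.
  by move=> il; rewrite coefB coefZ coefXn (negbTE il) mulr0 subr0 rE.
have ln0 : l != 0%N by rewrite -lt0n (leq_ltn_trans _ ql).
have g00 : g`_0 = 0 by rewrite gE 1?eq_sym// p0 mulr0.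
have g0 : g.[0] = 0 by rewrite horner_coef0.
have g1 : g.[1] = 0 by rewrite !hornerE expr1n mulr1 subrr.
have E : g *+ l - 'X * g^`() = p *+ (l - q).
  apply/polyP => i; rewrite coefB !coefMn coefXM coef_deriv.
  have -> : (if i == 0 then 0 else g`_i.-1.+1 *+ i.-1.+1) = g`_i *+ i.
    by case: i => [|i]; rewrite ?mulr0n.
  have [->|il] := eqVneq i l; first by rewrite subrr pl mul0rn.
  have key (a x y z : R) : y - z != 0 -> x / (y - z) * a * y - x / (y - z) * a * z = a * x.
    by move=> yz; field.
  rewrite (gE i il) -[X in X - _]mulr_natr -[X in _ - X]mulr_natr -[RHS]mulr_natr.
  apply: key.
  by rewrite subr_eq0 eqr_nat eq_sym.
exists g; split => //.
- rewrite gE ?ltn_eqF// pq mulr1 natrB 1?ltnW// divff// subr_eq0 eqr_nat.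
  by rewrite gtn_eqF.
- move=> i; have [->|il] := eqVneq i l; first by left.
  by rewrite gE// mulf_eq0 negb_or => /andP[_]; right.
- move=> x x01; rewrite ler_norml; apply/andP; split; last exact: (euler_max q0 ql B0 pB).
  rewrite lerNl -hornerN; apply: (@euler_max (- p) (- g) q l B) => //.
  + by move=> y y01; rewrite hornerN normrN pB.
  + by rewrite hornerN g0 oppr0.
  + by rewrite hornerN g1 oppr0.
  + by rewrite derivN mulrN opprK !mulNrn -E opprB addrC.
Qed.

Definition divergent L := forall B : R, exists K : nat,
  B <= \sum_(0 <= l < K | L l) l.+1%:R^-1.

(** Only the exponents larger than [q] are used; the product of the factors
   [1 - q / l] is controlled by the exponential of the divergent sum. *)
Lemma muntz_partial L q K : (0 < q)%N -> exists p, [/\ p`_q = 1, p`_0 = 0,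
    forall i, p`_i != 0 -> i = q \/ (L i /\ (i < q.+1 + K)%N) &
    forall x, 0 <= x <= 1 ->
      `|p.[x]| <= expR (- \sum_(q.+1 <= l < q.+1 + K | L l) l.+1%:R^-1)].
Proof.
move=> q0; elim: K => [|K [p [pq p0 pL pB]]].
  exists 'X^q; split.
  - by rewrite coefXn eqxx.
  - by rewrite coefXn eq_sym (gtn_eqF q0).
  - by move=> i; rewrite coefXn; have [->|_] := eqVneq i q; [left|rewrite eqxx].
  - move=> x /andP[x0 x1]; rewrite addn0 big_geq// oppr0 expR0 hornerXn.
    by rewrite normrX exprn_ile1// ger0_norm.
set l := (q.+1 + K)%N.
have ql : (q < l)%N by rewrite /l addSn ltnS leq_addr.
rewrite addnS -/l big_mkcond big_nat_recr/=; last by rewrite leq_addr.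
rewrite -big_mkcond/=.
case: ifPn => Ll; last first.
  exists p; split => //; last by rewrite addr0.
  by move=> i /pL [->|[Li il]]; [left|right; split => //; rewrite ltnW].
have pl : p`_l = 0.
  apply/eqP/negPn/negP => /pL [E|[_]]; last by rewrite ltnn.
  by move: ql; rewrite -E ltnn.
have [g [gq g0 gL gB]] := muntz_step q0 ql pl p0 pq pB.
exists g; split => //.
  move=> i /gL [->|/pL [->|[Li il]]]; [|by left|].
  - by right; split.
  - by right; split => //; rewrite ltnW.
move=> x /gB; move=> H; apply: le_trans H _.
rewrite opprD expRD mulrC ler_wpM2l ?expR_ge0//.
have l0 : 0 < l%:R :> R by rewrite ltr0n (leq_ltn_trans _ ql).
apply: (@le_trans _ _ (1 - l.+1%:R^-1)).
  rewrite lerB// -[leLHS]mul1r ler_pM// ?ler1n// ?invr_ge0//.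
  by rewrite lef_pV2 ?posrE ?ltr0n ?ler_nat.
exact: expR_ge1Dx.
Qed.

(** Müntz's theorem, in the form of von Golitschek: if the exponents in [L] have
   divergent sum of reciprocals, then [x ^ q] is a uniform limit on [0, 1] of
   polynomials with exponents in [L]. *)
Theorem muntz L q (e : R) : (0 < q)%N -> divergent L -> 0 < e ->
  exists p, [/\ p`_q = 1, forall i, p`_i != 0 -> i = q \/ L i &
    forall x, 0 <= x <= 1 -> `|p.[x]| <= e].
Proof.
move=> q0 Ldiv e0.
set S0 := \sum_(0 <= l < q.+1 | L l) (l.+1%:R^-1 : R).
have [K HK] := Ldiv (S0 - ln e).
have [p [pq p0 pL pB]] := muntz_partial L K q0.
exists p; split => //; first by move=> i /pL [->|[Li _]]; [left|right].
move=> x /pB H; apply: le_trans H _.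
rewrite -[leRHS](lnK (x := e)) ?posrE// ler_expR lerNl.
rewrite -(lerD2l S0); apply: le_trans HK _.
rewrite /S0 -big_cat_nat//=; last by rewrite leq_addr.
have KK : (K <= q.+1 + K)%N by rewrite leq_addl.
rewrite [leRHS](big_cat_nat (leq0n K) KK)/= lerDl; apply: sumr_ge0 => i _.
by rewrite invr_ge0.
Qed.

End muntz.

(** * Affine changes of variables in C^n *)

Section image_measure.
Context d d' (T1 : measurableType d) (T2 : measurableType d') (R : realType).
Variables (m : {measure set T1 -> \bar R}) (f : T1 -> T2).
Hypothesis mf : measurable_fun [set: T1] f.

Definition image_measure : {measure set T2 -> \bar R} :=
  measure_function_pushforward__canonical__measure_function_Measure m mf.

Lemma ge0_integral_image (g : T2 -> \bar R) : measurable_fun setT g ->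
  (forall y, 0 <= g y)%E -> (\int[image_measure]_y g y = \int[m]_x g (f x))%E.
Proof.
by move=> mg g0; rewrite (ge0_integral_pushforward mf)//= preimage_setT.
Qed.

End image_measure.

Section affine_R.
Context {R : realType}.
Local Notation T := (measurableTypeR R).
Local Notation mu := (@lebesgue_measure R).

Lemma measurable_affine (c b : R) : measurable_fun setT ((fun x : T => c * x + b) : T -> T).
Proof. by apply: measurable_funD => //; exact: measurable_funM. Qed.

Lemma lebesgue_affine (c b : R) : c != 0 -> forall A : set T, measurable A ->
  mu A = (`|c|%:E * mu ((fun x : T => (c * x + b)%R) @^-1` A))%E.
Proof.
move=> c0; pose f : T -> T := fun x => c * x + b.
have mf : measurable_fun setT f by exact: measurable_affine.
pose k : {nonneg R} := NngNum (normr_ge0 c).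
pose m : {measure set T -> \bar R} := mscale k (image_measure mu mf).
move=> A mA; transitivity (m A); last by [].
apply: (@lebesgue_measure_unique _ m) => // _ [[u v] _ <-].
change (mu `]u, v] = `|c|%:E * mu (f @^-1` `]u, v]))%E.
have [cp|cn] := ltP 0 c; last first.
  have {cn}cn : c < 0 by rewrite lt_neqAle c0.
  have -> : f @^-1` `]u, v] = `[(v - b) / c, (u - b) / c[%classic.
    apply/seteqP; split => x /=; rewrite !in_itv /= /f.
      move=> /andP[ux xv]; rewrite ler_ndivrMr// ltr_ndivlMr//.
      by rewrite mulrC lerBrDr xv ltrBlDr.
    rewrite ler_ndivrMr// ltr_ndivlMr// => /andP[xv ux].
    by rewrite mulrC -ltrBlDr ux -lerBrDr.
  rewrite [LHS]lebesgue_measure_itv [X in (_ * X)%E]lebesgue_measure_itv /= !lte_fin.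
  rewrite ltr_nM2r ?invr_lt0// ltrD2r; case: ltP => uv; last by rewrite mule0.
  rewrite -!EFinB -EFinM ltr0_norm//; congr (_%:E); field; exact: c0.
have -> : f @^-1` `]u, v] = `](u - b) / c, (v - b) / c]%classic.
  apply/seteqP; split => x /=; rewrite !in_itv /= /f.
    move=> /andP[ux xv]; rewrite ltr_pdivrMr// ler_pdivlMr//.
    by rewrite mulrC lerBrDr xv ltrBlDr ux.
  rewrite ltr_pdivrMr// ler_pdivlMr// => /andP[ux xv].
  by rewrite mulrC -ltrBlDr ux -lerBrDr.
rewrite [LHS]lebesgue_measure_itv [X in (_ * X)%E]lebesgue_measure_itv /= !lte_fin.
rewrite ltr_pM2r ?invr_gt0// ltrD2r; case: ltP => uv; last by rewrite mule0.
rewrite -!EFinB -EFinM gtr0_norm//; congr (_%:E); field; exact: c0.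
Qed.

Lemma integral_affine_R (c b : R) (f : T -> \bar R) : c != 0 ->
  measurable_fun setT f -> (forall x, 0 <= f x)%E ->
  (\int[mu]_x f x = `|c|%:E * \int[mu]_x f (c * x + b)%R)%E.
Proof.
move=> c0 mf f0; pose h : T -> T := fun x => c * x + b.
have mh : measurable_fun setT h by exact: measurable_affine.
pose k : {nonneg R} := NngNum (normr_ge0 c).
rewrite (@eq_measure_integral _ _ _ _ (mscale k (image_measure mu mh))); last first.
  by move=> A mA _; exact: (lebesgue_affine b c0 mA).
rewrite ge0_integral_mscale//; congr (_ * _)%E.
by rewrite ge0_integral_image.
Qed.

End affine_R.

Section affine_R2.
Context {R : realType}.
Local Notation T := (measurableTypeR R).
Local Notation R2 := (T * T)%type.
Local Notation mu := (@lebesgue_measure R).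
Local Notation mu2 := (@leb2 R).
Implicit Types f : R2 -> \bar R.

Lemma leb2E f : measurable_fun setT f -> (forall p, 0 <= f p)%E ->
  (\int[mu2]_p f p = \int[mu]_x \int[mu]_y f (x, y))%E.
Proof.
move=> mf f0; rewrite -(@fubini_tonelli1 _ _ _ _ _ mu mu f mf f0).
exact: eq_measure_integral.
Qed.

Lemma leb2E' f : measurable_fun setT f -> (forall p, 0 <= f p)%E ->
  (\int[mu2]_p f p = \int[mu]_y \int[mu]_x f (x, y))%E.
Proof.
move=> mf f0; rewrite -(@fubini_tonelli2 _ _ _ _ _ mu mu f mf f0).
exact: eq_measure_integral.
Qed.

Definition linR2 (a b c d e g : R) (p : R2) : R2 :=
  (a * p.1 + b * p.2 + e, c * p.1 + d * p.2 + g).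

Lemma measurable_linR2 a b c d e g : measurable_fun setT (linR2 a b c d e g).
Proof.
apply: measurable_fun_pair => /=.
  by apply: measurable_funD => //; apply: measurable_funD; apply: measurable_funM.
by apply: measurable_funD => //; apply: measurable_funD; apply: measurable_funM.
Qed.

(** Shears preserve planar measure: slice along the sheared direction. *)
Lemma integral_shear1 (t : R) f : measurable_fun setT f -> (forall p, 0 <= f p)%E ->
  (\int[mu2]_p f (linR2 1 t 0 1 0 0 p) = \int[mu2]_p f p)%E.
Proof.
move=> mf f0; rewrite [RHS]leb2E'// leb2E'//; last first.
  by apply: measurableT_comp => //; exact: measurable_linR2.
apply: eq_integral => y _.
have mfy : measurable_fun setT (fun x => f (x, y)).
  by apply: measurableT_comp => //; exact: pair2_measurable.
rewrite [RHS](@integral_affine_R _ 1 (t * y) _ (oner_neq0 _) mfy)// normr1 mul1e.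
by apply: eq_integral => x _; rewrite /linR2 /= mul0r add0r !mul1r !addr0.
Qed.

Lemma integral_shear2 (t : R) f : measurable_fun setT f -> (forall p, 0 <= f p)%E ->
  (\int[mu2]_p f (linR2 1 0 t 1 0 0 p) = \int[mu2]_p f p)%E.
Proof.
move=> mf f0; rewrite [RHS]leb2E// leb2E//; last first.
  by apply: measurableT_comp => //; exact: measurable_linR2.
apply: eq_integral => x _.
have mfx : measurable_fun setT (fun y => f (x, y)).
  by apply: measurableT_comp => //; exact: pair1_measurable.
rewrite [RHS](@integral_affine_R _ 1 (t * x) _ (oner_neq0 _) mfx)// normr1 mul1e.
apply: eq_integral => y _; congr (f (_, _)); rewrite /linR2 /=; ring.
Qed.

Lemma integral_diag (r s e g : R) f : r != 0 -> s != 0 ->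
  measurable_fun setT f -> (forall p, 0 <= f p)%E ->
  (\int[mu2]_p f p = (`|r| * `|s|)%:E * \int[mu2]_p f (linR2 r 0 0 s e g p))%E.
Proof.
move=> r0 s0 mf f0; rewrite leb2E// leb2E//; last first.
  by apply: measurableT_comp => //; exact: measurable_linR2.
have mF : measurable_fun setT (fun x => \int[mu]_y f (x, y))%E.
  exact: (measurable_fun_fubini_tonelli_F (m2 := mu) f mf f0).
have F0 x : (0 <= \int[mu]_y f (x, y))%E by exact: integral_ge0.
rewrite (@integral_affine_R _ r e _ r0 mF F0) EFinM -muleA; congr (_ * _)%E.
have E x : (\int[mu]_y f ((r * x + e)%R, y) =
    `|s|%:E * \int[mu]_y f (linR2 r 0 0 s e g (x, y)))%E.
  have mfx : measurable_fun setT (fun y => f (r * x + e, y)).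
    by apply: measurableT_comp => //; exact: pair1_measurable.
  rewrite (@integral_affine_R _ s g _ s0 mfx)//; congr (_ * _)%E.
  by apply: eq_integral => y _; rewrite /linR2 /= !mul0r addr0 add0r.
under eq_integral do rewrite E.
rewrite ge0_integralZl//.
- apply: (measurable_fun_fubini_tonelli_F (m2 := mu)
    (fun p => f (linR2 r 0 0 s e g p))) => //.
  by apply: measurableT_comp => //; exact: measurable_linR2.
- by move=> x _; exact: integral_ge0.
Qed.

(** A rotation is a product of three shears. *)
Lemma integral_rot (c s : R) f : c ^+ 2 + s ^+ 2 = 1 ->
  measurable_fun setT f -> (forall p, 0 <= f p)%E ->
  (\int[mu2]_p f (linR2 c (- s) s c 0 0 p) = \int[mu2]_p f p)%E.
Proof.
move=> cs mf f0; have [s0|s0] := eqVneq s 0.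
  have c2 : c ^+ 2 = 1 by rewrite -cs s0 expr0n addr0.
  have cn0 : c != 0.
    by apply/eqP => c0; move/eqP: c2; rewrite c0 expr0n eq_sym oner_eq0.
  have c1 : `|c| = 1.
    by apply/eqP; rewrite -(@eqrXn2 _ 2)// ?normr_ge0// expr1n real_normK ?num_real// c2.
  rewrite [RHS](@integral_diag c c 0 0 f cn0 cn0 mf f0) c1 mulr1 mul1e.
  by rewrite s0 oppr0.
pose t := (c - 1) / s.
pose g := f \o linR2 1 t 0 1 0 0; pose h := g \o linR2 1 0 s 1 0 0.
have mg : measurable_fun setT g.
  by apply: measurableT_comp => //; exact: measurable_linR2.
have mh : measurable_fun setT h.
  by apply: measurableT_comp => //; exact: measurable_linR2.
transitivity (\int[mu2]_p h (linR2 1 t 0 1 0 0 p))%E.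
  apply: eq_integral => -[x y] _; rewrite /h /g /=; congr f; rewrite /linR2 /=.
  have cE : c * c = 1 - s * s by rewrite -!expr2 -cs addrK.
  congr (_, _).
    rewrite /t; apply: (mulIf s0).
    transitivity (c * s * x + c * (c * y) - y); last by field.
    by rewrite (mulrA c c y) cE; ring.
  by rewrite /t; field.
have g0 p : (0 <= g p)%E by exact: f0.
have h0 p : (0 <= h p)%E by exact: f0.
rewrite (integral_shear1 _ mh h0).
transitivity (\int[mu2]_p g p)%E; last exact: integral_shear1.
exact: (integral_shear2 s mg g0).
Qed.

Lemma integral_affine_C2 (a b : R[i]) f : a != 0 ->
  measurable_fun setT f -> (forall p, 0 <= f p)%E ->
  (\int[mu2]_p f p = (normc a ^+ 2)%:E *
    \int[mu2]_p f (linR2 (Re a) (- Im a) (Im a) (Re a) (Re b) (Im b) p))%E.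
Proof.
move=> a0 mf f0; set r := normc a.
have r0 : r != 0 by rewrite normc_eq0.
rewrite (@integral_diag r r (Re b) (Im b) f r0 r0 mf f0) -expr2 real_normK ?num_real//.
congr (_ * _)%E.
pose c := Re a / r; pose s := Im a / r.
have cs : c ^+ 2 + s ^+ 2 = 1.
  by rewrite !expr_div_n -mulrDl -sqr_normcE divff// expf_neq0.
rewrite -(@integral_rot c s (fun p => f (linR2 r 0 0 r (Re b) (Im b) p)) cs)//; last first.
  by apply: measurableT_comp => //; exact: measurable_linR2.
apply: eq_integral => -[x y] _; congr (f (_, _)); rewrite /linR2 /= /c /s; field; exact: r0.
Qed.

End affine_R2.

Section affine_Cn.
Context {R : realType}.
Local Notation T := (measurableTypeR R).
Local Notation R2 := (T * T)%type.

Lemma lebSE n (f : 'rV[R[i]]_n.+1 -> \bar R) :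
  measurable_fun setT f -> (forall p, 0 <= f p)%E ->
  (\int[leb n.+1]_z f z = \int[leb2]_p \int[leb n]_z f (consC (p, z)))%E.
Proof.
move=> mf f0.
pose m2 : {measure set (R2 * 'rV[R[i]]_n)%type -> \bar R} := (leb2 \x leb n)%E.
rewrite (@eq_measure_integral _ _ _ _ (image_measure m2 measurable_consC)); last first.
  by move=> A mA _.
rewrite ge0_integral_image// /m2.
have mfc : measurable_fun setT (f \o consC (n := n)).
  by apply: measurableT_comp => //; exact: measurable_consC.
have fc0 q : (0 <= (f \o consC (n := n)) q)%E by exact: f0.
exact: (@fubini_tonelli1 _ _ _ _ _ leb2 (leb n) (f \o consC) mfc fc0).
Qed.

Lemma measurable_affine_Cn n (a : R[i]) (b : 'rV[R[i]]_n) :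
  measurable_fun setT (fun z : 'rV[R[i]]_n => a *: z + b).
Proof.
apply: measurable_fun_Cn => j.
rewrite (_ : _ \o _ = linR2 (Re a) (- Im a) (Im a) (Re a) (Re (b 0 j)) (Im (b 0 j))
    \o coordR2 j).
  by apply: measurableT_comp; [exact: measurable_linR2|exact: measurable_coordR2].
apply/funext => z; rewrite /coordR2 /linR2 /= !mxE.
by rewrite RecD ImcD RecM ImcM mulNr [Re a * Im _ + _]addrC.
Qed.

Lemma integral_affine_Cn n (a : R[i]) (b : 'rV[R[i]]_n) (f : 'rV[R[i]]_n -> \bar R) :
  a != 0 -> measurable_fun setT f -> (forall p, 0 <= f p)%E ->
  (\int[leb n]_z f z = ((normc a ^+ 2) ^+ n)%:E * \int[leb n]_z f (a *: z + b)%R)%E.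
Proof.
move=> a0; elim: n b f => [|n IH] b f mf f0.
  rewrite expr0 mul1e; apply: eq_integral => z _; congr f.
  by apply/rowP => -[].
have mfa : measurable_fun setT (fun z : 'rV[R[i]]_n.+1 => f (a *: z + b)).
  by apply: measurableT_comp => //; exact: measurable_affine_Cn.
rewrite lebSE// lebSE//.
have mfc : measurable_fun setT (fun q : R2 * 'rV[R[i]]_n => f (consC q)).
  by apply: measurableT_comp => //; exact: measurable_consC.
have mF : measurable_fun setT (fun p : R2 => \int[leb n]_z f (consC (p, z)))%E.
  exact: (measurable_fun_fubini_tonelli_F (m2 := leb n) (fun q => f (consC q)) mfc).
have F0 p : (0 <= \int[leb n]_z f (consC (p, z)))%E by exact: integral_ge0.
rewrite (@integral_affine_C2 _ a (b 0 ord0) _ a0 mF F0).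
rewrite [in RHS](exprS (normc a ^+ 2) n) [in RHS]EFinM -muleA; congr (_ * _)%E.
pose b' : 'rV[R[i]]_n := \row_k b 0 (lift ord0 k).
pose L := linR2 (Re a) (- Im a) (Im a) (Re a) (Re (b 0 ord0)) (Im (b 0 ord0)).
have E p : (\int[leb n]_z f (consC (L p, z)) =
    ((normc a ^+ 2) ^+ n)%:E * \int[leb n]_z f (a *: consC (p, z) + b)%R)%E.
  have mfp : measurable_fun setT (fun z : 'rV[R[i]]_n => f (consC (L p, z))).
    exact: (measurableT_comp mfc (pair1_measurable _)).
  rewrite (@IH b' _ mfp)//; congr (_ * _)%E; apply: eq_integral => z _; congr f.
  apply/rowP => j; rewrite !mxE; case: unliftP => [k ->|->] /=; first by rewrite !mxE.
  apply: complex_eq; rewrite ?RecD ?ImcD ?RecM ?ImcM /L /linR2 /=; ring.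
under eq_integral do rewrite -/L E.
rewrite ge0_integralZl//.
- apply: (measurable_fun_fubini_tonelli_F (m2 := leb n)
    (fun q => f (a *: consC q + b))) => //.
  exact: (measurableT_comp mfa measurable_consC).
- by move=> p _; exact: integral_ge0.
- by rewrite lee_fin exprn_ge0// exprn_ge0// normc_ge0.
Qed.

End affine_Cn.

(** * Integration on the unit ball *)

Section integral_ae.
Context d (T : measurableType d) (R : realType).
Variable mu : {measure set T -> \bar R}.
Local Open Scope ereal_scope.
Import HBNNSimple.

(** The integral of a nonnegative function is a supremum over simple functions,
   and a simple function below [f] can be cut off on the null set where [f] and
   [g] differ. *)
Lemma ge0_le_integral_ae (f g : T -> \bar R) : (forall x, 0 <= f x) ->
  (forall x, 0 <= g x) -> {ae mu, forall x, f x = g x} ->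
  \int[mu]_x f x <= \int[mu]_x g x.
Proof.
move=> f0 g0 [N [mN N0 fgN]].
rewrite [leLHS]ge0_integralTE// [leRHS]ge0_integralTE//.
apply: ge_ereal_sup => _ [h /= hf <-].
pose h' : {nnsfun T >-> R} := (h \* indic_nnsfun R (measurableC mN))%R.
have hh' : sintegral mu h = sintegral mu h'.
  rewrite -!integralT_nnsfun; apply: ge0_ae_eq_integral => //.
  - exact/measurable_EFinP.
  - exact/measurable_EFinP.
  - by move=> x _; rewrite lee_fin.
  - by move=> x _; rewrite lee_fin.
  - exists N; split => // x /= hx; apply: contrapT => xN; apply: hx => _ /=.
    by rewrite mindicE mem_set ?mulr1.
rewrite hh'; apply: ereal_sup_ubound; exists h' => // x /=.
rewrite mindicE; have [xN|xN] := pselect (N x).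
  by rewrite memNset ?mulr0.
rewrite mem_set// mulr1; have -> // : g x = f x.
by apply/esym; apply: contrapT => fg; exact/xN/fgN.
Qed.

Lemma ge0_integral_ae (f g : T -> \bar R) : (forall x, 0 <= f x) ->
  (forall x, 0 <= g x) -> {ae mu, forall x, f x = g x} ->
  \int[mu]_x f x = \int[mu]_x g x.
Proof.
move=> f0 g0 fg; apply/eqP; rewrite eq_le; apply/andP; split.
  exact: ge0_le_integral_ae.
apply: ge0_le_integral_ae => //; case: fg => N [mN N0 fgN].
exists N; split => // x /= gf; apply: fgN => /= E; exact: gf.
Qed.

Lemma integral_ae (f g : T -> \bar R) : {ae mu, forall x, f x = g x} ->
  \int[mu]_x f x = \int[mu]_x g x.
Proof.
move=> [N [mN N0 fgN]]; rewrite integralE [RHS]integralE.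
congr (_ - _); apply: ge0_integral_ae => //; exists N; split => // x /= hx;
  apply: fgN => /= E; apply: hx; by rewrite ?funeposE ?funenegE E.
Qed.

End integral_ae.

Section transfer.
Context d1 d2 (T1 : measurableType d1) (T2 : measurableType d2) (R : realType).
Variables (mu1 : {measure set T1 -> \bar R}) (mu2 : {measure set T2 -> \bar R}).
Variables (D : set T1) (phi : T2 -> T1) (k : R).
Hypotheses (mD : measurable D) (mphi : measurable_fun setT phi) (k0 : 0 < k).
Hypothesis ge0_transfer : forall f : T1 -> \bar R, measurable_fun setT f ->
  (forall x, 0 <= f x)%E ->
  (\int[mu1]_(x in D) f x = k%:E * \int[mu2]_x f (phi x))%E.
Local Open Scope ereal_scope.

Lemma integrable_transfer (f : T1 -> \bar R) : measurable_fun setT f ->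
  mu1.-integrable D f -> mu2.-integrable setT (f \o phi).
Proof.
move=> mf /integrableP[_ foo]; apply/integrableP; split.
  exact: measurableT_comp.
move: foo; rewrite (ge0_transfer (f := fun x => `|f x|)) //; last first.
  exact: measurableT_comp.
have I0 : 0 <= \int[mu2]_x `|f (phi x)| by exact: integral_ge0.
rewrite [X in _ -> X < _](_ : _ = \int[mu2]_x `|f (phi x)|)//.
by case: (\int[mu2]_x _) I0 => [r _ _||//]; [rewrite ltry|rewrite gt0_muley ?lte_fin].
Qed.

Lemma integral_transfer (f : T1 -> \bar R) : measurable_fun setT f ->
  mu1.-integrable D f -> \int[mu1]_(x in D) f x = k%:E * \int[mu2]_x f (phi x).
Proof.
move=> mf fi; have fpi := integrable_transfer mf fi.
have fP : \int[mu2]_x f (phi x) =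
    \int[mu2]_x f^\+ (phi x) - \int[mu2]_x f^\- (phi x).
  by rewrite [LHS]integralE -[X in X - _]/(\int[mu2]_x (f \o phi)^\+ x)
    -[X in _ - X]/(\int[mu2]_x (f \o phi)^\- x) funepos_comp funeneg_comp.
have Qfin : \int[mu2]_x f^\- (phi x) \is a fin_num.
  by have := integrable_neg_fin_num measurableT fpi; rewrite funeneg_comp.
rewrite fP [LHS]integralE (ge0_transfer (measurable_funepos mf)) ?(ge0_transfer (measurable_funeneg mf))//.
move: (\int[mu2]_x f^\+ _) (\int[mu2]_x f^\- _) Qfin => P Q Qfin.
by rewrite muleBr//; apply: fin_num_adde_defl; rewrite fin_numN.
Qed.

Lemma Rintegral_transfer (f : T1 -> R) : measurable_fun setT f ->
  mu1.-integrable D (EFin \o f) ->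
  (\int[mu1]_(x in D) f x = k * \int[mu2]_x f (phi x))%R.
Proof.
move=> mf fi; rewrite /Rintegral integral_transfer//; last exact/measurable_EFinP.
have mef : measurable_fun setT (EFin \o f) by exact/measurable_EFinP.
rewrite fineM//; exact: (integrable_fin_num measurableT (integrable_transfer mef fi)).
Qed.

Lemma cint_transfer (f : T1 -> R[i]) : cmeasurable setT f ->
  cintegrable mu1 D f -> cintegrable mu2 setT (f \o phi) /\
  cint mu1 D f = (k%:C%C * cint mu2 setT (f \o phi))%R.
Proof.
move=> [m1 m2] [f1 f2]; split.
  have e1 : measurable_fun setT (EFin \o (fun x => Re (f x))) by exact/measurable_EFinP.
  have e2 : measurable_fun setT (EFin \o (fun x => Im (f x))) by exact/measurable_EFinP.
  by split; [exact: (integrable_transfer e1 f1)|exact: (integrable_transfer e2 f2)].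
apply: complex_eq => /=; first by rewrite (Rintegral_transfer m1)// mul0r subr0.
by rewrite (Rintegral_transfer m2)// mul0r addr0.
Qed.

End transfer.

Section nu.
Context {R : realType} {n : nat}.
Local Notation V := 'rV[R[i]]_n.
Local Notation nu := (@nu R n).
Local Notation B := (@uball R n).
Implicit Types (z : V) (f : V -> \bar R) (t : R) (c : R[i]).

Lemma enormZ c z : enorm (c *: z) = normc c * enorm z.
Proof.
rewrite /enorm; have -> : \sum_j normc ((c *: z) 0 j) ^+ 2 =
    normc c ^+ 2 * \sum_j normc (z 0 j) ^+ 2.
  by rewrite mulr_sumr; apply: eq_bigr => j _; rewrite mxE normcM exprMn.
by rewrite sqrtrM ?sqr_ge0// sqrtr_sqr ger0_norm ?normc_ge0.
Qed.

Lemma enorm_ge0 z : 0 <= enorm z. Proof. exact: sqrtr_ge0. Qed.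

Lemma sqr_enorm z : enorm z ^+ 2 = \sum_j normc (z 0 j) ^+ 2.
Proof. by rewrite sqr_sqrtr// sumr_ge0// => j _; rewrite sqr_ge0. Qed.

Lemma measurable_coord j : cmeasurable setT (fun z : V => z 0 j).
Proof.
have mj := @measurable_coordR2 R n j; split.
  by rewrite (_ : (fun z => _) = fst \o coordR2 j)//; exact: measurableT_comp.
by rewrite (_ : (fun z => _) = snd \o coordR2 j)//; exact: measurableT_comp.
Qed.

Lemma measurable_sqr_enorm : measurable_fun setT (fun z : V => enorm z ^+ 2).
Proof.
under eq_fun do rewrite sqr_enorm.
apply: measurable_sum => j.
exact: (measurable_sqr_normc (measurable_coord j)).
Qed.

Lemma measurable_enorm : measurable_fun setT (@enorm R n).
Proof.
rewrite (_ : @enorm R n = fun z => Num.sqrt (enorm z ^+ 2)); last first.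
  by apply/funext => z; rewrite sqrtr_sqr ger0_norm ?enorm_ge0.
apply: measurableT_comp; last exact: measurable_sqr_enorm.
by apply: continuous_measurable_fun; exact: sqrt_continuous.
Qed.

Lemma measurable_ball t : measurable [set z : V | enorm z < t].
Proof.
rewrite (_ : [set z | _] = @enorm R n @^-1` `]-oo, t[).
  by rewrite -[X in measurable X]setTI; exact: measurable_enorm.
by apply/seteqP; split => z /=; rewrite in_itv.
Qed.

Let mB : measurable B. Proof. exact: measurable_uball. Qed.
Let mBC : measurable (~` B). Proof. exact: measurableC. Qed.

Let vol : R := (volB n)%:num.

Lemma volB_gt0 : 0 < vol.
Proof. by rewrite /vol /= fine_gt0// leb_uball_gt0 leb_uball_lty. Qed.

Lemma nu_setC_ball : nu (~` B) = 0%E.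
Proof.
transitivity ((volB n)%:num^-1%:E * leb n (~` B `&` B))%E; first by [].
by rewrite setICl measure0 mule0.
Qed.

Lemma nu_setT : nu setT = 1%E.
Proof.
rewrite -(setUv B) (measureU _ mB mBC) ?setICr//.
by rewrite [X in (X + _)%E](@nu_uball R n) [X in (_ + X)%E]nu_setC_ball adde0.
Qed.

Lemma nu_lty (A : set V) : measurable A -> (nu A < +oo)%E.
Proof.
move=> mA; apply: (@le_lt_trans _ _ (nu setT)); last by rewrite nu_setT ltry.
by apply: le_measure; rewrite ?inE.
Qed.

Lemma ae_ball (P : V -> Prop) : (forall z, B z -> P z) -> {ae nu, forall z, P z}.
Proof.
move=> BP; exists (~` B); split; [exact: mBC|exact: nu_setC_ball|].
by move=> z /= nP Bz; exact/nP/BP.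
Qed.

Lemma ge0_integral_nu f : measurable_fun setT f -> (forall z, 0 <= f z)%E ->
  (\int[nu]_z f z = (vol^-1)%:E * \int[leb n]_(z in B) f z)%E.
Proof.
move=> mf f0; rewrite (ge0_integral_mscale _ measurableT)//; congr (_ * _)%E.
have mN : mrestr (leb n) (@measurable_uball R n) (~` B) = 0%E.
  by rewrite /mrestr setICl measure0.
rewrite (ge0_negligible_integral (N := ~` B))//.
rewrite setDE setCK setTI; apply: eq_measure_integral => A mA AB.
by rewrite /= /mrestr setIidl.
Qed.

Lemma nu_ge0_finite f (K : R) : (forall z, 0 <= f z)%E -> measurable_fun setT f ->
  (forall z, B z -> f z <= K%:E)%E -> (\int[nu]_z f z < +oo)%E.
Proof.
move=> f0 mf fK; rewrite ge0_integral_nu//.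
have K0 : 0 <= `|K| by [].
apply: (@le_lt_trans _ _ ((vol^-1)%:E * \int[leb n]_(z in B) `|K|%:E)%E).
  apply: lee_wpmul2l; first by rewrite lee_fin invr_ge0 ltW// volB_gt0.
  apply: ge0_le_integral => //; first exact: measurable_funTS.
  by move=> z Bz; apply: le_trans (fK _ Bz) _; rewrite lee_fin ler_norm.
rewrite integral_cst//= lte_mul_pinfty ?lee_fin ?invr_ge0 ?(ltW volB_gt0)//.
by rewrite lte_mul_pinfty// leb_uball_lty.
Qed.

Lemma ball_rot c z : normc c = 1 -> B (c *: z) = B z.
Proof. by move=> c1; rewrite /uball /= enormZ c1 mul1r. Qed.

Lemma restrictP (A A' : set V) f g z z' : (A z <-> A' z') -> (A z -> f z = g z') ->
  (f \_ A) z = (g \_ A') z'.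
Proof.
move=> AA fg; rewrite !patchE; have [Az|Az] := pselect (A z).
  by rewrite !mem_set//; [exact: fg|exact/AA].
by rewrite !memNset// => /AA.
Qed.

Lemma ge0_integral_nu_rot c : normc c = 1 -> forall f, measurable_fun setT f ->
  (forall z, 0 <= f z)%E -> (\int[nu]_z f z = 1%:E * \int[nu]_z f (c *: z)%R)%E.
Proof.
move=> c1 f mf f0; rewrite mul1e.
have cN0 : c != 0 by rewrite -normc_eq0 c1 oner_neq0.
have mc : measurable_fun setT (fun z => f (c *: z)).
  have := @measurable_affine_Cn R n c 0; under eq_fun do rewrite addr0.
  by move=> h; exact: measurableT_comp.
rewrite !ge0_integral_nu//; congr (_ * _)%E.
rewrite integral_mkcond [RHS]integral_mkcond.
rewrite (@integral_affine_Cn _ _ c 0 _ cN0)//; last 2 first.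
- by apply/(measurable_restrictT _ mB); exact: measurable_funTS.
- by move=> z; exact: erestrict_ge0.
rewrite c1 expr1n expr1n mul1e; apply: eq_integral => z _.
by rewrite addr0; apply: restrictP => //; rewrite ball_rot.
Qed.

(** Homotheties: the measure has real dimension [2 n]. *)
Lemma ge0_integral_nu_scale t : 0 < t -> t <= 1 -> forall f, measurable_fun setT f ->
  (forall z, 0 <= f z)%E ->
  (\int[nu]_(z in [set z | (enorm z < t)%R]) f z =
   (t ^+ (2 * n))%:E * \int[nu]_z f (t%:C%C *: z)%R)%E.
Proof.
move=> t0 t1 f mf f0.
have nt : normc (t%:C%C : R[i]) = t by rewrite normc_real gtr0_norm.
have tN0 : (t%:C%C : R[i]) != 0 by rewrite -normc_eq0 nt gt_eqF.
have mt : measurable_fun setT (fun z => f (t%:C%C *: z)).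
  have := @measurable_affine_Cn R n t%:C%C 0; under eq_fun do rewrite addr0.
  by move=> h; exact: measurableT_comp.
have mBt := measurable_ball t.
have mft : measurable_fun setT (f \_ [set z | enorm z < t]).
  by apply/(measurable_restrictT _ mBt); exact: measurable_funTS.
have ft0 z : (0 <= (f \_ [set z | (enorm z < t)%R]) z)%E by exact: erestrict_ge0.
rewrite integral_mkcond (ge0_integral_nu mft ft0) (ge0_integral_nu mt)//.
rewrite muleCA; congr (_ * _)%E.
rewrite integral_mkcond [X in (_ * X)%E]integral_mkcond.
rewrite (@integral_affine_Cn _ _ t%:C%C 0 _ tN0)//; last 2 first.
- by apply/(measurable_restrictT _ mB); exact: measurable_funTS.
- by move=> z; apply: erestrict_ge0 => y _; exact: ft0.
rewrite nt -exprM; congr (_ * _)%E; apply: eq_integral => z _.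
rewrite addr0; have [Bz|Bz] := pselect (B z).
  have tz : enorm (t%:C%C *: z) < t by rewrite enormZ nt gtr_pMr.
  have Btz : B (t%:C%C *: z) by rewrite /uball /=; exact: lt_le_trans t1.
  by rewrite !patchE !mem_set.
rewrite [RHS]patchE memNset// patchE; case: ifPn => // _.
rewrite patchE memNset//= enormZ nt gtr_pMr//; exact: Bz.
Qed.

Lemma cint_nu_rot c (f : V -> R[i]) : normc c = 1 -> cmeasurable setT f ->
  cintegrable nu setT f -> cintegrable nu setT (fun z => f (c *: z)) /\
  cint nu setT f = cint nu setT (fun z => f (c *: z)).
Proof.
move=> c1 mf fi.
have mc : measurable_fun setT (fun z : V => c *: z).
  by have := @measurable_affine_Cn R n c 0; under eq_fun do rewrite addr0.
have [? ->] := cint_transfer mc ltr01 (ge0_integral_nu_rot c1) mf fi.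
by rewrite mul1r.
Qed.

Lemma cint_nu_scale t (f : V -> R[i]) : 0 < t -> t <= 1 -> cmeasurable setT f ->
  cintegrable nu setT f -> cintegrable nu setT (fun z => f (t%:C%C *: z)) /\
  cint nu [set z | enorm z < t] f =
    (t ^+ (2 * n))%:C%C * cint nu setT (fun z => f (t%:C%C *: z)).
Proof.
move=> t0 t1 mf [f1 f2].
have mt : measurable_fun setT (fun z : V => t%:C%C *: z).
  by have := @measurable_affine_Cn R n t%:C%C 0; under eq_fun do rewrite addr0.
have tn0 : 0 < t ^+ (2 * n) by rewrite exprn_gt0.
apply: (cint_transfer mt tn0 (ge0_integral_nu_scale t0 t1) mf).
by split; apply: integrableS measurableT (measurable_ball t) _ _ => //.
Qed.

End nu.

(** * Holomorphic functions on the ball *)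

Section sum_norm.
Context {R : realType} {n : nat}.
Local Notation V := 'rV[R[i]]_n.
Implicit Types (a b h z : V) (c : R[i]).

Definition nrm1 h : R := \sum_j normc (h 0 j).

Lemma nrm1_ge0 h : 0 <= nrm1 h.
Proof. by apply: sumr_ge0 => j _; exact: normc_ge0. Qed.

Lemma nrm1D a b : nrm1 (a + b) <= nrm1 a + nrm1 b.
Proof.
by rewrite /nrm1 -big_split; apply: ler_sum => j _; rewrite mxE le_normcD.
Qed.

Lemma nrm1Z c a : nrm1 (c *: a) = normc c * nrm1 a.
Proof. by rewrite /nrm1 mulr_sumr; apply: eq_bigr => j _; rewrite mxE normcM. Qed.

Lemma nrm1_0 : nrm1 0 = 0.
Proof. by apply: big1 => j _; rewrite mxE ComplexField.Normc.normc0. Qed.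

Lemma le_coord_nrm1 a j : normc (a 0 j) <= nrm1 a.
Proof.
by rewrite /nrm1 (bigD1 j)//= lerDl sumr_ge0// => k _; exact: normc_ge0.
Qed.

Lemma coord_ball (d : R) h : 0 < d -> (forall j, normc (h 0 j) < d) ->
  ball (0 : V) d%:C%C h.
Proof.
move=> d0 hd; split; first by rewrite ltcR.
move=> i j; rewrite !ord1 mxE -ball_normE /= sub0r normrN normrCE ltcR; exact: hd.
Qed.

Lemma norm_le_nrm1 h : `|h| <= (nrm1 h)%:C%C.
Proof.
have r0 : 0 <= (nrm1 h)%:C%C by rewrite ler0c nrm1_ge0.
rewrite real_leNgt ?normr_real ?ger0_real//; apply/negP => lt.
have h0 : 0 < `|h| := le_lt_trans r0 lt.
have E : `|h| = (Re `|h|)%:C%C by rewrite RRe_real// normr_real.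
have := coord_ball (h := h) (d := Re `|h|).
rewrite -E -ball_normE /= sub0r normrN ltxx => H.
suff : false by []; apply: H; first by move: h0; rewrite E ltcR.
by move=> j; rewrite E ltcR in lt; apply: le_lt_trans lt; exact: le_coord_nrm1.
Qed.

Lemma coord_le_norm h j : `|h 0 j| <= `|h|.
Proof.
rewrite real_leNgt ?normr_real//; apply/negP => lt.
have : ball (0 : V) `|h 0 j| h by rewrite -ball_normE /= sub0r normrN.
by move=> [_ /(_ 0 j)]; rewrite mxE -ball_normE /= sub0r normrN ltxx.
Qed.

Lemma nrm1_le_norm h : (nrm1 h)%:C%C <= `|h| *+ n.
Proof.
rewrite /nrm1 rmorph_sum /= -[X in _ *+ X]card_ord -sumr_const.
by apply: ler_sum => j _; rewrite -normrCE coord_le_norm.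
Qed.

Lemma near_nrm1 (P : V -> Prop) : (\forall h \near (0 : V), P h) <->
  exists2 d : R, 0 < d & forall h, nrm1 h < d -> P h.
Proof.
split.
  move=> /nbhs_ballP[e /= e0 he].
  have E : e = (Re e)%:C%C by rewrite RRe_real// gtr0_real.
  have d0 : 0 < Re e by move: e0; rewrite E ltcR.
  exists (Re e) => // h hd; apply: he; rewrite E; apply: coord_ball => // j.
  by apply: le_lt_trans hd; exact: le_coord_nrm1.
move=> [d d0 hd]; apply/nbhs_ballP; exists (d / n.+1%:R)%:C%C => /=.
  by rewrite ltcR divr_gt0.
move=> h [_ hb]; apply: hd.
apply: (@le_lt_trans _ _ (\sum_(j < n) (d / n.+1%:R))).
  apply: ler_sum => j _; have := hb 0 j.
  by rewrite mxE -ball_normE /= sub0r normrN normrCE ltcR => /ltW.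
rewrite sumr_const card_ord -[X in X < _]mulr_natr mulrAC ltr_pdivrMr//.
by rewrite ltr_pM2l// ltr_nat.
Qed.

End sum_norm.

Section differentiability.
Context {R : realType} {n : nat}.
Local Notation V := 'rV[R[i]]_n.
Implicit Types (f : V -> R[i]) (a b h z : V) (l : 'I_n -> R[i]).

Definition lform l h : R[i] := \sum_j h 0 j * l j.

Definition hdiff f a l := forall e : R, 0 < e -> exists2 d : R, 0 < d &
  forall h, nrm1 h < d -> normc (f (a + h) - f a - lform l h) <= e * nrm1 h.

Lemma lform_linear l : linear (lform l : V -> R[i]).
Proof.
move=> c u v; rewrite /lform scaler_sumr -big_split; apply: eq_bigr => j _.
by rewrite !mxE mulrDl; congr (_ + _); rewrite -mulrA.
Qed.

Lemma normc_lform l h (K : R) : (forall j, normc (l j) <= K) ->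
  normc (lform l h) <= K * nrm1 h.
Proof.
move=> lK; rewrite /lform /nrm1 mulr_sumr.
elim/big_ind2 : _ => [|x1 y1 x2 y2 h1 h2|j _].
- by rewrite ComplexField.Normc.normc0.
- by apply: le_trans (le_normcD _ _) _; rewrite lerD.
- by rewrite normcM mulrC ler_wpM2r ?normc_ge0.
Qed.

Lemma lform_exists_bound l : exists2 K : R, 0 <= K & forall j, normc (l j) <= K.
Proof.
exists (\sum_j normc (l j)); first by apply: sumr_ge0 => j _; exact: normc_ge0.
move=> j; rewrite (bigD1 j)//= lerDl; apply: sumr_ge0 => k _; exact: normc_ge0.
Qed.

Lemma differentiableP_hdiff f a : differentiable f a <-> exists l, hdiff f a l.
Proof.
split.
  move=> /[dup] df /diff_locallyP[_ /eqaddoP fo].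
  exists (fun j => 'd f a (delta_mx 0 j)) => e e0.
  have e0' : 0 < e%:C%C by rewrite ltcR.
  have /near_nrm1[d d0 hd] := fo _ e0'; exists d => // h /hd H.
  have {}H : `|f (h + a) - (f a + 'd f a h)| <= e%:C%C * `|h| := H.
  rewrite -lecR -normrCE rmorphM /=.
  have -> : lform (fun j => 'd f a (delta_mx 0 j)) h = 'd f a h.
    rewrite [in RHS](row_sum_delta h) linear_sum; apply: eq_bigr => j _.
    by rewrite linearZ.
  have -> : f (a + h) - f a - 'd f a h = f (h + a) - (f a + 'd f a h).
    by rewrite [a + h]addrC opprD addrA.
  by apply: le_trans H _; rewrite ler_wpM2l ?norm_le_nrm1// ltW.
move=> [l hl].
pose L : {linear V -> R[i]} := HB.pack (lform l) (GRing.isLinear.Build _ _ _ _ (lform l) (lform_linear l)).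
have [K K0 lK] := lform_exists_bound l.
have Lc : continuous L.
  apply: bounded_linear_continuous; apply/linear_boundedP.
  exists (K *+ n)%:C%C; split; first by rewrite ger0_real// ler0c mulrn_wge0.
  move=> M KM h; rewrite [`|L h|]normrCE.
  apply: (@le_trans _ _ (K * nrm1 h)%:C%C); first by rewrite lecR normc_lform.
  rewrite rmorphM /=; apply: le_trans (ler_wpM2l _ (nrm1_le_norm h)) _.
    by rewrite ler0c.
  rewrite mulrnAr -mulrnAl ler_wpM2r// ltW//.
  by move: KM; rewrite rmorphMn.
have fL : f \o shift a = cst (f a) + L +o_ (0 : V) id.
  apply/eqaddoP => e e0.
  have E : e = (Re e)%:C%C by rewrite RRe_real// gtr0_real.
  have r0 : 0 < Re e by move: e0; rewrite E ltcR.
  have r1 : 0 < Re e / n.+1%:R by rewrite divr_gt0.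
  have [d d0 hd] := hl _ r1; apply/near_nrm1; exists d => // h /hd H.
  suff : `|f (h + a) - (f a + lform l h)| <= e * `|h| by [].
  rewrite [h + a]addrC opprD addrA normrCE E.
  apply: (@le_trans _ _ (Re e / n.+1%:R * nrm1 h)%:C%C); first by rewrite lecR.
  rewrite !rmorphM /= -mulrA; apply: ler_wpM2l; first by rewrite ler0c ltW.
  apply: le_trans (ler_wpM2l _ (nrm1_le_norm h)) _; first by rewrite ler0c invr_ge0.
  rewrite -[X in _ * X]mulr_natr mulrCA -[leRHS]mulr1 ler_wpM2l//.
  rewrite -(rmorph_nat (real_complex R) n) -rmorphM /= lecR mulrC.
  by rewrite ler_pdivrMr// mul1r ler_nat.
have dL := diff_unique Lc fL.
by apply/diff_locallyP; rewrite dL; split.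
Qed.

Lemma hdiff_line f a l b (p : R[i]) : hdiff f (a + p *: b) l ->
  cder (fun x => f (a + x *: b)) p (lform l b).
Proof.
move=> fl e e0; have N0 := nrm1_ge0 b.
have e1 : 0 < e / (1 * (nrm1 b + 1)) by rewrite divr_gt0// mul1r ltr_wpDl.
have [d d0 hd] := fl _ e1.
exists (d / (nrm1 b + 1)); first by rewrite divr_gt0// ltr_wpDl.
move=> h hlt.
have hb : nrm1 (h *: b) < d.
  rewrite nrm1Z; apply: (@le_lt_trans _ _ (normc h * (nrm1 b + 1))).
    by rewrite ler_wpM2l ?normc_ge0// lerDl.
  by rewrite -ltr_pdivlMr// ltr_wpDl.
have := hd _ hb; rewrite scalerDl addrA => H.
have -> : lform l b * h = lform l (h *: b).
  rewrite /lform mulr_suml; apply: eq_bigr => j _; rewrite mxE; ring.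
apply: le_trans H _; rewrite nrm1Z mulrCA mulrC ler_wpM2r ?normc_ge0//.
by rewrite -[leRHS]divr1; apply: ler_div_succM => //; exact: ltW.
Qed.

Definition hcont f a := forall e : R, 0 < e -> exists2 d : R, 0 < d &
  forall h, nrm1 h < d -> normc (f (a + h) - f a) <= e.

Lemma hdiff_cont f a l : hdiff f a l -> hcont f a.
Proof.
move=> fl e e0; have [d d0 hd] := fl _ ltr01.
have [K K0 lK] := lform_exists_bound l.
have K1 : 0 < K + 1 by rewrite ltr_wpDl.
exists (Num.min d (e / (K + 1))); first by rewrite lt_min d0 divr_gt0.
move=> h; rewrite lt_min => /andP[/hd H he].
rewrite -[X in normc X](subrK (lform l h)); apply: le_trans (le_normcD _ _) _.
apply: le_trans (lerD H (normc_lform _ lK)) _.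
by rewrite -mulrDl mulrC addrC -ler_pdivlMr// ltW.
Qed.

End differentiability.

Section ball_geometry.
Context {R : realType} {n : nat}.
Local Notation V := 'rV[R[i]]_n.
Local Notation B := (@uball R n).
Implicit Types (a b h z w : V).

Lemma uball_sqr z : B z <-> enorm z ^+ 2 < 1.
Proof.
by rewrite -[X in _ <-> (_ < X)](expr1n R 2%N) ltr_pXn2r ?nnegrE ?enorm_ge0.
Qed.

Lemma uball_open a : B a -> exists2 r : R, 0 < r & forall h, nrm1 h < r -> B (a + h).
Proof.
move=> /[dup] Ba /uball_sqr aS; set S := enorm a ^+ 2 in aS.
pose r := Num.min 1 ((1 - S) / 3).
exists r; first by rewrite lt_min ltr01 divr_gt0// subr_gt0.
move=> h; rewrite lt_min => /andP[h1 h2]; apply/uball_sqr.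
have a1 j : normc (a 0 j) <= 1.
  rewrite -[leRHS](expr1n R 2%N) -(ler_pXn2r (n := 2)) ?nnegrE ?normc_ge0//.
  rewrite !expr1n; apply: le_trans (ltW aS); rewrite /S sqr_enorm (bigD1 j)//= lerDl.
  by apply: sumr_ge0 => k _; exact: sqr_ge0.
apply: (@le_lt_trans _ _ (\sum_j (normc (a 0 j) ^+ 2 + 3 * normc (h 0 j)))).
  rewrite sqr_enorm; apply: ler_sum => j _; rewrite mxE.
  have hj : normc (h 0 j) <= 1 by apply: le_trans (le_coord_nrm1 _ _) (ltW h1).
  have A := a1 j; have Na := normc_ge0 (a 0 j); have Nh := normc_ge0 (h 0 j).
  apply: (@le_trans _ _ ((normc (a 0 j) + normc (h 0 j)) ^+ 2)).
    by rewrite ler_pXn2r ?nnegrE ?normc_ge0 ?addr_ge0// le_normcD.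
  by nra.
rewrite big_split /= -sqr_enorm -/S -mulr_sumr -/(nrm1 h); lra.
Qed.

Definition cut (f : V -> R[i]) z : R[i] := if enorm z < 1 then f z else 0.

Lemma cutE f z : B z -> cut f z = f z.
Proof. by rewrite /cut /uball /= => ->. Qed.

(** Rounding the real coordinates to multiples of [1 / k.+1]. *)
Definition grid (k : nat) z : {ffun 'I_n -> int * int} :=
  [ffun j => (Num.floor (k.+1%:R * Re (z 0 j)), Num.floor (k.+1%:R * Im (z 0 j)))].

Definition gridpoint (k : nat) (c : {ffun 'I_n -> int * int}) : V :=
  \row_j Complex ((c j).1%:~R / k.+1%:R) ((c j).2%:~R / k.+1%:R).

Lemma measurable_floor_set (k : nat) (m : int) :
  measurable ([set x : R | Num.floor (k.+1%:R * x) = m] : set (measurableTypeR R)).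
Proof.
rewrite (_ : [set x | _] = `[m%:~R / k.+1%:R, (m + 1)%:~R / k.+1%:R[%classic).
  exact: measurable_itv.
have k0 : 0 < k.+1%:R :> R by [].
apply/seteqP; split => x /=; rewrite in_itv /= ler_pdivrMr// ltr_pdivlMr// ![x * _]mulrC.
  by move=> <-; rewrite floor_le floorD1_gt.
by move=> xm; apply: floor_def.
Qed.

Lemma measurable_grid k c : measurable [set z : V | grid k z = c].
Proof.
rewrite (_ : [set z | _] = \bigcap_(j in [set: 'I_n])
  coordR2 j @^-1` ([set x | Num.floor (k.+1%:R * x) = (c j).1] `*`
                   [set x | Num.floor (k.+1%:R * x) = (c j).2])).
  apply: fin_bigcap_measurable => // j _.
  rewrite -[X in measurable X]setTI; apply: measurable_coordR2 => //.
  by apply: measurableX; exact: measurable_floor_set.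
apply/seteqP; split => z /=.
  by move=> <- j _ /=; rewrite ffunE.
move=> h; apply/ffunP => j; rewrite ffunE.
by have [/= -> ->] := h j Logic.I; case: (c j).
Qed.

Lemma measurable_gridded (g : {ffun 'I_n -> int * int} -> R) k :
  measurable_fun setT (g \o grid k : V -> measurableTypeR R).
Proof.
move=> _ Y mY; rewrite setTI.
rewrite (_ : _ @^-1` Y = \bigcup_i
  (if @unpickle {ffun 'I_n -> int * int} i is Some c
   then [set z : V | grid k z = c /\ Y (g c)] else set0)).
  apply: bigcupT_measurable => i; case: unpickle => // c.
  have [Yc|Yc] := pselect (Y (g c)).
    rewrite (_ : [set z | _] = [set z : V | grid k z = c]).
      exact: measurable_grid.
    by apply/seteqP; split => z /=; [case|].
  rewrite (_ : [set z | _] = set0)//.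
  by apply/seteqP; split => z //= -[].
apply/seteqP; split => z /=.
  by move=> Yz; exists (pickle (grid k z)) => //; rewrite pickleK.
by move=> [i _]; case: unpickle => // c [zc Yc]; rewrite /= zc.
Qed.

Lemma gridpoint_close k z : nrm1 (gridpoint k (grid k z) - z) <= (2 * n)%:R / k.+1%:R.
Proof.
apply: (@le_trans _ _ (\sum_(j < n) (2 / k.+1%:R))); last first.
  by rewrite sumr_const card_ord -[leLHS]mulr_natr natrM mulrAC.
apply: ler_sum => j _; rewrite !mxE ffunE /=.
have H (x : R) : `|(Num.floor (k.+1%:R * x))%:~R / k.+1%:R - x| <= k.+1%:R^-1.
  have k0 : 0 < k.+1%:R :> R by [].
  have := floor_le (k.+1%:R * x); have := floorD1_gt (k.+1%:R * x).
  rewrite intrD; set m := (Num.floor _)%:~R => h1 h2.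
  have -> : m / k.+1%:R - x = (m - k.+1%:R * x) / k.+1%:R by field.
  rewrite normrM [X in _ * X]ger0_norm ?invr_ge0// ler_piMl ?invr_ge0//.
  by rewrite ler_norml; apply/andP; split; lra.
apply: le_trans (normc_leD _) _; rewrite RecD RecN ImcD ImcN /=.
by rewrite mulrDl mul1r lerD.
Qed.

Lemma cut_measurable f : (forall z, B z -> hcont f z) -> cmeasurable setT (cut f).
Proof.
move=> fc.
pose g k z := cut f (gridpoint k (grid k z)) * (if enorm z < 1 then 1 else 0).
have mB1 : measurable_fun setT (fun z : V => if enorm z < 1 then 1 else 0 : R).
  have -> : (fun z : V => if enorm z < 1 then 1 else 0 : R) = \1_B.
    apply/funext => z; rewrite indicE; have [h|h] := boolP (enorm z < 1).
      by rewrite mem_set.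
    by rewrite memNset//; exact/negP.
  by apply: measurable_indic; exact: measurable_uball.
have lim z : forall e : R, 0 < e -> exists N, forall k, (N <= k)%N ->
    normc (cut f z - g k z) <= e.
  move=> e e0; rewrite /g; have [Bz|nBz] := boolP (enorm z < 1); last first.
    by exists 0%N => k _; rewrite mulr0 /cut (negbTE nBz) subrr ComplexField.Normc.normc0 ltW.
  have [d1 d10 h1] := fc z Bz e e0; have [d2 d20 h2] := uball_open Bz.
  pose d := Num.min d1 d2; have d0 : 0 < d by rewrite lt_min d10.
  exists (Num.truncn ((2 * n)%:R / d)) => k Nk; rewrite mulr1.
  have kd : nrm1 (gridpoint k (grid k z) - z) < d.
    apply: le_lt_trans (gridpoint_close k z) _.
    rewrite ltr_pdivrMr// mulrC -ltr_pdivrMr//.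
    by apply: lt_le_trans (truncnS_gt _) _; rewrite ler_nat ltnS.
  move: kd; rewrite lt_min => /andP[k1 k2].
  have := h1 _ k1; have := h2 _ k2; rewrite subrKC => Bg hg.
  by rewrite !cutE// normc_distC.
have cvg (p : R[i] -> R) : (forall x y, `|p x - p y| <= normc (x - y)) ->
    (forall k, measurable_fun setT (fun z => p (g k z))) ->
    measurable_fun setT (fun z => p (cut f z)).
  move=> pl mp; apply/measurable_EFinP.
  apply: (emeasurable_fun_cvg (fun k z => (p (g k z))%:E)).
    by move=> k; exact/measurable_EFinP.
  move=> z _; apply/fine_cvgP; split; first exact: nearW.
  apply/cvgrPdist_le => e e0; have [N hN] := lim z e e0.
  exists N => // k /= Nk; exact: le_trans (pl _ _) (hN _ Nk).
split.
  apply: (cvg (@complex.Re R)) => [x y|k]; first by rewrite -RecN -RecD le_Re_normc.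
  rewrite (_ : (fun z => _) = (fun z => Re (cut f (gridpoint k (grid k z))) *
      (if enorm z < 1 then 1 else 0))).
    apply: measurable_funM => //.
    exact: (measurable_gridded (fun c => Re (cut f (gridpoint k c)))).
  by apply/funext => z; rewrite /g; case: ifP => _; rewrite ?mulr1// !mulr0.
apply: (cvg (@complex.Im R)) => [x y|k]; first by rewrite -ImcN -ImcD le_Im_normc.
rewrite (_ : (fun z => _) = (fun z => Im (cut f (gridpoint k (grid k z))) *
    (if enorm z < 1 then 1 else 0))).
  apply: measurable_funM => //.
  exact: (measurable_gridded (fun c => Im (cut f (gridpoint k c)))).
by apply/funext => z; rewrite /g; case: ifP => _; rewrite ?mulr1// !mulr0.
Qed.

Lemma holomorphic_cont (f : V -> R[i]) z : holomorphic f -> B z -> hcont f z.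
Proof. by move=> hf /hf/differentiableP_hdiff[l /hdiff_cont]. Qed.

Lemma holomorphic_measurable (f : V -> R[i]) : holomorphic f -> cmeasurable setT (cut f).
Proof. by move=> hf; apply: cut_measurable => z; exact: holomorphic_cont. Qed.

Lemma ae_cut (f : V -> R[i]) : {ae nu n, forall z, cut f z = f z}.
Proof. by apply: ae_ball => z Bz; rewrite cutE. Qed.

End ball_geometry.

Section local_bound.
Context {R : realType} {n : nat}.
Local Notation V := 'rV[R[i]]_n.
Local Notation B := (@uball R n).
Local Notation nu := (@nu R n).
Local Notation T := (measurableTypeR R).
Local Notation mu := (@lebesgue_measure R).
Local Notation circ := (`[0, pi *+ 2]%classic : set T).
Implicit Types (a b h z w : V) (v : V -> R[i]).

Lemma holomorphic_line v a b (p : R[i]) : holomorphic v -> B (a + p *: b) ->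
  exists A, cder (fun x => v (a + x *: b)) p A.
Proof.
by move=> hv /hv/differentiableP_hdiff[l hl]; exists (lform l b); exact: hdiff_line.
Qed.

Definition sqnorm v : \bar R := (\int[nu]_z (normc (v z) ^+ 2)%:E)%E.

Lemma sqnorm_ge0 v : (0 <= sqnorm v)%E.
Proof. by apply: integral_ge0 => z _; rewrite lee_fin sqr_ge0. Qed.

Lemma measurable_nrm1_ball (r : R) : measurable [set z : V | nrm1 z < r].
Proof.
rewrite (_ : [set z | _] = @nrm1 R n @^-1` `]-oo, r[).
  rewrite -[X in measurable X]setTI.
  have mN : measurable_fun setT (@nrm1 R n).
    by apply: measurable_sum => j; exact: (measurable_normc (measurable_coord j)).
  exact: mN.
by apply/seteqP; split => z /=; rewrite in_itv.
Qed.

Lemma leb_nrm1_ball_gt0 (r : R) : 0 < r -> (0 < leb n [set z : V | nrm1 z < r]%R)%E.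
Proof.
move=> r0; pose s := r / (2 * n).+1%:R.
have s0 : 0 < s by rewrite divr_gt0.
have [mc cE] := leb_cube n s0.
apply: (@lt_le_trans _ _ (leb n (cube n s))).
  by rewrite [ltRHS]cE lte_fin exprn_gt0// mulr_gt0// exprn_gt0.
apply: le_measure; rewrite ?inE//; first exact: measurable_nrm1_ball.
move=> z hz /=; apply: (@le_lt_trans _ _ (\sum_(j < n) (2 * s))).
  apply: ler_sum => j _; have [/= h1 h2] := hz j.
  apply: le_trans (normc_leD _) _; rewrite mulrDl mul1r.
  move: h1 h2; rewrite !in_itv /= => /andP[? ?] /andP[? ?].
  by apply: lerD; rewrite ler_norml; apply/andP; split; lra.
rewrite sumr_const card_ord -[X in X < _]mulr_natr /s.
have -> : 2 * (r / (2 * n).+1%:R) * n%:R = r * (2 * n)%:R / (2 * n).+1%:R.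
  have : (2 * n).+1%:R != 0 :> R by rewrite pnatr_eq0.
  by rewrite natrM; move: ((2 * n).+1%:R : R) => m m0; field.
by rewrite ltr_pdivrMr// ltr_pM2l// ltr_nat.
Qed.

Lemma integral_indic_mul d (X : measurableType d) (m : {measure set X -> \bar R})
    (D : set X) (f : X -> R) :
  (\int[m]_(x in D) (f x)%:E = \int[m]_x (\1_D x * f x)%:E)%E.
Proof.
rewrite integral_mkcond; apply: eq_integral => x _; rewrite patchE indicE.
by case: (x \in D); rewrite ?mul1r ?mul0r.
Qed.

Lemma measurable_rotate a :
  measurable_fun setT (fun p : T * V => a + cis p.1 *: p.2).
Proof.
apply: measurable_fun_Cn => j.
have mc : measurable_fun setT (fun p : T * V => cos p.1).
  apply: measurableT_comp => //; apply: continuous_measurable_fun; exact: continuous_cos.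
have ms : measurable_fun setT (fun p : T * V => sin p.1).
  apply: measurableT_comp => //; apply: continuous_measurable_fun; exact: continuous_sin.
have [mx my] := measurable_coord (R := R) (n := n) j.
have mx' : measurable_fun setT (fun p : T * V => Re (p.2 0 j)).
  exact: (measurableT_comp mx measurable_snd).
have my' : measurable_fun setT (fun p : T * V => Im (p.2 0 j)).
  exact: (measurableT_comp my measurable_snd).
apply: measurable_fun_pair.
  under eq_fun do rewrite /= mxE RecD mxE RecM /=.
  by apply: measurable_funD => //; apply: measurable_funB; exact: measurable_funM.
under eq_fun do rewrite /= mxE ImcD mxE ImcM /=.
by apply: measurable_funD => //; apply: measurable_funD; exact: measurable_funM.
Qed.

(** Mean value property for the holomorphic function [v ^ 2]. *)
Lemma circle_mean v z w : holomorphic v ->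
  (forall c : R[i], normc c < 2 -> B (z + c *: w)) ->
  (((pi *+ 2) * normc (v z) ^+ 2)%:E <=
   2%:E * \int[mu]_(y in circ) (normc (cut v (z + cis y *: w)) ^+ 2)%:E)%E.
Proof.
move=> hv hB; have pi0 : 0 <= pi *+ 2 :> R by rewrite mulrn_wge0// pi_ge0.
pose F (c : R[i]) := v (z + c *: w) * v (z + c *: w).
have FA p : normc p < 2 -> exists A, cder F p A.
  move=> /hB /(holomorphic_line hv)[A hA]; eexists; exact: (cderM hA hA).
have [A hA] : exists A, cder F 0 A.
  by apply: FA; rewrite ComplexField.Normc.normc0.
have lt12 : 1 < 2 :> R by rewrite ltr1n.
have [E _] := circint_der ltr01 lt12 FA hA.
have Fint : cintegrable mu circ (fun y => F (1%:C%C * cis y) * conjc (cis y) ^+ 0).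
  apply: circle_integrable => // y; apply: FA.
  by rewrite normc_rcis.
have mI : measurable circ by exact: measurable_itv.
have H : normc (circint F 0 1) <=
    2 * \int[mu]_(y in circ) normc (F (1%:C%C * cis y) * conjc (cis y) ^+ 0).
  exact: (normc_cint mI Fint).
rewrite E normcM normc_real ger0_norm// [F 0]/F scale0r addr0 normcM -expr2 in H.
apply: (@le_trans _ _ (2 * \int[mu]_(y in circ) normc (F (1%:C%C * cis y) * conjc (cis y) ^+ 0))%:E).
  by rewrite lee_fin.
have ni := cintegrable_normc mI Fint.
rewrite EFinM lee_wpmul2l// /Rintegral fineK; last exact: integrable_fin_num.
apply: ge0_le_integral => //.
- by move=> y _; rewrite lee_fin normc_ge0.
- exact: measurable_int ni.
- apply/measurable_EFinP; apply: measurable_funTS.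
  have := measurable_sqr_normc (holomorphic_measurable hv) => m1.
  exact: (measurableT_comp m1 (measurableT_comp (measurable_rotate z) (pair2_measurable w))).
- move=> y _; rewrite lee_fin expr0 mulr1 rmorph1 mul1r cutE.
    by rewrite /F normcM expr2.
  by apply: hB; rewrite normc_cis.
Qed.

(** Averaging [circle_mean] over all small [w]: point evaluations are bounded in
   the L^2 norm, locally uniformly. *)
Lemma local_bound a : B a -> exists r C : R, [/\ 0 < r, 0 <= C,
  forall h, nrm1 h < r -> B (a + h) &
  forall v, holomorphic v -> forall h, nrm1 h < r ->
    ((normc (v (a + h)) ^+ 2)%:E <= C%:E * sqnorm v)%E].
Proof.
move=> Ba; have [r0 r0p hr0] := uball_open Ba.
pose r := r0 / 3; have r_gt0 : 0 < r by rewrite divr_gt0.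
pose D : set V := [set w | nrm1 w < r].
have mD : measurable D by exact: measurable_nrm1_ball.
have Dgt0 : (0 < leb n D)%E by exact: leb_nrm1_ball_gt0.
have Dlty : (leb n D < +oo)%E.
  have [mc cE] := leb_cube n r_gt0.
  apply: (@le_lt_trans _ _ (leb n (cube n r))); last by rewrite [ltLHS]cE ltry.
  apply: le_measure; rewrite ?inE// => w /= hw j; split => /=; rewrite in_itv /= -ltr_norml.
    by apply: le_lt_trans hw; apply: le_trans (le_Re_normc _) (le_coord_nrm1 _ _).
  by apply: le_lt_trans hw; apply: le_trans (le_Im_normc _) (le_coord_nrm1 _ _).
pose mDr := fine (leb n D).
have mDr0 : 0 < mDr by rewrite fine_gt0// Dgt0.
have mDE : leb n D = mDr%:E by rewrite fineK// ge0_fin_numE.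
have pi0 : 0 < pi *+ 2 :> R by rewrite mulrn_wgt0// pi_gt0.
pose vol : R := (volB n)%:num; have vol0 : 0 < vol by exact: volB_gt0.
exists r, (2 * vol / mDr); split => //.
- by rewrite divr_ge0 ?mulr_ge0 ?ltW.
- by move=> h hr; apply: hr0; apply: lt_trans hr _; rewrite /r; lra.
move=> v hv h hr; set z := a + h.
have hB w : D w -> forall c : R[i], normc c < 2 -> B (z + c *: w).
  move=> Dw c c2; rewrite /z -addrA; apply: hr0.
  apply: le_lt_trans (nrm1D _ _) _; rewrite nrm1Z.
  have : normc c * nrm1 w <= 2 * r by rewrite ler_pM ?normc_ge0 ?nrm1_ge0 ?ltW.
  by move: hr; rewrite /r; lra.
pose g w : R := normc (cut v w) ^+ 2.
have mg : measurable_fun setT g by exact: measurable_sqr_normc (holomorphic_measurable hv).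
have g0 w : 0 <= g w by exact: sqr_ge0.
pose k (p : T * V) : \bar R := (\1_circ p.1 * (\1_D p.2 * g (z + cis p.1 *: p.2)))%:E.
have mgr : measurable_fun setT (fun p : T * V => g (z + cis p.1 *: p.2)).
  exact: (measurableT_comp mg (measurable_rotate z)).
have mk : measurable_fun setT k.
  apply/measurable_EFinP; apply: measurable_funM.
    by apply: (measurableT_comp (measurable_indic _) measurable_fst) => //; exact: measurable_itv.
  apply: measurable_funM => //.
  exact: (measurableT_comp (measurable_indic _) measurable_snd).
have ind0 (X : Type) (S : set X) x : 0 <= \1_S x :> R by rewrite indicE ler0n.
have k0 p : (0 <= k p)%E.
  rewrite lee_fin; apply: mulr_ge0; first exact: ind0.
  by apply: mulr_ge0; [exact: ind0|exact: g0].
have mgz : measurable_fun setT (fun w => g (z + w)).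
  have := @measurable_affine_Cn R n 1 z; under eq_fun do rewrite scale1r addrC.
  by move=> m1; exact: (measurableT_comp mg m1).
have S1 : (((pi *+ 2) * normc (v z) ^+ 2)%:E * mDr%:E <=
    2%:E * \int[leb n]_w \int[mu]_y k (y, w))%E.
  rewrite -mDE -integral_cst// -ge0_integralZl//; last 2 first.
  - exact: (measurable_fun_fubini_tonelli_G (m1 := mu) k mk k0).
  - by move=> w _; exact: integral_ge0.
  rewrite integral_mkcond; apply: ge0_le_integral => //.
  - move=> w _; apply: erestrict_ge0 => w' _; rewrite lee_fin mulr_ge0 ?sqr_ge0//.
    exact: ltW.
  - by apply/(measurable_restrictT _ mD); exact: measurable_cst.
  - apply: measurable_funeM; exact: (measurable_fun_fubini_tonelli_G (m1 := mu) k mk k0).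
  move=> w _; rewrite patchE; case: ifPn => [/set_mem Dw|_]; last first.
    by rewrite mule_ge0//; exact: integral_ge0.
  apply: le_trans (circle_mean hv (hB _ Dw)) _; rewrite lee_wpmul2l//.
  rewrite integral_indic_mul le_eqVlt; apply/orP; left; apply/eqP.
  by apply: eq_integral => y _; rewrite /k /= [\1_D w]indicE mem_set// mul1r.
have S2 : (\int[leb n]_w \int[mu]_y k (y, w) <= (pi *+ 2)%:E * (vol%:E * sqnorm v))%E.
  rewrite -(fubini_tonelli (m1 := mu) (m2 := leb n) k mk k0).
  have E y : (\int[leb n]_w k (y, w) <= (\1_circ y)%:E * (vol%:E * sqnorm v))%E.
    rewrite /k /=.
    under eq_integral do rewrite EFinM.
    have my : measurable_fun setT (fun w => (\1_D w * g (z + cis y *: w))%:E).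
      apply/measurable_EFinP; apply: measurable_funM => //.
      exact: (measurableT_comp mgr (pair1_measurable y)).
    rewrite ge0_integralZl//; last first.
      by move=> w _; rewrite lee_fin mulr_ge0 ?ind0 ?g0.
    rewrite lee_wpmul2l ?lee_fin//.
    have cN0 : cis y != 0 by rewrite -normc_eq0 normc_cis oner_neq0.
    have mf : measurable_fun setT (fun w => (\1_D w * g (z + w))%:E).
      by apply/measurable_EFinP; apply: measurable_funM.
    have := @integral_affine_Cn R n (cis y) 0 _ cN0 mf.
    rewrite normc_cis !expr1n mul1e => Ei.
    have -> : (\int[leb n]_w (\1_D w * g (z + cis y *: w))%:E =
        \int[leb n]_w (\1_D w * g (z + w))%:E)%E.
      rewrite Ei; last by move=> w; rewrite lee_fin mulr_ge0 ?ind0 ?g0.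
      apply: eq_integral => w _; rewrite addr0; congr (_ * _)%:E.
      have DD : D (cis y *: w) = D w by rewrite /D /= nrm1Z normc_cis mul1r.
      rewrite !indicE; have [Dw|Dw] := pselect (D w); first by rewrite !mem_set ?DD.
      by rewrite !memNset ?DD.
    apply: (@le_trans _ _ (\int[leb n]_w (g (z + w))%:E)%E).
      apply: ge0_le_integral => //.
      - by move=> w _; rewrite lee_fin mulr_ge0 ?ind0 ?g0.
      - exact/measurable_EFinP.
      - move=> w _; rewrite lee_fin ler_piMl// indicE; by case: (_ \in D).
    have mge : measurable_fun setT (fun w => (g w)%:E) by exact/measurable_EFinP.
    have := @integral_affine_Cn R n 1 z _ (oner_neq0 _) mge.
    rewrite ComplexField.Normc.normc1 !expr1n mul1e => Et.
    under eq_integral do rewrite -[X in g (z + X)]scale1r addrC.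
    rewrite -Et; last by move=> w; rewrite lee_fin.
    have -> : sqnorm v = (\int[nu]_w (g w)%:E)%E.
      apply: ge0_integral_ae; [by move=> w; rewrite lee_fin sqr_ge0|by move=> w; rewrite lee_fin|].
      by apply: ae_ball => w Bw; rewrite /g cutE.
    rewrite (ge0_integral_nu mge)//.
    rewrite muleA -EFinM divff ?mul1e; last exact: lt0r_neq0.
    rewrite [X in (_ <= X)%E]integral_mkcond le_eqVlt; apply/orP; left; apply/eqP.
    apply: eq_integral => w _; rewrite patchE; case: ifPn => // /negP nB.
    rewrite /g /cut; case: ifPn => [Bw|_]; first by exfalso; apply: nB; exact/mem_set.
    by rewrite ComplexField.Normc.normc0 expr0n.
  apply: (@le_trans _ _ (\int[mu]_y ((\1_circ y)%:E * (vol%:E * sqnorm v)))%E).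
    apply: ge0_le_integral => //.
    - by move=> y _; exact: integral_ge0.
    - exact: (measurable_fun_fubini_tonelli_F (m2 := leb n) k mk).
    - apply: emeasurable_funM => //; apply/measurable_EFinP; apply: measurable_indic.
      exact: measurable_itv.
  rewrite ge0_integralZr//; last 2 first.
  - by apply/measurable_EFinP; apply: measurable_indic; exact: measurable_itv.
  - by rewrite mule_ge0 ?sqnorm_ge0// lee_fin ltW.
  rewrite lee_wpmul2r//; first by rewrite mule_ge0 ?sqnorm_ge0// lee_fin ltW.
  have mI : measurable circ by exact: measurable_itv.
  rewrite (integral_indic _ measurableT mI) setIT.
  rewrite le_eqVlt; apply/orP; left; apply/eqP.
  by have := lebesgue_segment (ltW pi0); rewrite subr0.
have E2 : (0 <= 2%:E :> \bar R)%E by rewrite lee_fin.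
have := le_trans S1 (lee_wpmul2l E2 S2).
case: (sqnorm v) (sqnorm_ge0 v) => [s s0||]; last 2 first.
- by move=> _ _; rewrite gt0_muley ?leey// lte_fin divr_gt0// mulr_gt0.
- by [].
rewrite -!EFinM !lee_fin => H.
rewrite mulrAC ler_pdivlMr//.
rewrite -(ler_pM2l pi0) mulrA; apply: le_trans H _.
by rewrite le_eqVlt; apply/orP; left; apply/eqP; ring.
Qed.

End local_bound.

Section cauchy_estimates.
Context {R : realType}.

Lemma cder_is_derive (p : R[i] -> R) (G : R[i] -> R[i]) (s : R) A :
  (forall x y, p (x - y) = p x - p y) -> (forall x, `|p x| <= normc x) ->
  (forall (r : R) x, p (x * r%:C%C) = p x * r) ->
  cder G s%:C%C A -> is_derive s 1 (fun t : R => p (G t%:C%C)) (p A).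
Proof.
move=> pB pn pM dG.
have H : h^-1 *: (p (G (h *: 1 + s)%:C%C) - p (G s%:C%C)) @[h --> (0:R)^'] --> p A.
  apply/cvgrPdist_le => e e0; have [d d0 hd] := dG _ e0.
  rewrite /dnbhs near_withinE; apply/nbhs_normP; exists d => //= h.
  rewrite /ball_ /= sub0r normrN => hlt h0.
  have := hd h%:C%C; rewrite normc_real => /(_ hlt) H.
  have E : p A - h^-1 * (p (G (h + s)%:C%C) - p (G s%:C%C)) =
     - h^-1 * p (G (s%:C%C + h%:C%C) - G s%:C%C - A * h%:C%C).
    rewrite !pB pM rmorphD /= [h%:C%C + _]addrC; field; exact: h0.
  have -> : h *: (1 : R) = h by exact: mulr1.
  rewrite [_ *: _]/(_ * _) E normrM normrN normfV.
  by rewrite ler_pdivrMl ?normr_gt0//; apply: le_trans (pn _) _; rewrite [leRHS]mulrC.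
by split; [apply/cvg_ex; exists (p A)|apply/cvg_lim].
Qed.

(** Mean value inequality along the segment [0, 1]. *)
Lemma cder_mvt (G : R[i] -> R[i]) (K : R) :
  (forall s : R, 0 <= s <= 1 -> exists2 A, cder G s%:C%C A & normc A <= K) ->
  normc (G 1 - G 0) <= 2 * K.
Proof.
move=> hG.
have main (p : R[i] -> R) : (forall x y, p (x - y) = p x - p y) ->
    (forall x, `|p x| <= normc x) ->
    (forall (r : R) x, p (x * r%:C%C) = p x * r) -> `|p (G 1) - p (G 0)| <= K.
  move=> pB pn pM.
  have ex (s : R) : exists A, 0 <= s <= 1 -> cder G s%:C%C A /\ normc A <= K.
    by have [/hG[A ? ?]|ns] := pselect (0 <= s <= 1); [exists A|exists 0].
  have [A hA] := choice ex.
  have D (s : R) : 0 <= s <= 1 -> is_derive s 1 (fun t : R => p (G t%:C%C)) (p (A s)).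
    by move=> /hA[dG _]; exact: (cder_is_derive pB pn pM dG).
  have [||c cI] := @MVT_segment R (fun t : R => p (G t%:C%C)) (fun s => p (A s)) 0 1 ler01.
  - by move=> x; rewrite in_itv /= => /andP[x0 x1]; apply: D; rewrite !ltW.
  - apply: continuous_in_subspaceT => x; rewrite inE /= in_itv /= => /D[dx _].
    by apply: differentiable_continuous; exact/derivable1_diffP.
  rewrite subr0 mulr1 => ->; apply: le_trans (pn _) _.
  by have [] := hA c; [move: cI; rewrite in_itv|].
have H1 := main (@complex.Re R); have H2 := main (@complex.Im R).
apply: le_trans (normc_leD _) _; rewrite RecD RecN ImcD ImcN mulr2n mulrDl mul1r.
apply: lerD; [apply: H1|apply: H2].
- by move=> x y; rewrite RecD RecN.
- exact: le_Re_normc.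
- by move=> r x; rewrite RecM /= mulr0 subr0.
- by move=> x y; rewrite ImcD ImcN.
- exact: le_Im_normc.
- by move=> r x; rewrite ImcM /= mulr0 add0r.
Qed.

End cauchy_estimates.

Section cauchy_estimates_Cn.
Context {R : realType} {n : nat}.
Local Notation V := 'rV[R[i]]_n.
Implicit Types (a b c h z : V) (v : V -> R[i]) (l : 'I_n -> R[i]).

Definition hdiff_ball v a (r : R) := forall h, nrm1 h < r -> exists l, hdiff v (a + h) l.

Lemma lformZ l (t : R[i]) b : lform l (t *: b) = t * lform l b.
Proof. by rewrite /lform mulr_sumr; apply: eq_bigr => j _; rewrite mxE mulrA. Qed.

Lemma hdiff_shift v a c l : hdiff v (a + c) l -> hdiff (fun z => v (z + c)) a l.
Proof.
move=> hv e e0; have [d d0 hd] := hv _ e0; exists d => // h /hd.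
by rewrite (addrAC a h c).
Qed.

Lemma hdiffB v w a l l' : hdiff v a l -> hdiff w a l' ->
  hdiff (fun z => v z - w z) a (fun j => l j - l' j).
Proof.
move=> hv hw e e0; have e2 : 0 < e / 2 by rewrite divr_gt0.
have [d1 d10 h1] := hv _ e2; have [d2 d20 h2] := hw _ e2.
exists (Num.min d1 d2); first by rewrite lt_min d10.
move=> h; rewrite lt_min => /andP[/h1 H1 /h2 H2].
have -> : lform (fun j => l j - l' j) h = lform l h - lform l' h.
  by rewrite /lform -sumrB; apply: eq_bigr => j _; rewrite mulrBr.
have -> : v (a + h) - w (a + h) - (v a - w a) - (lform l h - lform l' h) =
  (v (a + h) - v a - lform l h) - (w (a + h) - w a - lform l' h) by ring.
apply: le_trans (normcB _ _) _; apply: le_trans (lerD H1 H2) _.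
by rewrite -mulrDl -splitr.
Qed.

(** Cauchy's estimate for the first derivative. *)
Lemma cauchy_derivative v a (r M : R) c b l : hdiff_ball v a r ->
  (forall h, nrm1 h < r -> normc (v (a + h)) <= M) ->
  nrm1 c < r / 2 -> nrm1 b <= r / 4 -> hdiff v (a + c) l ->
  normc (lform l b) <= 2 * M.
Proof.
move=> hv vM cr br hl; have pi0 : 0 < pi *+ 2 :> R by rewrite mulrn_wgt0// pi_gt0.
have inside (x : R[i]) : normc x < 2 -> nrm1 (c + x *: b) < r.
  move=> x2; apply: le_lt_trans (nrm1D _ _) _; rewrite nrm1Z.
  have : normc x * nrm1 b <= 2 * (r / 4) by apply: ler_pM; rewrite ?normc_ge0 ?nrm1_ge0// ltW.
  by lra.
pose F (x : R[i]) := v (a + c + x *: b).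
have FA x : normc x < 2 -> exists A, cder F x A.
  move=> /inside /hv; rewrite addrA => -[l' hl']; exists (lform l' b).
  exact: hdiff_line.
have F0 : cder F 0 (lform l b) by apply: hdiff_line; rewrite scale0r addr0.
have lt12 : 1 < 2 :> R by rewrite ltr1n.
have [_ E] := circint_der ltr01 lt12 FA F0.
have Fint : cintegrable lebesgue_measure `[0, pi *+ 2]
    (fun y => F (1%:C%C * cis y) * conjc (cis y) ^+ 1).
  by apply: circle_integrable => // y; apply: FA; rewrite normc_rcis.
have := normc_segint (K := M) (ltW pi0) Fint; rewrite -/(circint F 1 1) subr0 => H.
have {H} : normc (circint F 1 1) <= 2 * (pi *+ 2) * M.
  apply: H => y _; rewrite expr1 normcM normc_conj normc_cis mulr1 /F -addrA.
  by apply: vM; apply: inside; rewrite normc_rcis.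
rewrite E normcM normc_real (ger0_norm (ltW pi0)) rmorph1 mul1r.
have -> : 2 * (pi *+ 2) * M = pi *+ 2 * (2 * M) by ring.
by rewrite ler_pM2l.
Qed.

Lemma cauchy_increment v a (r M : R) c b (t : R) : hdiff_ball v a r ->
  (forall h, nrm1 h < r -> normc (v (a + h)) <= M) ->
  nrm1 c < r / 4 -> nrm1 b <= r / 4 -> 0 <= t <= 1 ->
  normc (v (a + c + t%:C%C *: b) - v (a + c)) <= 4 * M * t.
Proof.
move=> hv vM cr br /andP[t0 t1].
pose G (x : R[i]) := v (a + c + x *: (t%:C%C *: b)).
have := @cder_mvt R G (2 * M * t); rewrite /G scale1r scale0r addr0.
have -> : 2 * (2 * M * t) = 4 * M * t by ring.
apply => s /andP[s0 s1].
have st : nrm1 (c + (s * t)%:C%C *: b) < r / 2.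
  apply: le_lt_trans (nrm1D _ _) _; rewrite nrm1Z normc_real ger0_norm ?mulr_ge0//.
  have : s * t * nrm1 b <= nrm1 b by rewrite ler_piMl ?nrm1_ge0 ?mulr_ile1.
  by lra.
have r0 : 0 < r by have := nrm1_ge0 c; lra.
have str : nrm1 (c + (s * t)%:C%C *: b) < r by lra.
have [l hl] := hv _ str.
exists (lform l (t%:C%C *: b)).
  by apply: hdiff_line; rewrite scalerA -rmorphM /= -addrA.
rewrite lformZ normcM normc_real ger0_norm// mulrC ler_wpM2r//.
exact: (cauchy_derivative hv vM st br hl).
Qed.

(** Second-order Taylor remainder, with a constant depending only on the radius
   and on the sup norm. *)
Lemma cauchy_remainder v a (r M : R) l b (t : R) : hdiff_ball v a r ->
  (forall h, nrm1 h < r -> normc (v (a + h)) <= M) -> hdiff v a l ->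
  0 < r -> nrm1 b <= r / 32 -> 0 <= t <= 1 ->
  normc (v (a + t%:C%C *: b) - v a - t%:C%C * lform l b) <= 16 * M * t ^+ 2.
Proof.
move=> hv vM hl r0 br /andP[t0 t1].
have dl (s : R) : 0 <= s <= 1 -> forall l', hdiff v (a + (s * t)%:C%C *: b) l' ->
    normc (lform (fun j => l' j - l j) b) <= 8 * M * t.
  move=> /andP[s0 s1] l' hl'; set c := (s * t)%:C%C *: b.
  have st1 : s * t <= 1 by rewrite mulr_ile1.
  have st0 : 0 <= s * t by rewrite mulr_ge0.
  have cr : nrm1 c <= r / 32.
    rewrite nrm1Z normc_real ger0_norm//; apply: le_trans br.
    by rewrite ler_piMl ?nrm1_ge0.
  pose u z := v (z + c) - v z.
  have hu : hdiff_ball u a (r / 8).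
    move=> h hr.
    have h1 : nrm1 (h + c) < r by apply: le_lt_trans (nrm1D _ _) _; lra.
    have h2 : nrm1 h < r by lra.
    have [l1 hl1] := hv _ h1; have [l2 hl2] := hv _ h2.
    exists (fun j => l1 j - l2 j); apply: hdiffB => //.
    by apply: hdiff_shift; rewrite -addrA.
  have uM h : nrm1 h < r / 8 -> normc (u (a + h)) <= 4 * M * t.
    move=> hr; have h4 : nrm1 h < r / 4 by lra.
    have b4 : nrm1 b <= r / 4 by lra.
    have M0 : 0 <= M by apply: le_trans (vM 0 _); rewrite ?normc_ge0// nrm1_0.
    have st01 : 0 <= s * t <= 1 by rewrite st0.
    apply: le_trans (cauchy_increment hv vM h4 b4 st01) _.
    by rewrite ler_wpM2l ?mulr_ge0// ler_piMl.
  have z2 : nrm1 (0 : V) < r / 8 / 2 by rewrite nrm1_0 !divr_gt0.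
  have b32 : nrm1 b <= r / 8 / 4 by lra.
  have -> : 8 * M * t = 2 * (4 * M * t) by ring.
  apply: (cauchy_derivative hu uM z2 b32); rewrite addr0.
  by apply: hdiffB => //; exact: hdiff_shift.
pose G (x : R[i]) := v (a + x *: (t%:C%C *: b)) - x * (t%:C%C * lform l b).
have := @cder_mvt R G (8 * M * t ^+ 2).
rewrite /G scale1r scale0r addr0 mul1r mul0r subr0.
have -> : 2 * (8 * M * t ^+ 2) = 16 * M * t ^+ 2 by ring.
have -> : v (a + t%:C%C *: b) - t%:C%C * lform l b - v a =
  v (a + t%:C%C *: b) - v a - t%:C%C * lform l b by ring.
apply => s s01; have /andP[s0 s1] := s01.
have st1 : s * t <= 1 by rewrite mulr_ile1.
have st0 : 0 <= s * t by rewrite mulr_ge0.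
have str : nrm1 ((s * t)%:C%C *: b) < r.
  rewrite nrm1Z normc_real ger0_norm//.
  have : s * t * nrm1 b <= nrm1 b by rewrite ler_piMl ?nrm1_ge0.
  by lra.
have [l' hl'] := hv _ str.
exists (lform l' (t%:C%C *: b) - t%:C%C * lform l b).
  have D1 : cder (fun x => v (a + x *: (t%:C%C *: b))) s%:C%C (lform l' (t%:C%C *: b)).
    by apply: hdiff_line; rewrite scalerA -rmorphM.
  move=> e e0; have [d d0 hd] := D1 _ e0; exists d => // h /hd.
  set k := t%:C%C * lform l b.
  have -> // : v (a + (s%:C%C + h) *: (t%:C%C *: b)) - (s%:C%C + h) * k -
    (v (a + s%:C%C *: (t%:C%C *: b)) - s%:C%C * k) - (lform l' (t%:C%C *: b) - k) * h =
    v (a + (s%:C%C + h) *: (t%:C%C *: b)) - v (a + s%:C%C *: (t%:C%C *: b)) -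
    lform l' (t%:C%C *: b) * h by ring.
have -> : lform l' (t%:C%C *: b) - t%:C%C * lform l b =
    t%:C%C * lform (fun j => l' j - l j) b.
  rewrite lformZ -mulrBr; congr (_ * _).
  by rewrite /lform -sumrB; apply: eq_bigr => j _; rewrite mulrBr.
rewrite normcM normc_real ger0_norm//.
apply: le_trans (ler_wpM2l t0 (dl s s01 _ hl')) _.
by rewrite le_eqVlt; apply/orP; left; apply/eqP; ring.
Qed.

End cauchy_estimates_Cn.

Section limits.
Context {R : realType} {n : nat}.
Local Notation V := 'rV[R[i]]_n.
Local Notation B := (@uball R n).
Implicit Types (a b c h z : V) (v : V -> R[i]).

Definition cconv (w : nat -> R[i]) (x : R[i]) := forall e : R, 0 < e ->
  exists N, forall k, (N <= k)%N -> normc (w k - x) <= e.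

Lemma ccauchy_conv (w : nat -> R[i]) :
  (forall e : R, 0 < e -> exists N, forall k m, (N <= k)%N -> (N <= m)%N ->
    normc (w k - w m) <= e) -> exists x, cconv w x.
Proof.
move=> wc.
have main (p : R[i] -> R) : (forall x y, p (x - y) = p x - p y) ->
    (forall x, `|p x| <= normc x) -> exists x : R, forall e : R, 0 < e ->
      exists N, forall k, (N <= k)%N -> `|p (w k) - x| <= e.
  move=> pB pn; have : cvg ((fun k => p (w k)) @ \oo).
    apply/cauchy_cvgP/cauchyP => e e0; have e2 : 0 < e / 2 by rewrite divr_gt0.
    have [N hN] := wc _ e2; exists (p (w N)); exists N => // k /= Nk.
    rewrite /ball /= -pB; apply: le_lt_trans (pn _) _.
    by apply: le_lt_trans (hN _ _ (leqnn N) Nk) _; lra.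
  move=> cv; exists (lim ((fun k => p (w k)) @ \oo)) => e e0.
  have /cvgrPdist_le /(_ _ e0)[N _ hN] := cv.
  by exists N => k Nk; rewrite distrC; exact: hN.
have [|x hx] := main (@complex.Re R) _ (@le_Re_normc R).
  by move=> x y; rewrite RecD RecN.
have [|y hy] := main (@complex.Im R) _ (@le_Im_normc R).
  by move=> x' y; rewrite ImcD ImcN.
exists (Complex x y) => e e0; have e2 : 0 < e / 2 by rewrite divr_gt0.
have [N1 h1] := hx _ e2; have [N2 h2] := hy _ e2.
exists (maxn N1 N2) => k; rewrite geq_max => /andP[/h1 H1 /h2 H2].
apply: le_trans (normc_leD _) _; rewrite RecD RecN ImcD ImcN /=.
by rewrite [leRHS](splitr e); exact: lerD.
Qed.

Lemma cconv_le (w : nat -> R[i]) x (K : R) : cconv w x ->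
  (forall k, normc (w k) <= K) -> normc x <= K.
Proof.
move=> wx wK; apply/ler_addgt0Pr => e e0; have [N hN] := wx _ e0.
have -> : x = w N - (w N - x) by ring.
by apply: le_trans (normcB _ _) _; apply: lerD => //; exact: hN.
Qed.

Lemma cconvB w w' x x' : cconv w x -> cconv w' x' ->
  cconv (fun k => w k - w' k) (x - x').
Proof.
move=> wx wx' e e0; have e2 : 0 < e / 2 by rewrite divr_gt0.
have [N1 h1] := wx _ e2; have [N2 h2] := wx' _ e2.
exists (maxn N1 N2) => k; rewrite geq_max => /andP[/h1 H1 /h2 H2].
have -> : w k - w' k - (x - x') = (w k - x) - (w' k - x') by ring.
by apply: le_trans (normcB _ _) _; rewrite [leRHS](splitr e); exact: lerD.
Qed.

Lemma cconvZ (c : R[i]) w x : cconv w x -> cconv (fun k => c * w k) (c * x).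
Proof.
move=> wx e e0; have N1 : 0 < normc c + 1 by rewrite ltr_wpDl// normc_ge0.
have [N hN] := wx _ (divr_gt0 e0 N1); exists N => k /hN H.
rewrite -mulrBr normcM; apply: le_trans (ler_wpM2l (normc_ge0 c) H) _.
rewrite mulrCA; apply: ler_piMr; first exact: ltW.
by rewrite ler_pdivrMr// mul1r lerDl.
Qed.

Lemma cconv_lform (l : nat -> 'I_n -> R[i]) (l' : 'I_n -> R[i]) b :
  (forall j, cconv (fun k => l k j) (l' j)) -> cconv (fun k => lform (l k) b) (lform l' b).
Proof.
move=> hl e e0; have N1 : 0 < nrm1 b + 1 by rewrite ltr_wpDl// nrm1_ge0.
have e1 := divr_gt0 e0 N1.
have [N hN] : exists N, forall j k, (N <= k)%N -> normc (l k j - l' j) <= e / (nrm1 b + 1).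
  have [N hN] := choice (fun j => hl j _ e1); exists (\max_j N j)%N => j k Nk.
  by apply: hN; apply: leq_trans Nk; exact: leq_bigmax.
exists N => k Nk.
have -> : lform (l k) b - lform l' b = lform (fun j => l k j - l' j) b.
  by rewrite /lform -sumrB; apply: eq_bigr => j _; rewrite mulrBr.
apply: le_trans (normc_lform b (fun j => hN j k Nk)) _.
rewrite -mulrA; apply: ler_piMr; first exact: ltW.
by rewrite mulrC ler_pdivrMr// mul1r lerDl.
Qed.

(** Weierstrass: the Cauchy estimates make difference quotients converge
   uniformly, so a locally bounded limit of holomorphic functions, Cauchy
   locally uniformly, is holomorphic. *)
Lemma hdiff_limit (v : nat -> V -> R[i]) (u : V -> R[i]) a (r M : R) :
  0 < r -> (forall k, hdiff_ball (v k) a r) ->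
  (forall k h, nrm1 h < r -> normc (v k (a + h)) <= M) ->
  (forall e : R, 0 < e -> exists N, forall k m, (N <= k)%N -> (N <= m)%N ->
     forall h, nrm1 h < r -> normc (v k (a + h) - v m (a + h)) <= e) ->
  (forall h, nrm1 h < r -> cconv (fun k => v k (a + h)) (u (a + h))) ->
  exists l, hdiff u a l.
Proof.
move=> r0 hv vM vc vu.
have z0 : nrm1 (0 : V) < r by rewrite nrm1_0.
have ex k : exists l, hdiff (v k) a l by have := hv k _ z0; rewrite addr0.
have [l hl] := choice ex.
have exl j : exists x, cconv (fun k => l k j) x.
  apply: ccauchy_conv => e e0.
  have e1 : 0 < e * (r / 4) / 2 by rewrite divr_gt0// mulr_gt0// divr_gt0.
  have [N hN] := vc _ e1; exists N => k m Nk Nm.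
  pose b : V := (r / 4)%:C%C *: delta_mx 0 j.
  have r4 : 0 < r / 4 by rewrite divr_gt0.
  have nb : nrm1 b <= r / 4.
    have d1 : (delta_mx 0 j : V) 0 j = 1 by rewrite mxE !eqxx.
    rewrite nrm1Z normc_real (ger0_norm (ltW r4)) /nrm1 (bigD1 j)//= d1.
    rewrite big1 => [|i ij]; last first.
      by rewrite mxE (negbTE ij) ComplexField.Normc.normc0.
    by rewrite addr0 ComplexField.Normc.normc1 mulr1.
  have hd : hdiff_ball (fun z => v k z - v m z) a r.
    move=> h hr; have [l1 h1] := hv k _ hr; have [l2 h2] := hv m _ hr.
    by eexists; exact: hdiffB h1 h2.
  have r2 : nrm1 (0 : V) < r / 2 by rewrite nrm1_0 divr_gt0.
  have hkm : hdiff (fun z => v k z - v m z) (a + 0) (fun j => l k j - l m j).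
    by rewrite addr0; exact: hdiffB.
  have := cauchy_derivative hd (hN k m Nk Nm) r2 nb hkm.
  rewrite lformZ normcM normc_real (ger0_norm (ltW r4)).
  have -> : lform (fun j => l k j - l m j) (delta_mx 0 j) = l k j - l m j.
    rewrite /lform (bigD1 j)//= mxE !eqxx mul1r big1 ?addr0// => i ij.
    by rewrite mxE (negbTE ij) mul0r.
  have -> : 2 * (e * (r / 4) / 2) = r / 4 * e by field.
  by rewrite ler_pM2l.
have [l' hl'] := choice exl.
exists l' => e e0.
have M0 : 0 <= M by apply: le_trans (vM 0%N 0 z0); exact: normc_ge0.
pose s := r / 32; have s0 : 0 < s by rewrite divr_gt0.
have rem b (t : R) : nrm1 b <= s -> 0 <= t <= 1 ->
    normc (u (a + t%:C%C *: b) - u a - t%:C%C * lform l' b) <= 16 * M * t ^+ 2.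
  move=> bs t01; have /andP[t0 t1] := t01.
  apply: (cconv_le (w := fun k => v k (a + t%:C%C *: b) - v k a - t%:C%C * lform (l k) b)).
    apply: cconvB; last by apply: cconvZ; exact: cconv_lform.
    apply: cconvB; last by have := vu _ z0; rewrite addr0.
    apply: vu; rewrite nrm1Z normc_real ger0_norm//.
    have : t * nrm1 b <= nrm1 b by rewrite ler_piMl ?nrm1_ge0.
    by rewrite /s in bs; lra.
  by move=> k; exact: (cauchy_remainder (hv k) (vM k) (hl k)).
pose K := 16 * M / s ^+ 2.
have K0 : 0 <= K.
  by apply: divr_ge0; [exact: mulr_ge0|exact: sqr_ge0].
exists (Num.min s (e / (K + 1))).
  by rewrite lt_min s0 divr_gt0// ltr_wpDl.
move=> h; rewrite lt_min => /andP[hs he].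
have [h0|hn0] := eqVneq (nrm1 h) 0.
  have -> : h = 0.
    apply/rowP => j; rewrite mxE; apply/eqP; rewrite -normc_eq0 eq_le normc_ge0 andbT.
    by rewrite -h0 le_coord_nrm1.
  rewrite addr0 subrr sub0r normcN.
  have -> : lform l' 0 = 0 by apply: big1 => j _; rewrite mxE mul0r.
  by rewrite ComplexField.Normc.normc0 mulr_ge0 ?nrm1_ge0// ltW.
have h0 : 0 < nrm1 h by rewrite lt_neqAle eq_sym hn0 nrm1_ge0.
pose t := nrm1 h / s; pose b := (t^-1)%:C%C *: h.
have t0 : 0 < t by rewrite divr_gt0.
have t01 : 0 <= t <= 1.
  by apply/andP; split; [exact: ltW|rewrite ler_pdivrMr// mul1r; exact: ltW].
have tb : t%:C%C *: b = h.
  by rewrite /b scalerA -rmorphM divff ?gt_eqF//= scale1r.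
have bs : nrm1 b <= s.
  have ti : 0 < t^-1 by rewrite invr_gt0.
  by rewrite nrm1Z normc_real (ger0_norm (ltW ti)) /t invf_div divfK.
have := rem b t bs t01; rewrite -lformZ tb => H; apply: le_trans H _.
have -> : 16 * M * t ^+ 2 = K * nrm1 h * nrm1 h.
  by rewrite /K /t; field; rewrite gt_eqF.
rewrite ler_wpM2r ?nrm1_ge0//.
apply: (@le_trans _ _ ((K + 1) * nrm1 h)); first by rewrite ler_wpM2r ?nrm1_ge0// lerDl.
have K1 : 0 < K + 1 by rewrite ltr_wpDl.
by rewrite mulrC -ler_pdivlMr// ltW.
Qed.

End limits.

(** * The Bergman projection *)

Section fatou_bound.
Context d (T : measurableType d) (R : realType) (mu : {measure set T -> \bar R}).

(** Fatou's lemma in the form needed for the lower semicontinuity of a distance. *)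
Lemma fatou_le (f_ : nat -> T -> R) (f : T -> R) (c : R) :
  (forall k, measurable_fun setT (f_ k)) -> (forall k x, 0 <= f_ k x) ->
  (forall x, f_ ^~ x @ \oo --> f x) ->
  (forall e : R, 0 < e -> exists N, forall k, (N <= k)%N ->
    (\int[mu]_x (f_ k x)%:E <= (c + e)%:E)%E) ->
  (\int[mu]_x (f x)%:E <= c%:E)%E.
Proof.
move=> mf f0 ff hc; apply/lee_addgt0Pr => e e0; have [N hN] := hc _ e0.
pose g k x := (f_ (k + N)%N x)%:E.
have mg k : measurable_fun setT (g k) by exact/measurable_EFinP.
have g0 k x : setT x -> (0 <= g k x)%E by rewrite lee_fin.
have gf x : limn_einf (g ^~ x) = (f x)%:E.
  have cv : (g ^~ x) @ \oo --> (f x)%:E.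
    apply/fine_cvgP; split; first exact: nearW.
    rewrite (_ : fine \o _ = (fun k => f_ (k + N)%N x))//.
    have := ff x; rewrite -(cvg_shiftn N); exact.
  by rewrite is_cvg_limn_einfE; [exact/cvg_lim|apply/cvg_ex; exists (f x)%:E].
have := fatou mu measurableT mg g0; under eq_integral do rewrite gf.
move=> H; apply: le_trans H _; rewrite limn_einf_lim; apply: lime_le.
  exact: is_cvg_einfs.
apply: nearW => k; apply: (@le_trans _ _ (\int[mu]_x g k x)%E).
  by apply: ereal_inf_lbound; exists k => /=.
by rewrite -EFinD; apply: hN; rewrite leq_addl.
Qed.

End fatou_bound.

Section square_integrable.
Context d (T : measurableType d) (R : realType) (mu : {measure set T -> \bar R}).
Implicit Types (f g h : T -> R[i]) (c : R[i]).

Definition sqint f : \bar R := (\int[mu]_z (normc (f z) ^+ 2)%:E)%E.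
Definition sqn f : R := fine (sqint f).
Definition borelL2 f := cmeasurable setT f /\ (sqint f < +oo)%E.
Definition ip f g : R[i] := cint mu setT (fun z => f z * conjc (g z)).

Lemma sqint_ge0 f : (0 <= sqint f)%E.
Proof. by apply: integral_ge0 => z _; rewrite lee_fin sqr_ge0. Qed.

Lemma sqn_ge0 f : 0 <= sqn f.
Proof. by rewrite fine_ge0// sqint_ge0. Qed.

Lemma sqintE f : borelL2 f -> sqint f = (sqn f)%:E.
Proof. by move=> [_ foo]; rewrite fineK// ge0_fin_numE// sqint_ge0. Qed.

Lemma sqint_integrable f : borelL2 f ->
  mu.-integrable setT (fun z => (normc (f z) ^+ 2)%:E).
Proof.
move=> [mf foo]; apply/integrableP; split.
  by apply/measurable_EFinP; exact: measurable_sqr_normc.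
by under eq_integral do rewrite gee0_abs ?lee_fin ?sqr_ge0//.
Qed.

Lemma sqn_Rintegral f : sqn f = \int[mu]_z normc (f z) ^+ 2.
Proof. by []. Qed.

Lemma borelL2_le f g h : cmeasurable setT f -> borelL2 g -> borelL2 h ->
  (forall z, normc (f z) ^+ 2 <= 2 * normc (g z) ^+ 2 + 2 * normc (h z) ^+ 2) ->
  borelL2 f /\ sqn f <= 2 * sqn g + 2 * sqn h.
Proof.
move=> mf gL hL fgh.
have gi := sqint_integrable gL; have hi := sqint_integrable hL.
have Z2 k : mu.-integrable setT (fun z => (normc (k z) ^+ 2)%:E) ->
    mu.-integrable setT (fun z => (2 * normc (k z) ^+ 2)%:E).
  by move=> ki; apply: eq_integrable (integrableZl measurableT 2 ki) => // z _; rewrite EFinM.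
have E2 k : borelL2 k -> (\int[mu]_z (2 * normc (k z) ^+ 2)%:E = (2 * sqn k)%:E)%E.
  move=> kL; have ki := sqint_integrable kL.
  transitivity (2%:E * sqint k)%E; last by rewrite EFinM sqintE.
  by rewrite -integralZl//; apply: eq_integral => z _; rewrite EFinM.
have I : (sqint f <= (2 * sqn g + 2 * sqn h)%:E)%E.
  apply: (@le_trans _ _ (\int[mu]_z ((2 * normc (g z) ^+ 2)%:E + (2 * normc (h z) ^+ 2)%:E))%E).
    apply: ge0_le_integral => //.
    - by move=> z _; rewrite lee_fin sqr_ge0.
    - by apply/measurable_EFinP; exact: measurable_sqr_normc.
    - by apply: emeasurable_funD; [exact: measurable_int (Z2 _ gi)|exact: measurable_int (Z2 _ hi)].
    - by move=> z _; rewrite -EFinD lee_fin.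
  by rewrite integralD ?Z2// !E2// -EFinD.
split; first by split => //; apply: le_lt_trans I _; rewrite ltry.
by rewrite -lee_fin -sqintE//; split => //; apply: le_lt_trans I _; rewrite ltry.
Qed.

Lemma sqr_normcD_le (x y : R[i]) : normc (x + y) ^+ 2 <= 2 * normc x ^+ 2 + 2 * normc y ^+ 2.
Proof.
rewrite !sqr_normcE RecD ImcD.
have := sqr_ge0 (Re x - Re y); have := sqr_ge0 (Im x - Im y); nra.
Qed.

Lemma borelL2D f g : borelL2 f -> borelL2 g -> borelL2 (fun z => f z + g z).
Proof.
move=> fL gL; have mfg := cmeasurableD fL.1 gL.1.
by have [] := borelL2_le mfg fL gL (fun z => sqr_normcD_le _ _).
Qed.

Lemma sqintZ c f : cmeasurable setT f ->
  sqint (fun z => c * f z) = ((normc c ^+ 2)%:E * sqint f)%E.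
Proof.
move=> mf; rewrite -ge0_integralZl//; last 3 first.
- by apply/measurable_EFinP; exact: measurable_sqr_normc.
- by move=> z _; rewrite lee_fin sqr_ge0.
- by rewrite lee_fin sqr_ge0.
by apply: eq_integral => z _; rewrite normcM exprMn EFinM.
Qed.

Lemma borelL2Z c f : borelL2 f -> borelL2 (fun z => c * f z).
Proof.
move=> fL; split; first exact: (cmeasurableM (cmeasurable_cst _ c) fL.1).
by rewrite (sqintZ c fL.1) sqintE// -EFinM ltry.
Qed.

Lemma sqnZ c f : borelL2 f -> sqn (fun z => c * f z) = normc c ^+ 2 * sqn f.
Proof. by move=> fL; rewrite /sqn (sqintZ c fL.1) (sqintE fL) -EFinM. Qed.

Lemma borelL2B f g : borelL2 f -> borelL2 g -> borelL2 (fun z => f z - g z).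
Proof.
move=> fL gL; have := borelL2D fL (borelL2Z (-1) gL).
by under [X in borelL2 X]eq_fun do rewrite mulN1r.
Qed.

Lemma ip_integrable f g : borelL2 f -> borelL2 g ->
  cintegrable mu setT (fun z => f z * conjc (g z)).
Proof.
move=> fL gL.
apply: (@le_cintegrable _ _ _ mu _ measurableT _ (fun z => normc (f z) ^+ 2 + normc (g z) ^+ 2)).
- exact: (cmeasurableM fL.1 (cmeasurable_conj gL.1)).
- move=> z _; rewrite normcM normc_conj.
  have := normc_ge0 (f z); have := normc_ge0 (g z).
  have := sqr_ge0 (normc (f z) - normc (g z)); nra.
- apply: eq_integrable (integrableD measurableT (sqint_integrable fL) (sqint_integrable gL)) => //.
Qed.

Lemma sqn_expand c f g : borelL2 f -> borelL2 g ->
  sqn (fun z => f z - c * g z) =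
  sqn f - 2 * Re (conjc c * ip f g) + normc c ^+ 2 * sqn g.
Proof.
move=> fL gL; have cgL := borelL2Z c gL.
have ii := ip_integrable fL gL; have [i1 _] := cintegrableZ measurableT (conjc c) ii.
have fi := sqint_integrable fL; have gi := sqint_integrable cgL.
have -> : Re (conjc c * ip f g) = \int[mu]_z Re (conjc c * (f z * conjc (g z))).
  by rewrite /ip -cintZ.
rewrite -(sqnZ c gL) !sqn_Rintegral.
have i2 : mu.-integrable setT (EFin \o (fun z => 2 * Re (conjc c * (f z * conjc (g z))))).
  by apply: eq_integrable (integrableZl measurableT 2 i1) => // z _.
have i3 : mu.-integrable setT (EFin \o (fun z => normc (f z) ^+ 2 -
    2 * Re (conjc c * (f z * conjc (g z))))).
  by apply: eq_integrable (integrableB measurableT fi i2) => // z _.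
rewrite -RintegralZl// -RintegralB// -RintegralD//.
apply: eq_Rintegral => z _; rewrite !sqr_normcE.
rewrite !(RecD, RecN, RecM, ImcD, ImcN, ImcM, Rec_conj, Imc_conj); ring.
Qed.

Lemma parallelogram f g : borelL2 f -> borelL2 g ->
  sqn (fun z => f z + g z) + sqn (fun z => f z - g z) = 2 * sqn f + 2 * sqn g.
Proof.
move=> fL gL; have := sqn_expand 1 fL gL; have := sqn_expand (-1) fL gL.
under [X in sqn X = _ -> _]eq_fun do rewrite mulN1r opprK.
under [X in _ -> sqn X = _ -> _]eq_fun do rewrite mul1r.
move=> -> ->; rewrite normcN ComplexField.Normc.normc1 expr1n.
by rewrite !(RecM, Rec_conj, Imc_conj, RecN, ImcN) /=; ring.
Qed.

End square_integrable.

Section projection.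
Context {R : realType} {n : nat}.
Local Notation V := 'rV[R[i]]_n.
Local Notation B := (@uball R n).
Local Notation nu := (@nu R n).
Local Notation borelL2 := (borelL2 nu).
Local Notation sqn := (sqn nu).
Local Notation sqint := (sqint nu).
Local Notation ip := (ip nu).
Implicit Types (f g h u v w : V -> R[i]).

(** [inner] and [L2] only see functions up to null sets, so that one may replace [f]
   by a Borel function and a holomorphic [v] by [cut v]. *)
Lemma inner_ae f f' g g' : {ae nu, forall z, f z = f' z} ->
  {ae nu, forall z, g z = g' z} -> inner f g = ip f' g'.
Proof.
move=> ff gg; congr Complex; congr fine; apply: integral_ae;
  by move: ff gg; apply: filterS2 => z -> ->.
Qed.

Lemma sqint_ae f g : {ae nu, forall z, f z = g z} -> sqint f = sqint g.
Proof. by move=> fg; apply: integral_ae; move: fg; apply: filterS => z ->. Qed.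

Lemma L2_borel f : L2 f -> exists2 g, borelL2 g & {ae nu, forall z, f z = g z}.
Proof.
move=> [[g [g1 g2 fg]] foo]; exists g => //; split; first by split.
by rewrite -(sqint_ae fg).
Qed.

Lemma borel_L2 f g : borelL2 g -> {ae nu, forall z, f z = g z} -> L2 f.
Proof.
move=> [[g1 g2] goo] fg; split; first by exists g; split.
by rewrite -[X in (X < _)%E]/(sqint f) (sqint_ae fg).
Qed.

Lemma ae_sym f g : {ae nu, forall z, f z = g z} -> {ae nu, forall z, g z = f z}.
Proof. by apply: filterS => z ->. Qed.

Lemma A2_cut v : A2 v -> borelL2 (cut v).
Proof.
move=> [hv [_ voo]]; split; first exact: holomorphic_measurable.
by rewrite (sqint_ae (ae_cut v)).
Qed.

Lemma cut_A2 v : holomorphic v -> (sqint (cut v) < +oo)%E -> A2 v.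
Proof.
move=> hv voo; split => //; apply: (@borel_L2 _ (cut v)); last exact/ae_sym/ae_cut.
by split => //; exact: holomorphic_measurable.
Qed.

Lemma cutD f g : cut (fun z => f z + g z) = (fun z => cut f z + cut g z).
Proof. by apply/funext => z; rewrite /cut; case: ifP; rewrite ?addr0. Qed.

Lemma cutZ (c : R[i]) f : cut (fun z => c * f z) = (fun z => c * cut f z).
Proof. by apply/funext => z; rewrite /cut; case: ifP; rewrite ?mulr0. Qed.

Lemma holomorphicDZ v w (c : R[i]) : holomorphic v -> holomorphic w ->
  holomorphic (fun z => v z + c * w z).
Proof.
move=> hv hw z Bz; apply: (@differentiableD _ _ _ v (fun z => c * w z)).
  exact: hv.
exact: (@differentiableZ _ _ _ w c z (hw z Bz)).
Qed.

Lemma A2DZ v w (c : R[i]) : A2 v -> A2 w -> A2 (fun z => v z + c * w z).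
Proof.
move=> Av Aw; apply: cut_A2; first exact: holomorphicDZ Av.1 Aw.1.
by rewrite cutD cutZ; case: (borelL2D (A2_cut Av) (borelL2Z c (A2_cut Aw))).
Qed.

Lemma A2_0 : A2 (fun=> 0 : R[i]) (n := n).
Proof.
apply: cut_A2; first by move=> z _; exact: differentiable_cst.
have -> : cut (fun=> 0 : R[i]) = (fun=> 0 : R[i]) :> (V -> _).
  by apply/funext => z; rewrite /cut; case: ifP.
rewrite /sqint; under eq_integral do rewrite ComplexField.Normc.normc0 expr0n.
by rewrite integral0 ltry.
Qed.

Lemma A2_bound a : B a -> exists r C : R, [/\ 0 < r, 0 <= C,
  forall h : V, nrm1 h < r -> B (a + h) &
  forall v, A2 v -> forall h : V, nrm1 h < r -> normc (v (a + h)) ^+ 2 <= C * sqn (cut v)].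
Proof.
move=> /local_bound[r [C [r0 C0 hr hv]]]; exists r, C; split => // v Av h hh.
have := hv v Av.1 h hh; rewrite [X in (C%:E * X)%E](_ : _ = sqint v)// -(sqint_ae (ae_cut v)).
by rewrite (sqintE (A2_cut Av)) -EFinM lee_fin.
Qed.

Lemma A2_hdiff_ball v a (r : R) : A2 v -> (forall h : V, nrm1 h < r -> B (a + h)) ->
  hdiff_ball v a r.
Proof. by move=> [hv _] hB h /hB /hv/differentiableP_hdiff. Qed.

Lemma le_sqr_small (x K e : R) : 0 <= x -> 0 < e -> 0 <= K -> x ^+ 2 <= K * (e ^+ 2 / (K + 1)) -> x <= e.
Proof.
move=> x0 e0 K0 H; rewrite -(ler_pXn2r (n := 2)) ?nnegrE ?(ltW e0)//.
apply: le_trans H _; rewrite mulrCA; apply: ler_piMr; first exact: sqr_ge0.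
by rewrite ler_pdivrMr ?mul1r ?lerDl// ltr_wpDl.
Qed.

(** Point evaluations are bounded on A^2, locally uniformly, so convergence in norm
   implies locally uniform convergence; this is what makes A^2 closed in L^2. *)
Lemma A2_cauchy_limit (v : nat -> V -> R[i]) (S : R) : (forall k, A2 (v k)) ->
  (forall k, sqn (cut (v k)) <= S) ->
  (forall e : R, 0 < e -> exists N, forall k m, (N <= k)%N -> (N <= m)%N ->
    sqn (cut (fun z => v k z + (-1) * v m z)) <= e) ->
  exists2 u, holomorphic u & forall z, B z -> cconv (v ^~ z) (u z).
Proof.
move=> Av vS vc.
have unif a (r C : R) : 0 <= C -> (forall w, A2 w -> forall h : V, nrm1 h < r ->
      normc (w (a + h)) ^+ 2 <= C * sqn (cut w)) ->
    forall e : R, 0 < e -> exists N, forall k m, (N <= k)%N -> (N <= m)%N ->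
     forall h : V, nrm1 h < r -> normc (v k (a + h) - v m (a + h)) <= e.
  move=> C0 hC e e0; have e1 : 0 < e ^+ 2 / (C + 1).
    by rewrite divr_gt0 ?exprn_gt0// ltr_wpDl.
  have [N hN] := vc _ e1; exists N => k m Nk Nm h hr.
  apply: (le_sqr_small _ e0 C0); first exact: normc_ge0.
  have := hC _ (A2DZ (-1) (Av k) (Av m)) h hr; rewrite mulN1r => H.
  by apply: le_trans H _; rewrite ler_wpM2l// hN.
have ex z : exists x, B z -> cconv (v ^~ z) x.
  have [Bz|nBz] := pselect (B z); last by exists 0.
  have [r [C [r0 C0 _ hC]]] := A2_bound Bz.
  have [|x hx] := @ccauchy_conv R (v ^~ z); last by exists x.
  move=> e e0; have [N hN] := unif _ _ _ C0 hC e e0; exists N => k m Nk Nm.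
  have z0 : nrm1 (0 : V) < r by rewrite nrm1_0.
  by have := hN k m Nk Nm 0 z0; rewrite addr0.
have [u hu] := choice ex; exists u => // a Ba; apply/differentiableP_hdiff.
have [r [C [r0 C0 hr hC]]] := A2_bound Ba.
have S0 : 0 <= S := le_trans (sqn_ge0 _ _) (vS 0%N).
apply: (@hdiff_limit _ _ v u a r (Num.sqrt (C * S))) => //.
- by move=> k; exact: A2_hdiff_ball.
- move=> k h hh; rewrite -(ler_pXn2r (n := 2)) ?nnegrE ?normc_ge0 ?sqrtr_ge0//.
  rewrite sqr_sqrtr ?mulr_ge0//; apply: le_trans (hC _ (Av k) h hh) _.
  by rewrite ler_wpM2l.
- exact: (unif _ _ _ C0 hC).
- by move=> h hh; apply: hu; exact: hr.
Qed.

Definition rdist h v := sqn (fun z => h z - cut v z).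

(** By the parallelogram law a minimizing sequence is Cauchy in norm; the distance
   passes to its pointwise limit by Fatou's lemma. *)
Lemma projection_exists h : borelL2 h -> exists2 u, A2 u &
  forall v, A2 v -> rdist h u <= rdist h v.
Proof.
move=> hL; pose E : set R := [set rdist h v | v in @A2 R n].
have Elb : has_lbound E by exists 0 => _ [v _ <-]; exact: sqn_ge0.
have E0 : E !=set0 by exists (rdist h (fun=> 0)); exists (fun=> 0) => //; exact: A2_0.
pose d := inf E.
have dE v : A2 v -> d <= rdist h v by move=> Av; apply: ge_inf => //; exists v.
have ex (k : nat) : exists v, A2 v /\ rdist h v < d + k.+1%:R^-1.
  have k0 : 0 < k.+1%:R^-1 :> R by rewrite invr_gt0.
  by have [_ [v Av <-] hv] := inf_adherent k0 (conj E0 Elb); exists v.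
have [v hv] := choice ex.
have Av k : A2 (v k) by have [] := hv k.
have dv k : rdist h (v k) < d + k.+1%:R^-1 by have [] := hv k.
have vL k := A2_cut (Av k).
have hvL k := borelL2B hL (vL k).
have vc (e : R) : 0 < e -> exists N, forall k m, (N <= k)%N -> (N <= m)%N ->
    sqn (cut (fun z => v k z + (-1) * v m z)) <= e.
  move=> e0; exists (Num.truncn (4 / e)) => k m Nk Nm.
  have small j : (Num.truncn (4 / e) <= j)%N -> j.+1%:R^-1 <= e / 4.
    move=> Nj; rewrite invf_ple ?posrE ?divr_gt0// invf_div.
    by apply: ltW; apply: lt_le_trans (truncnS_gt _) _; rewrite ler_nat.
  have := parallelogram (hvL m) (hvL k).
  have -> : (fun z => h z - cut (v m) z - (h z - cut (v k) z)) =
      cut (fun z => v k z + (-1) * v m z).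
    by rewrite cutD cutZ; apply/funext => z; ring.
  have -> : (fun z => h z - cut (v m) z + (h z - cut (v k) z)) =
      (fun z => 2 * (h z - cut (fun z => (1 / 2) * v m z + (1 / 2) * v k z) z)).
    by rewrite cutD !cutZ; apply/funext => z; field.
  have Am : A2 (fun z => (1 / 2) * v m z + (1 / 2) * v k z).
    have A0 : A2 (fun z => (1 / 2) * v m z).
      by have := A2DZ (1 / 2) A2_0 (Av m); under [X in A2 X]eq_fun do rewrite add0r.
    exact: A2DZ.
  rewrite sqnZ; last exact: borelL2B (A2_cut Am).
  have -> : normc (2 : R[i]) = 2.
    by rewrite -(rmorph_nat (real_complex R) 2) normc_real ger0_norm.
  have := dE _ Am; rewrite /rdist; have := dv k; have := dv m; rewrite /rdist.
  have := small _ Nk; have := small _ Nm.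
  have arith (p q a b x y : R) : p <= e / 4 -> q <= e / 4 -> a < d + p -> b < d + q ->
      d <= x -> 2 ^+ 2 * x + y = 2 * a + 2 * b -> y <= e by lra.
  exact: arith.
pose S := 2 * (d + 1) + 2 * sqn h.
have vS k : sqn (cut (v k)) <= S.
  have [|_ H] := borelL2_le (vL k).1 (hvL k) hL.
    move=> z; have := sqr_normcD_le (- (h z - cut (v k) z)) (h z).
    by rewrite normcN opprB subrK.
  apply: le_trans H _; rewrite /S lerD2r ler_pM2l//; apply: ltW; apply: lt_le_trans (dv k) _.
  by rewrite lerD2l invf_le1// ler1n.
have [u hu uv] := A2_cauchy_limit Av vS vc.
have mu : cmeasurable setT (cut u) := holomorphic_measurable hu.
have hum : cmeasurable setT (fun z => h z - cut u z) := cmeasurableB hL.1 mu.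
have hud : (sqint (fun z => h z - cut u z)%R <= d%:E)%E.
  apply: (fatou_le (f_ := fun k z => normc (h z - cut (v k) z) ^+ 2)).
  - by move=> k; exact: measurable_sqr_normc (hvL k).1.
  - by move=> k z; exact: sqr_ge0.
  - move=> z; suff cz : normc (h z - cut (v k) z) @[k --> \oo] --> normc (h z - cut u z).
      by under eq_fun do rewrite expr2; rewrite expr2; exact: cvgM.
    have [Bz|nBz] := boolP (enorm z < 1); last first.
      by rewrite /cut (negbTE nBz); exact: cvg_cst.
    apply/cvgrPdist_le => e e0; have [N hN] := uv z Bz e e0.
    exists N => // k /= Nk; rewrite !cutE//.
    apply: le_trans (hN _ Nk).
    have T (x y : R[i]) : normc x - normc y <= normc (x - y).
      by rewrite lerBlDr -[X in normc X <= _](subrK y) le_normcD.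
    rewrite ler_norml; apply/andP; split.
      rewrite lerNl opprB; apply: le_trans (T _ _) _.
      by rewrite [leRHS]normc_distC (_ : _ - _ = u z - v k z)//; ring.
    apply: le_trans (T _ _) _.
    by rewrite (_ : _ - _ = v k z - u z)//; ring.
  - move=> e e0; exists (Num.truncn e^-1) => k Nk.
    rewrite -[X in (X <= _)%E]/(sqint (fun z => h z - cut (v k) z)%R) (sqintE (hvL k)) lee_fin.
    apply: ltW; apply: lt_le_trans (dv k) _; rewrite lerD2l.
    rewrite invf_ple ?posrE//; apply: ltW; apply: lt_le_trans (truncnS_gt _) _.
    by rewrite ler_nat.
have huL : borelL2 (fun z => h z - cut u z).
  by split => //; apply: le_lt_trans hud _; rewrite ltry.
have Au : A2 u.
  apply: cut_A2 => //; have [[]//] := borelL2B hL huL.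
  by under [X in (X < _)%E -> _]eq_integral do rewrite opprB subrKC.
exists u => // w Aw; apply: le_trans (dE w Aw).
by rewrite /rdist -lee_fin -sqintE.
Qed.

(** Moving the best approximation by [s * ip w v] in the direction of [v], for a small
   [s > 0], would shorten the distance if [ip w v] were nonzero. *)
Lemma best_is_proj h u : borelL2 h -> A2 u -> (forall v, A2 v -> rdist h u <= rdist h v) ->
  forall v, A2 v -> ip (fun z => h z - cut u z) (cut v) = 0.
Proof.
move=> hL Au best v Av; set w := (fun z => h z - cut u z).
have wL : borelL2 w := borelL2B hL (A2_cut Au).
set x := ip w (cut v); set N := sqn (cut v).
have N0 : 0 <= N by exact: sqn_ge0.
pose s := (N + 1)^-1; have s0 : 0 < s by rewrite invr_gt0 ltr_wpDl.
have := best _ (A2DZ (s%:C%C * x) Au Av).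
rewrite /rdist cutD cutZ.
have -> : (fun z => h z - (cut u z + s%:C%C * x * cut v z)) =
    (fun z => w z - s%:C%C * x * cut v z) by apply/funext => z; rewrite opprD addrA.
rewrite (sqn_expand (s%:C%C * x) wL (A2_cut Av)) -/x -/N -/w.
have -> : Re (conjc (s%:C%C * x) * x) = s * normc x ^+ 2.
  by rewrite sqr_normcE !(RecM, ImcM, Rec_conj, Imc_conj) /=; ring.
rewrite normcM normc_real (ger0_norm (ltW s0)) => H.
have sN : s * N <= 1 by rewrite mulrC ler_pdivrMr ?mul1r ?lerDl// ltr_wpDl.
have : normc x ^+ 2 <= 0.
  have X0 := sqr_ge0 (normc x).
  have H2 : (s * normc x) ^+ 2 * N <= s * normc x ^+ 2.
    have -> : (s * normc x) ^+ 2 * N = (s * normc x ^+ 2) * (s * N) by ring.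
    by rewrite ler_piMr// mulr_ge0// ltW.
  by rewrite -(pmulr_rle0 _ s0); lra.
by rewrite le_eqVlt ltNge sqr_ge0 orbF sqrf_eq0 normc_eq0 => /eqP.
Qed.

Lemma ae_sub f f' g g' : {ae nu, forall z, f z = f' z} -> {ae nu, forall z, g z = g' z} ->
  {ae nu, forall z, f z - g z = f' z - g' z}.
Proof. by apply: filterS2 => z -> ->. Qed.

Theorem bergman_projP h : L2 h -> is_proj_A2 h (bergman_proj h).
Proof.
move=> /L2_borel[g gL hg].
have [u Au best] := projection_exists gL.
apply: (@xgetPex _ (fun=> 0) (is_proj_A2 h)); exists u; split => // v Av.
rewrite (inner_ae (ae_sub hg (ae_sym (ae_cut u))) (ae_sym (ae_cut v))).
exact: best_is_proj.
Qed.

Lemma sqn_cut_eq0 w : A2 w -> sqn (cut w) = 0 -> forall z, B z -> w z = 0.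
Proof.
move=> Aw w0 z Bz; have [r [C [r0 C0 _ hC]]] := A2_bound Bz.
have z0 : nrm1 (0 : V) < r by rewrite nrm1_0.
have := hC w Aw 0 z0; rewrite addr0 w0 mulr0.
by rewrite le_eqVlt ltNge sqr_ge0 orbF sqrf_eq0 normc_eq0 => /eqP.
Qed.

Lemma is_proj_unique h u u' : L2 h -> is_proj_A2 h u -> is_proj_A2 h u' ->
  forall z, B z -> u z = u' z.
Proof.
move=> /L2_borel[g gL hg] [Au hu] [Au' hu'].
pose w z := u z + (-1) * u' z; have Aw : A2 w by exact: A2DZ.
suff w0 : sqn (cut w) = 0.
  move=> z Bz; have := sqn_cut_eq0 Aw w0 Bz.
  by rewrite /w mulN1r => /eqP; rewrite subr_eq0 => /eqP.
have uL := A2_cut Au; have u'L := A2_cut Au'; have wL := A2_cut Aw.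
have E1 : ip (fun z => g z - cut u z) (cut w) = 0.
  by rewrite -(hu w Aw); apply/esym/inner_ae; [exact/ae_sub/ae_sym/ae_cut|exact/ae_sym/ae_cut].
have E2 : ip (fun z => g z - cut u' z) (cut w) = 0.
  by rewrite -(hu' w Aw); apply/esym/inner_ae; [exact/ae_sub/ae_sym/ae_cut|exact/ae_sym/ae_cut].
have : ip (cut w) (cut w) = 0.
  have <- : ip (fun z => g z - cut u' z) (cut w) - ip (fun z => g z - cut u z) (cut w) = 0.
    by rewrite E1 E2 subrr.
  rewrite /ip -cintB//; try by apply: ip_integrable => //; exact: borelL2B.
  apply: eq_cint => z _; rewrite -mulrBl; congr (_ * _).
  by rewrite /w cutD cutZ; ring.
move=> /(congr1 (@complex.Re R)) /= <-; rewrite sqn_Rintegral.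
apply: eq_Rintegral => z _; rewrite sqr_normcE RecM Rec_conj Imc_conj; ring.
Qed.

Lemma bergman_proj_eq h u : L2 h -> is_proj_A2 h u -> forall z, B z -> bergman_proj h z = u z.
Proof. by move=> hL hu; exact: (is_proj_unique hL (bergman_projP hL) hu). Qed.

End projection.

(** * Functions orthogonal to a multiplicative family *)

Section absorption.
Import HBNNSimple.
Context d (T : measurableType d) (R : realType) (mu : {measure set T -> \bar R}).
Context (I : Type) (w : I -> T -> R[i]).
Implicit Types (h phi psi : T -> R[i]) (A : set T).

Definition cbounded phi := cmeasurable setT phi /\ exists K, forall z, normc (phi z) <= K.

Lemma cintegrableM phi h : cbounded phi -> cintegrable mu setT h ->
  cintegrable mu setT (fun z => phi z * h z).
Proof.
move=> [mphi [K hK]] hi.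
apply: (@le_cintegrable _ _ _ mu _ measurableT _ (fun z => K * normc (h z))).
- exact: cmeasurableM mphi (cintegrable_measurable hi).
- by move=> z _; rewrite normcM ler_wpM2r// normc_ge0.
- by apply: eq_integrable (integrableZl measurableT K (cintegrable_normc measurableT hi)).
Qed.

Lemma cboundedM phi psi : cbounded phi -> cbounded psi ->
  cbounded (fun z => phi z * psi z).
Proof.
move=> [m1 [K1 h1]] [m2 [K2 h2]]; split; first exact: cmeasurableM.
by exists (K1 * K2) => z; rewrite normcM ler_pM// normc_ge0.
Qed.

Lemma cboundedD phi psi : cbounded phi -> cbounded psi ->
  cbounded (fun z => phi z + psi z).
Proof.
move=> [m1 [K1 h1]] [m2 [K2 h2]]; split; first exact: cmeasurableD.
by exists (K1 + K2) => z; apply: le_trans (le_normcD _ _) _; rewrite lerD.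
Qed.

Lemma cbounded_cst c : cbounded (fun=> c).
Proof. by split; [exact: cmeasurable_cst|exists (normc c)]. Qed.

Lemma cbounded_conj phi : cbounded phi -> cbounded (fun z => conjc (phi z)).
Proof.
by move=> [m [K hK]]; split; [exact: cmeasurable_conj|exists K => z; rewrite normc_conj].
Qed.

Hypothesis wb : forall i, cbounded (w i).

Definition annih h := cintegrable mu setT h /\
  forall i, cint mu setT (fun z => w i z * h z) = 0.

(** The bounded functions that act by multiplication on the annihilator of the
   family [w]; they form an algebra closed under bounded pointwise limits, hence
   contain with a real function all its bounded Borel functions. *)
Definition absorbs phi := cbounded phi /\
  forall h, annih h -> annih (fun z => phi z * h z).

Lemma absorbs_cst c : absorbs (fun=> c).
Proof.
split; first exact: cbounded_cst.
move=> h [hi hw]; split; first exact: cintegrableM (cbounded_cst c) hi.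
move=> i; under eq_cint do rewrite mulrCA.
by rewrite cintZ// ?hw ?mulr0//; exact: cintegrableM.
Qed.

Lemma absorbsM phi psi : absorbs phi -> absorbs psi -> absorbs (fun z => phi z * psi z).
Proof.
move=> [b1 a1] [b2 a2]; split; first exact: cboundedM.
by move=> h /a2/a1; under eq_fun do rewrite mulrA.
Qed.

Lemma absorbsD phi psi : absorbs phi -> absorbs psi -> absorbs (fun z => phi z + psi z).
Proof.
move=> [b1 a1] [b2 a2]; split; first exact: cboundedD.
move=> h hA; have [i1 h1] := a1 _ hA; have [i2 h2] := a2 _ hA.
have E : (fun z => (phi z + psi z) * h z) = (fun z => phi z * h z + psi z * h z).
  by apply/funext => z; rewrite mulrDl.
rewrite E; split; first exact: cintegrableD.
move=> i; under eq_cint do rewrite mulrDr.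
by rewrite cintD ?h1 ?h2 ?addr0//; exact: cintegrableM.
Qed.

Lemma absorbsB phi psi : absorbs phi -> absorbs psi -> absorbs (fun z => phi z - psi z).
Proof.
move=> a1 a2; have := absorbsD a1 (absorbsM (absorbs_cst (-1)) a2).
by under [X in absorbs X -> _]eq_fun do rewrite mulN1r.
Qed.

Lemma absorbsX phi k : absorbs phi -> absorbs (fun z => phi z ^+ k).
Proof.
move=> a; elim: k => [|k IH]; first exact: absorbs_cst 1.
by have := absorbsM a IH; under [X in absorbs X -> _]eq_fun do rewrite -exprS.
Qed.

Lemma absorbs_family i : (forall i j, exists k, forall z, w i z * w j z = w k z) ->
  absorbs (w i).
Proof.
move=> wM; split => // h [hi hw]; split; first exact: cintegrableM.
move=> j; have [k wk] := wM j i.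
by under eq_cint do rewrite mulrA wk.
Qed.

Definition rabsorbs (phi : T -> R) := absorbs (fun z => (phi z)%:C%C).

Lemma rabsorbs_lim (phi_ : nat -> T -> R) (phi : T -> R) (K : R) :
  (forall k, rabsorbs (phi_ k)) -> measurable_fun setT phi ->
  (forall k z, `|phi_ k z| <= K) -> (forall z, `|phi z| <= K) ->
  (forall z, phi_ ^~ z @ \oo --> phi z) -> rabsorbs phi.
Proof.
move=> pa mp pK pK' pp.
have pb : cbounded (fun z => (phi z)%:C%C).
  by split; [exact: cmeasurable_real|exists K => z; rewrite normc_real].
split => // h hA; split; first exact: cintegrableM hA.1.
move=> i; have [u1 u2] := cintegrableM (wb i) hA.1.
have lim0 (u : T -> R) : mu.-integrable setT (EFin \o u) ->
    (forall k, \int[mu]_z (phi_ k z * u z) = 0) -> \int[mu]_z (phi z * u z) = 0.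
  move=> ui u0.
  have mk k : measurable_fun setT (phi_ k) by have [[[m _] _] _] := pa k.
  have mu_ : measurable_fun setT u by exact/measurable_EFinP/(measurable_int _ ui).
  have Ku : mu.-integrable setT (fun z => (K * `|u z|)%:E).
    by apply: eq_integrable (integrableZl measurableT K (integrable_norm ui)).
  have := @dominated_cvg _ _ _ mu _ measurableT (fun k z => (phi_ k z * u z)%:E)
    (fun z => (phi z * u z)%:E) (fun z => (K * `|u z|)%:E).
  move=> /(_ _ _ _ Ku) H.
  have {}H : (\int[mu]_z (phi_ k z * u z)%:E)%E @[k --> \oo] -->
      (\int[mu]_z (phi z * u z)%:E)%E.
    apply: H => //.
    - by move=> k; apply/measurable_EFinP; exact: measurable_funM.
    - move=> z _; apply: cvg_EFin; first exact: nearW.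
      by apply: cvgM => //; exact: cvg_cst.
    - by move=> k z _; rewrite lee_fin normrM ler_wpM2r.
  have E0 k : (\int[mu]_z (phi_ k z * u z)%:E)%E = 0%E.
    have ik : mu.-integrable setT (EFin \o (fun z => phi_ k z * u z)).
      apply: le_integrable Ku => //.
        by apply/measurable_EFinP; exact: measurable_funM.
      move=> z _; rewrite lee_fin normrM [leRHS]ger0_norm.
        by rewrite ler_wpM2r.
      by rewrite mulr_ge0// (le_trans (normr_ge0 _) (pK' z)).
    rewrite -[LHS]fineK; last exact: integrable_fin_num ik.
    by have := u0 k; rewrite /Rintegral => ->.
  have {}H : cst 0%E @ \oo --> (\int[mu]_z (phi z * u z)%:E)%E.
    by move: H; under eq_fun do rewrite E0.
  by rewrite /Rintegral -(cvg_unique _ (@cvg_cst _ _ _ _ _) H).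
have E k : cint mu setT (fun z => w i z * ((phi_ k z)%:C%C * h z)) = 0.
  by have [_ a] := pa k; have [_] := a _ hA; exact.
have Re_p (p : T -> R) z : Re (w i z * ((p z)%:C%C * h z)) = p z * Re (w i z * h z).
  by rewrite mulrCA [in LHS]RecM (_ : Re (p z)%:C%C = p z)// (_ : Im (p z)%:C%C = 0)// mul0r subr0.
have Im_p (p : T -> R) z : Im (w i z * ((p z)%:C%C * h z)) = p z * Im (w i z * h z).
  by rewrite mulrCA [in LHS]ImcM (_ : Re (p z)%:C%C = p z)// (_ : Im (p z)%:C%C = 0)// mul0r addr0.
apply: complex_eq => /=.
  under eq_Rintegral do rewrite Re_p; apply: lim0 => // k.
  under eq_Rintegral do rewrite -Re_p.
  by have /(congr1 (@complex.Re R)) := E k.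
under eq_Rintegral do rewrite Im_p; apply: lim0 => // k.
under eq_Rintegral do rewrite -Im_p.
by have /(congr1 (@complex.Im R)) := E k.
Qed.

Definition absorbed A := measurable A /\ rabsorbs \1_A.

Lemma absorbedC A : absorbed A -> absorbed (~` A).
Proof.
move=> [mA aA]; split; first exact: measurableC.
have := absorbsB (absorbs_cst 1) aA; rewrite /rabsorbs.
suff -> : (fun z => 1 - (\1_A z)%:C%C) = (fun z => (\1_(~` A) z)%:C%C) :> (T -> R[i]) by [].
by apply/funext => z; rewrite !indicE in_setC; case: (z \in A); rewrite /= ?subr0 ?subrr.
Qed.

Lemma absorbedI A C : absorbed A -> absorbed C -> absorbed (A `&` C).
Proof.
move=> [mA aA] [mC aC]; split; first exact: measurableI.
rewrite /rabsorbs; under [X in absorbs X]eq_fun do rewrite indicI /= rmorphM.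
exact: absorbsM.
Qed.

(** Stability under intersections comes for free from the definition of [absorbs],
   which quantifies over the whole annihilator. *)
Lemma absorbed_sigma_algebra : sigma_algebra setT absorbed.
Proof.
have a0 : absorbed set0.
  split => //; have := absorbs_cst 0; rewrite /rabsorbs.
  by under [X in _ -> absorbs X]eq_fun do rewrite indic0.
have aU A C : absorbed A -> absorbed C -> absorbed (A `|` C).
  by move=> aA aC; rewrite -[_ `|` _]setCK setCU; exact/absorbedC/absorbedI/absorbedC/aC/absorbedC.
split => //; first by move=> A; rewrite setTD; exact: absorbedC.
move=> F aF; have mF : measurable (\bigcup_k F k).
  by apply: bigcupT_measurable => k; have [] := aF k.
split => //.
pose G k := \big[setU/set0]_(j < k) F j.
have aG k : absorbed (G k).
  rewrite /G; elim: k => [|k IH]; first by rewrite big_ord0.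
  by rewrite big_ord_recr; exact: aU.
have ind01 A z : `|\1_A z : R| <= 1 by rewrite indicE; case: (_ \in _); rewrite ?normr1 ?normr0.
apply: (@rabsorbs_lim (fun k => \1_(G k)) _ 1) => //.
- by move=> k; have [] := aG k.
move=> z; have [[k _ Fz]|nF] := pselect ((\bigcup_k F k) z).
  apply/cvgrPdist_le => e e0; exists k.+1 => // j /= kj.
  rewrite [\1_(\bigcup_k F k) z]indicE mem_set; last by exists k.
  rewrite indicE mem_set ?subrr ?normr0 ?ltW//.
  by rewrite /G -bigcup_mkord; exists k.
apply/cvgrPdist_le => e e0; exists 0%N => // j _.
rewrite [\1_(\bigcup_k F k) z]indicE memNset// indicE memNset ?subrr ?normr0 ?ltW//.
by rewrite /G -bigcup_mkord => -[k _ Fz]; apply: nF; exists k.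
Qed.

Lemma rabsorbs_simple (T' : Type) (X : T -> T') (f : {fimfun T' >-> R}) :
  (forall x, absorbed (X @^-1` (f @^-1` [set x]))) -> rabsorbs (f \o X).
Proof.
move=> aX; rewrite /rabsorbs.
under [X in absorbs X]eq_fun do rewrite /= fimfunE fsbig_finite//=.
elim: (finmap.enum_fset _) => [|x s IH].
  by under [X in absorbs X]eq_fun do rewrite big_nil; exact: absorbs_cst.
under [X in absorbs X]eq_fun do rewrite big_cons rmorphD rmorphM.
apply: absorbsD => //; apply: absorbsM; first exact: absorbs_cst.
by have [_] := aX x.
Qed.

Lemma absorbed_preimage (X : T -> R) : (forall a, absorbed [set z | X z < a]) ->
  forall Y : set R, measurable Y -> absorbed (X @^-1` Y).
Proof.
move=> aX; have := sigma_algebra_image X absorbed_sigma_algebra.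
set S := image_set_system _ _ _ => SS.
have sub : <<s @RGenInftyO.G R >> `<=` S.
  apply: smallest_sub => // _ [a ->]; rewrite /S /image_set_system /= setTI.
  suff -> : X @^-1` `]-oo, a[%classic = [set z | X z < a] by exact: aX.
  by apply/seteqP; split => z /=; rewrite in_itv.
move=> Y mY; have : S Y by apply: sub; exact: (eq_ind _ (fun M => M Y) mY _ (RGenInftyO.measurableE R)).
by rewrite /S /image_set_system /= setTI.
Qed.

(** Approximating [phi], rather than [phi \o X], by simple functions keeps the level
   sets in the sigma-algebra generated by [X]. *)
Lemma rabsorbs_borel (X : T -> R) (phi : R -> R) (K : R) :
  (forall a, absorbed [set z | X z < a]) -> measurable_fun setT phi ->
  (forall x, `|phi x| <= K) -> rabsorbs (phi \o X).
Proof.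
move=> aX mphi hK; have aY := absorbed_preimage aX.
have mX : measurable_fun setT X.
  by move=> _ Y mY; rewrite setTI; have [] := aY Y mY.
pose psi1 x := (phi x + K)%:E.
have psi0 x : setT x -> (0 <= psi1 x)%E.
  by move=> _; rewrite lee_fin; have := hK x; rewrite ler_norml => /andP[]; rewrite -lerBlDr sub0r.
have mpsi : measurable_fun setT psi1.
  by apply/measurable_EFinP; apply: measurable_funD => //; exact: measurable_cst.
pose s k : {nnsfun R >-> R} := nnsfun_approx measurableT mpsi k.
have cv x : (fun k => s k x) @ \oo --> phi x + K.
  have := cvg_nnsfun_approx measurableT mpsi psi0 (Logic.I : [set: R] x).
  by move=> /fine_cvgP[_]; exact: cvg_trans.
have s_le k x : s k x <= phi x + K.
  have nd : {homo (fun k => s k x) : n m / (n <= m)%N >-> n <= m}.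
    by move=> a b ab; exact/lefP/nd_nnsfun_approx.
  have := nondecreasing_cvgn_le nd; have /cvg_lim <- := cv x => //.
  by apply; apply/cvg_ex; exists (phi x + K).
have aS : rabsorbs (fun z => phi (X z) + K).
  apply: (@rabsorbs_lim (fun k => s k \o X) _ (K + K)).
  - by move=> k; apply: rabsorbs_simple => x; apply: aY; exact: measurable_sfunP.
  - by apply: measurable_funD => //; exact: measurableT_comp.
  - move=> k z; rewrite ger0_norm//=; apply: le_trans (s_le k _) _.
    by rewrite lerD2r; have := hK (X z); rewrite ler_norml => /andP[].
  - move=> z; apply: le_trans (ler_normD _ _) _; apply: lerD; first exact: hK.
    by rewrite ger0_norm// (le_trans _ (hK 0)).
  - by move=> z; exact: cv.
have := absorbsB aS (absorbs_cst K%:C%C); rewrite /rabsorbs.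
by under [X in absorbs X -> _]eq_fun do rewrite -rmorphB addrK.
Qed.

End absorption.

Section steep_powers.
Context {R : realType}.
Implicit Types x y s : R.

Lemma bernoulli_le x N : 0 <= x <= 1 -> 1 - N%:R * x <= (1 - x) ^+ N.
Proof.
move=> /andP[x0 x1]; elim: N => [|N IH]; first by rewrite mul0r subr0 expr0.
rewrite exprS; have -> : N.+1%:R = N%:R + 1 :> R by rewrite natr1.
have N0 : 0 <= N%:R :> R by [].
have : (1 - x) * (1 - N%:R * x) <= (1 - x) * (1 - x) ^+ N by rewrite ler_wpM2l// subr_ge0.
have : 0 <= N%:R * x ^+ 2 by rewrite mulr_ge0// sqr_ge0.
lra.
Qed.

Lemma bernoulli_ge x N : 0 <= x <= 1 -> (1 - x) ^+ N * (1 + N%:R * x) <= 1.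
Proof.
move=> /andP[x0 x1]; elim: N => [|N IH]; first by rewrite mul0r addr0 expr0 mulr1.
apply: le_trans IH; rewrite exprS [_ * _ ^+ N]mulrC -mulrA.
rewrite ler_wpM2l ?exprn_ge0 ?subr_ge0//.
have -> : N.+1%:R = N%:R + 1 :> R by rewrite natr1.
have N0 : 0 <= N%:R :> R by [].
have : 0 <= N%:R * x ^+ 2 by rewrite mulr_ge0// sqr_ge0.
have := sqr_ge0 x; lra.
Qed.

(** The exponents make the transition of [1 - y ^+ k] from 1 to 0, which takes
   place near [y = 1], happen at [y = 1 / 2]. *)
Lemma steep_powers_cvg y : 0 <= y <= 1 ->
  (fun k : nat => (1 - y ^+ k) ^+ (k * 2 ^ k)%N) @ \oo --> (((y < 1 / 2 :> R) : bool)%:R : R).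
Proof.
move=> /andP[y0 y1].
have yk k : 0 <= y ^+ k <= 1 by rewrite exprn_ge0// exprn_ile1.
have E k : (k * 2 ^ k)%N%:R * y ^+ k = k%:R * (2 * y) ^+ k.
  by rewrite natrM natrX -mulrA -exprMn.
case: ltP => [y2|y2] /=.
  set s := Num.sqrt (2 * y).
  have s0 : 0 <= s by exact: sqrtr_ge0.
  have ss : s ^+ 2 = 2 * y by rewrite sqr_sqrtr// mulr_ge0.
  have s1 : s < 1.
    by rewrite -(@expr_lt1 _ 2)// ss; lra.
  apply/cvgrPdist_le => e e0.
  have := @cvg_expr R s; rewrite ger0_norm// => /(_ s1)/cvgrPdist_le.
  move=> /(_ (e * (1 - s))); rewrite mulr_gt0 ?subr_gt0// => /(_ isT)[N _ hN].
  exists N => // k /= Nk; have := hN k Nk; rewrite sub0r normrN ger0_norm ?exprn_ge0// => hk.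
  have [/andP[a0 a1]] := yk k.
  rewrite ger0_norm; last by rewrite subr_ge0 exprn_ile1 ?subr_ge0// lerBlDr lerDl.
  have := bernoulli_le (k * 2 ^ k)%N (yk k); rewrite E -ss -exprM mulnC exprM => H.
  have s1' : 0 <= 1 - s <= 1 by apply/andP; split; lra.
  have := bernoulli_ge k s1'; rewrite subKr => H2.
  have sk0 : 0 <= s ^+ k by rewrite exprn_ge0.
  have : (1 - s) * (k%:R * (s ^+ k) ^+ 2) <= (1 - s) * e; last by rewrite ler_pM2l ?subr_gt0//; lra.
  rewrite expr2; apply: le_trans (_ : s ^+ k <= _); last by rewrite mulrC.
  have -> : (1 - s) * (k%:R * (s ^+ k * s ^+ k)) = s ^+ k * (s ^+ k * (k%:R * (1 - s))) by ring.
  by rewrite ler_piMr//; lra.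
apply/cvgrPdist_le => e e0; exists (Num.truncn e^-1) => // k /= Nk.
have yk0 := yk k; have /andP[a0 a1] := yk0.
have p0 : 0 <= (1 - y ^+ k) ^+ (k * 2 ^ k)%N by rewrite exprn_ge0// subr_ge0.
rewrite sub0r normrN ger0_norm//.
have := bernoulli_ge (k * 2 ^ k)%N yk0; rewrite E => H.
have k2 : k%:R <= k%:R * (2 * y) ^+ k.
  by rewrite ler_peMr// exprn_ege1//; lra.
have ke : e^-1 <= 1 + k%:R.
  apply: ltW; apply: lt_le_trans (truncnS_gt _) _.
  by rewrite -natr1 addrC lerD2l ler_nat.
rewrite -[leRHS]mul1r -ler_pdivrMr//.
apply: le_trans H; rewrite ler_wpM2l//; apply: le_trans ke _.
by rewrite lerD2l.
Qed.

Lemma affine01 x a (K : R) : `|x| <= K ->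
  0 <= (x - a) * (2 * (K + `|a| + 1))^-1 + 1 / 2 <= 1.
Proof.
move=> xK; have D0 : 0 < 2 * (K + `|a| + 1).
  by rewrite mulr_gt0// ltr_wpDl// addr_ge0// (le_trans _ xK).
have : `|(x - a) * (2 * (K + `|a| + 1))^-1| <= 1 / 2.
  rewrite normrM (ger0_norm (x := _^-1)) ?invr_ge0 ?(ltW D0)// ler_pdivrMr//.
  by apply: le_trans (ler_normB _ _) _; lra.
by rewrite ler_norml => /andP[? ?]; apply/andP; split; lra.
Qed.

Context d (T : measurableType d) (mu : {measure set T -> \bar R}).
Context (I : Type) (w : I -> T -> R[i]).
Hypothesis wb : forall i, cbounded (w i).

(** The indicator of a half-line is a bounded pointwise limit of polynomials, see
   [steep_powers_cvg], after rescaling [a] to [1 / 2]. *)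
Lemma absorbed_lt (X : T -> R) a K : rabsorbs mu w X -> (forall z, `|X z| <= K) ->
  absorbed mu w [set z | X z < a].
Proof.
move=> aX hK; have mX : measurable_fun setT X by have [[[m _] _] _] := aX.
pose c := (2 * (K + `|a| + 1))^-1.
pose y z := (X z - a) * c + 1 / 2.
have K0 (z : T) : 0 <= K by exact: le_trans (normr_ge0 _) (hK z).
have y01 z : 0 <= y z <= 1 by exact: affine01.
have ay : rabsorbs mu w y.
  have A := absorbsD wb (absorbsM (absorbsB wb aX (absorbs_cst mu wb a%:C%C)) (absorbs_cst mu wb c%:C%C))
    (absorbs_cst mu wb (1 / 2)%:C%C).
  by move: A; rewrite /rabsorbs; under [X in absorbs _ _ X -> _]eq_fun do
    rewrite -rmorphB -rmorphM -rmorphD.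
have mS : measurable [set z | X z < a].
  rewrite (_ : [set z | _] = X @^-1` `]-oo, a[).
    by rewrite -[X in measurable X]setTI; exact: mX.
  by apply/seteqP; split => z /=; rewrite in_itv.
split => //; apply: (@rabsorbs_lim _ _ _ mu _ w wb
    (fun k z => (1 - y z ^+ k) ^+ (k * 2 ^ k)%N) _ 1).
- move=> k; have := absorbsX wb (k * 2 ^ k)%N (absorbsB wb (absorbs_cst mu wb 1) (absorbsX wb k ay)).
  rewrite /rabsorbs; under [X in absorbs _ _ X -> _]eq_fun do
    rewrite -rmorphXn -(rmorph1 (real_complex R)) -rmorphB -rmorphXn.
  exact.
- exact: measurable_indic.
- move=> k z; have /andP[a0 a1] := y01 z.
  have b0 : 0 <= 1 - y z ^+ k by rewrite subr_ge0 exprn_ile1.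
  have b1 : 1 - y z ^+ k <= 1 by rewrite lerBlDr lerDl exprn_ge0.
  by rewrite ger0_norm ?exprn_ge0// exprn_ile1.
- by move=> z; rewrite indicE; case: (_ \in _); rewrite ?normr1 ?normr0.
- move=> z; have := steep_powers_cvg (y01 z).
  suff -> : (y z < 1 / 2)%R = (z \in [set z | X z < a]) by rewrite -indicE.
  have -> : (z \in [set z | X z < a]) = (X z < a) by apply/idP/idP; rewrite inE.
  rewrite /y gtrDr pmulr_llt0 ?subr_lt0//.
  by rewrite invr_gt0 mulr_gt0// ltr_wpDl// addr_ge0// (K0 z).
Qed.

End steep_powers.

(** * Monomials and moments *)

Section monomials.
Context {R : realType} {n : nat}.
Local Notation V := 'rV[R[i]]_n.
Local Notation B := (@uball R n).
Local Notation nu := (@nu R n).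
Implicit Types (z : V) (m k : 'I_n -> nat).

Definition mon m z : R[i] := \prod_j z 0 j ^+ m j.
Definition deg m : nat := \sum_j m j.

Lemma monD m k z : mon (fun j => m j + k j)%N z = mon m z * mon k z.
Proof. by rewrite /mon -big_split; apply: eq_bigr => j _; rewrite exprD. Qed.

Lemma degD m k : deg (fun j => m j + k j)%N = (deg m + deg k)%N.
Proof. by rewrite /deg big_split. Qed.

Lemma monZ m c z : mon m (c *: z) = c ^+ deg m * mon m z.
Proof.
rewrite /mon /deg expr_sum -big_split; apply: eq_bigr => j _.
by rewrite mxE exprMn.
Qed.

Lemma mon0 z : mon (fun=> 0%N) z = 1.
Proof. by rewrite /mon big1. Qed.

Lemma normc_mon_le1 m z : B z -> normc (mon m z) <= 1.
Proof.
move=> /uball_sqr Bz; rewrite /mon; elim/big_ind : _.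
- by rewrite ComplexField.Normc.normc1.
- by move=> x y x1 y1; rewrite normcM -[leRHS]mulr1 ler_pM// normc_ge0.
move=> j _; rewrite normcX exprn_ile1// ?normc_ge0//.
rewrite -(@expr_le1 _ 2)// ?normc_ge0//; apply: le_trans (ltW Bz).
by rewrite ?sqr_enorm (bigD1 j)//= lerDl sumr_ge0// => i _; rewrite sqr_ge0.
Qed.

Lemma holomorphic_coord j : holomorphic (fun z : V => z 0 j).
Proof.
move=> z _; apply/differentiableP_hdiff; exists (fun i => (i == j)%:R) => e e0.
exists 1 => // h _; rewrite (_ : _ - _ = 0).
  by rewrite ComplexField.Normc.normc0 mulr_ge0 ?(ltW e0) ?nrm1_ge0.
rewrite mxE [_ + h 0 j]addrC addrK /lform (bigD1 j)//= eqxx mulr1 big1 ?addr0 ?subrr//.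
by move=> i /negbTE ->; rewrite mulr0.
Qed.

Lemma holomorphicM (f g : V -> R[i]) : holomorphic f -> holomorphic g ->
  holomorphic (fun z => f z * g z).
Proof.
by move=> hf hg z Bz; apply: (@differentiableM _ _ f g); [exact: hf|exact: hg].
Qed.

Lemma holomorphic_cst c : holomorphic (fun _ : V => c).
Proof. by move=> z _; exact: differentiable_cst. Qed.

Lemma holomorphic_mon m : holomorphic (mon m).
Proof.
rewrite /mon; elim: (index_enum _) => [|j s IH].
  under [X in holomorphic X]eq_fun do rewrite big_nil; exact: holomorphic_cst.
under [X in holomorphic X]eq_fun do rewrite big_cons.
apply: holomorphicM => //; elim: (m j) => [|k IHk].
  by under [X in holomorphic X]eq_fun do rewrite expr0; exact: holomorphic_cst.
under [X in holomorphic X]eq_fun do rewrite exprS.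
by apply: holomorphicM => //; exact: holomorphic_coord.
Qed.

Lemma cmeasurable_mon m : cmeasurable setT (mon m).
Proof. by apply: cmeasurable_prod => j; apply: cmeasurableX; exact: measurable_coord. Qed.

Lemma cmeasurable_cut (f : V -> R[i]) : cmeasurable setT f -> cmeasurable setT (cut f).
Proof.
move=> mf; have m1 := holomorphic_measurable (holomorphic_cst 1).
have <- : (fun z => cut (fun=> 1) z * f z) = cut f; last exact: cmeasurableM.
by apply/funext => z; rewrite /cut; case: ifP => _; rewrite ?mul1r ?mul0r.
Qed.

Lemma cbounded_cut (f : V -> R[i]) (K : R) : cmeasurable setT f ->
  (forall z, B z -> normc (f z) <= K) -> 0 <= K -> cbounded (cut f).
Proof.
move=> mf hK K0; split; first exact: cmeasurable_cut.
by exists K => z; rewrite /cut; case: ifPn => [/hK//|_]; rewrite ComplexField.Normc.normc0.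
Qed.

Lemma bounded_A2 f (K : R) : holomorphic f -> (forall z, B z -> normc (f z) <= K) ->
  0 <= K -> A2 f.
Proof.
move=> hf hK K0; apply: cut_A2 => //.
have mf := holomorphic_measurable hf.
apply: (@nu_ge0_finite _ _ _ (K ^+ 2)).
- by move=> z; rewrite lee_fin sqr_ge0.
- by apply/measurable_EFinP; exact: measurable_sqr_normc.
by move=> z Bz; rewrite lee_fin cutE// lerXn2r ?nnegrE ?normc_ge0// hK.
Qed.

Lemma A2_mon m : A2 (mon m).
Proof. by apply: (@bounded_A2 _ 1) => //; [exact: holomorphic_mon|exact: normc_mon_le1]. Qed.

Definition moment (p : ('I_n -> nat) * ('I_n -> nat)) : V -> R[i] :=
  cut (fun z => mon p.1 z * conjc (mon p.2 z)).

Lemma cbounded_moment p : cbounded (moment p).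
Proof.
apply: (@cbounded_cut _ 1) => //.
  exact: cmeasurableM (cmeasurable_mon _) (cmeasurable_conj (cmeasurable_mon _)).
move=> z Bz; rewrite normcM normc_conj -[leRHS]mulr1.
by rewrite ler_pM ?normc_ge0 ?normc_mon_le1.
Qed.

Lemma momentM p q : exists r, forall z, moment p z * moment q z = moment r z.
Proof.
exists (fun j => p.1 j + q.1 j, fun j => p.2 j + q.2 j)%N => z /=.
rewrite /moment /cut; case: ifP => _; last by rewrite mulr0.
by rewrite /= !monD [conjc (_ * _)]rmorphM; ring.
Qed.

(** Coordinates are bounded only on the ball; [clip] discards the null complement of
   the ball while keeping its Borel structure. *)
Definition clip z : V := if enorm z < 1 then z else 0.

Lemma clipE z : B z -> clip z = z.
Proof. by rewrite /clip /uball /= => ->. Qed.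

(** The moments are closed under multiplication, so they absorb each other, hence the
   real and imaginary parts of the coordinates and all Borel functions of these. *)
Lemma absorbed_clip (A : set V) : measurable A -> absorbed nu moment (clip @^-1` A).
Proof.
have wb := cbounded_moment.
have am p : absorbs nu moment (moment p) by apply: absorbs_family => //; exact: momentM.
pose d (j i : 'I_n) : nat := (i == j).
have mon_d j z : mon (d j) z = z 0 j.
  rewrite /mon (bigD1 j)//= /d eqxx expr1 big1 ?mulr1// => i /negbTE ->.
  by rewrite expr0.
pose o : 'I_n -> nat := fun=> 0%N.
have clip_c j z : (clip z) 0 j = moment (d j, o) z.
  rewrite /clip /moment /cut; case: ifP => _; last by rewrite mxE.
  by rewrite mon_d mon0 rmorph1 mulr1.
have clip_cc j z : conjc ((clip z) 0 j) = moment (o, d j) z.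
  rewrite /clip /moment /cut; case: ifP => _; last by rewrite mxE rmorph0.
  by rewrite mon_d mon0 mul1r.
have bnd (X : V -> R) j : (forall z, `|X z| <= normc ((clip z) 0 j)) ->
    exists K, forall z, `|X z| <= K.
  move=> h; have [_ [K hK]] := wb (d j, o); exists K => z.
  by apply: le_trans (h z) _; rewrite clip_c.
have aRe j a : absorbed nu moment [set z | Re ((clip z) 0 j) < a].
  have [K hK] := bnd (fun z => Re ((clip z) 0 j)) j (fun z => le_Re_normc _).
  apply: (absorbed_lt wb _ _ hK).
  rewrite /rabsorbs (_ : (fun z => _) =
      (fun z => (1 / 2) * (moment (d j, o) z + moment (o, d j) z))).
    exact: absorbsM (absorbs_cst nu wb _) (absorbsD wb (am _) (am _)).
  apply/funext => z; rewrite -clip_c -clip_cc.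
  by case: ((clip z) 0 j) => x y; apply: complex_eq; rewrite !(RecM, ImcM) /=; field.
have aIm j a : absorbed nu moment [set z | Im ((clip z) 0 j) < a].
  have [K hK] := bnd (fun z => Im ((clip z) 0 j)) j (fun z => le_Im_normc _).
  apply: (absorbed_lt wb _ _ hK).
  rewrite /rabsorbs (_ : (fun z => _) =
      (fun z => (Complex 0 (- (1 / 2))) * (moment (d j, o) z - moment (o, d j) z))).
    exact: absorbsM (absorbs_cst nu wb _) (absorbsB wb (am _) (am _)).
  apply/funext => z; rewrite -clip_c -clip_cc.
  by case: ((clip z) 0 j) => x y; apply: complex_eq; rewrite !(RecM, ImcM) /=; field.
have := sigma_algebra_image clip (absorbed_sigma_algebra nu wb).
set S := image_set_system _ _ _ => SS.
suff sub : g_sigma_preimage (@coordR2 R n) `<=` S.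
  by move=> /sub; rewrite /S /image_set_system /= setTI.
apply: smallest_sub => //; rewrite -bigcup_seq; apply: bigcup_sub => j _ _ [Y mY <-].
have := sigma_algebra_image (coordR2 j \o clip) (absorbed_sigma_algebra nu wb).
set S2 := image_set_system _ _ _ => SS2.
suff : S2 Y by rewrite /S /S2 /image_set_system /= !setTI.
move: Y mY; rewrite measurable_prod_measurableType; apply: smallest_sub => //.
move=> _ [Y1 mY1 [Y2 mY2 <-]]; rewrite /S2 /image_set_system /= setTI.
have A1 := absorbed_preimage wb (aRe j) mY1; have A2 := absorbed_preimage wb (aIm j) mY2.
exact: absorbedI A1 A2.
Qed.

Lemma nu_integral_restrict (E : set V) (f : V -> R) : measurable E ->
  measurable_fun setT f ->
  \int[nu]_(z in E) f z = \int[nu]_z (\1_(clip @^-1` E) z * f z).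
Proof.
move=> mE mf; rewrite /Rintegral integral_indic_mul; congr fine; apply: integral_ae.
apply: ae_ball => z Bz; rewrite !indicE.
have -> // : (z \in clip @^-1` E) = (z \in E).
by apply/idP/idP; rewrite !in_setE /preimage /= (clipE Bz).
Qed.

(** Multiplying [h] by the indicator of a Borel set keeps all its moments zero, by
   [absorbed_clip]; the zeroth moment is then the integral of [h] over that set. *)
Theorem moments_eq0 h : cintegrable nu setT h ->
  (forall m k, cint nu setT (fun z => mon m z * conjc (mon k z) * h z) = 0) ->
  {ae nu, forall z, h z = 0}.
Proof.
move=> hi h0; have wb := cbounded_moment.
have cutae p (f : V -> R[i]) : cint nu setT (fun z => moment p z * f z) =
    cint nu setT (fun z => mon p.1 z * conjc (mon p.2 z) * f z).
  by congr Complex; congr fine; apply: integral_ae; apply: ae_ball => z Bz; rewrite /moment cutE.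
have hA : annih nu moment h by split => // p; rewrite cutae.
have set0E E : measurable E -> cint nu setT (fun z => (\1_(clip @^-1` E) z)%:C%C * h z) = 0.
  move=> mE; have [_ [_ a]] := absorbed_clip mE; have [_ /(_ (fun=> 0%N, fun=> 0%N))] := a _ hA.
  by rewrite cutae; under eq_cint do rewrite /= !mon0 rmorph1 !mul1r.
have [h1 h2] := hi; have [m1 m2] := cintegrable_measurable hi.
have zero (f : V -> R) : nu.-integrable setT (EFin \o f) ->
    (forall E, measurable E -> \int[nu]_z (\1_(clip @^-1` E) z * f z) = 0) ->
    ae_eq nu setT (EFin \o f) (cst 0%E).
  move=> fi f0; apply: (integral_ae_eq measurableT fi) => // E _ mE.
  have /measurable_EFinP mf := measurable_int _ fi.
  have := f0 E mE; rewrite -nu_integral_restrict// /Rintegral => H.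
  have fE : (\int[nu]_(z in E) (f z)%:E)%E \is a fin_num.
    by apply: integrable_fin_num => //; exact: integrableS fi.
  by rewrite integral0 -[LHS](fineK fE) H.
have z1 := zero _ h1; have z2 := zero _ h2.
have {}z1 : ae_eq nu setT (EFin \o (fun z => Re (h z))) (cst 0%E).
  apply: z1 => E mE; have /(congr1 (@complex.Re R)) /= <- := set0E E mE.
  by apply: eq_Rintegral => z _; rewrite RecM /= mul0r subr0.
have {}z2 : ae_eq nu setT (EFin \o (fun z => Im (h z))) (cst 0%E).
  apply: z2 => E mE; have /(congr1 (@complex.Im R)) /= <- := set0E E mE.
  by apply: eq_Rintegral => z _; rewrite ImcM /= mul0r addr0.
move: z1 z2; apply: filterS2 => z /= /(_ Logic.I)[a] /(_ Logic.I)[b].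
by apply: complex_eq.
Qed.

End monomials.

(** * Radial multipliers *)

Section complex_integrals.
Context d (T : measurableType d) (R : realType) (mu : {measure set T -> \bar R}).
Implicit Types (f g : T -> R[i]) (D : set T).

Lemma cint_indic D f : cint mu setT (fun x => (\1_D x)%:C%C * f x) = cint mu D f.
Proof.
apply: complex_eq; rewrite /= /Rintegral [in RHS]integral_indic_mul; congr fine;
  apply: eq_integral => x _.
  by rewrite [in LHS]RecM (_ : Re (\1_D x)%:C%C = \1_D x)// (_ : Im (\1_D x)%:C%C = 0)// mul0r subr0.
by rewrite [in LHS]ImcM (_ : Re (\1_D x)%:C%C = \1_D x)// (_ : Im (\1_D x)%:C%C = 0)// mul0r addr0.
Qed.

Lemma cint_ae f g : {ae mu, forall x, f x = g x} -> cint mu setT f = cint mu setT g.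
Proof.
by move=> fg; congr Complex; congr fine; apply: integral_ae; move: fg;
  apply: filterS => x ->.
Qed.

End complex_integrals.

Section complex_fubini.
Context d1 d2 (T1 : measurableType d1) (T2 : measurableType d2) (R : realType).
Variables (m1 : {sigma_finite_measure set T1 -> \bar R}).
Variables (m2 : {sigma_finite_measure set T2 -> \bar R}).

Lemma Rintegral_fubini (f : T1 * T2 -> R) : (m1 \x m2)%E.-integrable setT (EFin \o f) ->
  \int[m1]_x \int[m2]_y f (x, y) = \int[m2]_y \int[m1]_x f (x, y).
Proof.
move=> fi; rewrite /Rintegral; congr fine.
have := Fubini fi.
have i1 := ae_integrable1 fi; have i2 := ae_integrable2 fi.
have <- : (\int[m1]_x \int[m2]_y (EFin \o f) (x, y) = \int[m1]_x (\int[m2]_y f (x, y))%:E)%E.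
  by apply: integral_ae; move: i1; apply: filterS => x h; rewrite /Rintegral fineK//; exact: integrable_fin_num.
have <- // : (\int[m2]_y \int[m1]_x (EFin \o f) (x, y) = \int[m2]_y (\int[m1]_x f (x, y))%:E)%E.
by apply: integral_ae; move: i2; apply: filterS => x h; rewrite /Rintegral fineK//; exact: integrable_fin_num.
Qed.

(** The inner integrals are finite only almost everywhere, but [Rintegral] sends
   infinite values to 0, which does not change the outer integral. *)
Lemma cint_fubini (H : T1 * T2 -> R[i]) : cmeasurable setT H ->
  (\int[m1]_x \int[m2]_y (normc (H (x, y)))%:E < +oo)%E ->
  cint m1 setT (fun x => cint m2 setT (fun y => H (x, y))) =
  cint m2 setT (fun y => cint m1 setT (fun x => H (x, y))).
Proof.
move=> mH Hoo; have [mR mI] := mH; have mN := measurable_normc mH.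
have Ni : (m1 \x m2)%E.-integrable setT (EFin \o (fun p => normc (H p))).
  apply/integrable12ltyP; first exact/measurable_EFinP.
  apply: le_lt_trans Hoo; rewrite le_eqVlt; apply/orP; left; apply/eqP.
  apply: eq_integral => x _; apply: eq_integral => y _ /=.
  by rewrite ger0_norm// normc_ge0.
have le_i (f : T1 * T2 -> R) : measurable_fun setT f -> (forall p, `|f p| <= normc (H p)) ->
    (m1 \x m2)%E.-integrable setT (EFin \o f).
  move=> mf fH; apply: (le_integrable measurableT _ _ Ni); first exact/measurable_EFinP.
  by move=> p _ /=; rewrite lee_fin [leRHS]ger0_norm ?normc_ge0.
apply: complex_eq => /=.
  by apply: (@Rintegral_fubini (fun p => Re (H p))); apply: le_i => // p; exact: le_Re_normc.
by apply: (@Rintegral_fubini (fun p => Im (H p))); apply: le_i => // p; exact: le_Im_normc.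
Qed.

End complex_fubini.

Section fnu.
Context {R : realType} {n : nat}.

(** The measure [nu], under a name to which the finiteness structure required by
   Fubini's theorem can be attached. *)
Definition fnu : set 'rV[R[i]]_n -> \bar R := nu n.

HB.instance Definition _ := Measure.on fnu.

Lemma fnu_fin : fin_num_fun fnu.
Proof. by move=> A mA; rewrite ge0_fin_numE// nu_lty. Qed.

HB.instance Definition _ := Measure_isFinite.Build _ _ _ fnu fnu_fin.

End fnu.

Section dilation.
Context {R : realType} {n : nat}.
Local Notation V := 'rV[R[i]]_n.
Local Notation B := (@uball R n).
Local Notation nu := (@nu R n).
Local Notation T := (measurableTypeR R).
Local Notation mu := (@lebesgue_measure R).
Local Notation circ := (`[0, pi *+ 2]%classic : set T).
Implicit Types (z : V) (v : V -> R[i]) (m : 'I_n -> nat) (t : R).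

Lemma cint_nu_ball (f g : V -> R[i]) : (forall z, B z -> f z = g z) ->
  cint nu setT f = cint nu setT g.
Proof. by move=> fg; apply: cint_ae; exact: ae_ball. Qed.

Lemma A2_cintegrable v : A2 v -> cintegrable nu setT (cut v).
Proof.
move=> /A2_cut vL; have L1 : borelL2 nu (fun=> 1).
  split; first exact: cmeasurable_cst.
  rewrite /sqint; under eq_integral do rewrite ComplexField.Normc.normc1 expr1n.
  by rewrite integral_cst// mul1e nu_setT ltry.
have := ip_integrable vL L1.
by under [X in cintegrable _ _ X -> _]eq_fun do rewrite rmorph1 mulr1.
Qed.

Definition cutconj m : V -> R[i] := cut (fun z => conjc (mon m z)).

Lemma cbounded_cutconj m : cbounded (cutconj m).
Proof.
apply: (@cbounded_cut _ _ _ 1) => //; first exact: cmeasurable_conj (cmeasurable_mon m).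
by move=> z Bz; rewrite normc_conj normc_mon_le1.
Qed.

Lemma uballZ c z : B z -> normc c <= 1 -> B (c *: z).
Proof.
rewrite /uball /= enormZ => Bz c1; apply: le_lt_trans Bz.
by rewrite ler_piMl// enorm_ge0.
Qed.

(** Averaging over the rotations [z |-> cis y *: z], which preserve [nu]. *)
Lemma circ_avg c v m t : A2 v -> 0 < t -> t <= 1 ->
  (pi *+ 2)%:C%C * cint nu setT (fun z => c * (cutconj m z * cut v (t%:C%C *: z))) =
  cint nu setT (fun z => c * conjc (mon m z) * circint (fun x => v (0 + x *: z)) (deg m) t).
Proof.
move=> Av t0 t1; set p := cutconj m; set u := fun z => c * (p z * cut v (t%:C%C *: z)).
have pi0 : 0 <= pi *+ 2 :> R by rewrite mulrn_wge0// pi_ge0.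
have mI : measurable circ by exact: measurable_itv.
have bp := cbounded_cutconj m; have mp : cmeasurable setT p := bp.1.
have vi := A2_cintegrable Av; have mv := cintegrable_measurable vi.
have [vti _] := cint_nu_scale t0 t1 mv vi.
have ui : cintegrable nu setT u by apply: cintegrableZ => //; exact: cintegrableM.
have mu_ : cmeasurable setT u := cintegrable_measurable ui.
pose H (q : T * V) : R[i] := (\1_circ q.1)%:C%C * u (cis q.1 *: q.2).
have mr : measurable_fun setT (fun q : T * V => cis q.1 *: q.2).
  by have := @measurable_rotate R n 0; under eq_fun do rewrite add0r.
have mH : cmeasurable setT H.
  apply: cmeasurableM; last exact: cmeasurable_comp mr mu_.
  apply: cmeasurable_real.
  exact: (measurableT_comp (measurable_indic mI) measurable_fst).
have m1 : measurable_fun setT (fun y : T => (\1_circ y : R)%:E).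
  by apply/measurable_EFinP; exact: measurable_indic.
have int1 : (\int[mu]_y (\1_circ y)%:E = (pi *+ 2)%:E)%E.
  rewrite (integral_indic _ measurableT mI) setIT.
  by have := lebesgue_segment pi0; rewrite subr0.
have mnu : measurable_fun setT (fun z => (normc (u z))%:E).
  by apply/measurable_EFinP; exact: measurable_normc.
have Hoo : (\int[mu]_y \int[fnu]_z (normc (H (y, z)))%:E < +oo)%E.
  have E y : (\int[nu]_z (normc (H (y, z)))%:E =
      (\1_circ y)%:E * (\int[nu]_z normc (u z))%:E)%E.
    transitivity (\int[nu]_z ((\1_circ y)%:E * (normc (u (cis y *: z)))%:E))%E.
      apply: eq_integral => z _; rewrite /H /= normcM normc_real ger0_norm ?EFinM//.
    have N0 z : (0 <= (normc (u z))%:E)%E by rewrite lee_fin normc_ge0.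
    rewrite ge0_integralZl//; last exact: (measurableT_comp mnu (measurableT_comp mr (pair1_measurable y))).
    have := ge0_integral_nu_rot (normc_cis y) mnu N0; rewrite mul1e => <-.
    by rewrite /Rintegral fineK//; apply: integrable_fin_num => //; exact: cintegrable_normc.
  under eq_integral do rewrite E.
  rewrite ge0_integralZr//; last by rewrite lee_fin; apply: Rintegral_ge0 => z _; exact: normc_ge0.
  by rewrite int1 -EFinM ltry.
have := cint_fubini (m1 := mu) (m2 := fnu) mH Hoo.
set J := cint nu setT u.
have EL : cint mu setT (fun y => cint fnu setT (fun z => H (y, z))) = (pi *+ 2)%:C%C * J.
  transitivity (cint mu setT (fun y => J * (\1_circ y)%:C%C)).
    apply: eq_cint => y _; have [ri E] := cint_nu_rot (normc_cis y) mu_ ui.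
    by rewrite mulrC /J E -(cintZ measurableT _ ri).
  have i1 : mu.-integrable setT (EFin \o (\1_circ : T -> R)).
    apply/integrableP; split => //.
    by under eq_integral do rewrite gee0_abs ?lee_fin//; rewrite int1 ltry.
  rewrite cintZ//; last exact: cintegrable_real.
  by rewrite cint_real// /Rintegral int1 mulrC.
rewrite EL => ->; apply: cint_nu_ball => z Bz.
transitivity (cint mu circ (fun y => c * conjc (mon m z) *
    (v (0 + (t%:C%C * cis y) *: z) * conjc (cis y) ^+ deg m))).
  rewrite -[RHS]cint_indic; apply: eq_cint => y _; rewrite /H /=; congr (_ * _).
  have Bc : B (cis y *: z) by apply: uballZ => //; rewrite normc_cis.
  rewrite /u /p /cutconj !cutE//.
    have -> : conjc (mon m (cis y *: z)) = conjc (cis y) ^+ deg m * conjc (mon m z).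
      by rewrite monZ rmorphM rmorphXn.
    rewrite add0r scalerA.
    by rewrite -!mulrA; congr (c * _); rewrite mulrC -mulrA; congr (_ * _).
  by apply: uballZ => //; rewrite normc_real ger0_norm// ltW.
rewrite cintZ//; apply: (@circle_integrable _ (fun x => v (0 + x *: z)) _ _ t0) => y.
apply: holomorphic_line Av.1 _; rewrite add0r; apply: uballZ => //.
by rewrite normcM normc_cis mulr1 normc_real gtr0_norm.
Qed.

(** For fixed [z] the circle averages of [circ_avg] are Taylor coefficients of the
   holomorphic function [x |-> v (x *: z)], hence homogeneous in [t]. *)
Lemma cint_dilate v m t : A2 v -> 0 < t -> t <= 1 ->
  cint nu setT (fun z => cutconj m z * cut v (t%:C%C *: z)) =
  (t ^+ deg m)%:C%C * cint nu setT (fun z => cutconj m z * cut v z).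
Proof.
move=> Av t0 t1.
have piN : (pi *+ 2)%:C%C != 0 :> R[i].
  by rewrite eq_complex /= eqxx andbT mulrn_eq0 /= gt_eqF// pi_gt0.
have wi s : 0 < s -> s <= 1 ->
    cintegrable nu setT (fun z => cutconj m z * cut v (s%:C%C *: z)).
  move=> s0 s1; apply: cintegrableM; first exact: cbounded_cutconj.
  have vi := A2_cintegrable Av.
  by have [] := cint_nu_scale s0 s1 (cintegrable_measurable vi) vi.
have -> : cint nu setT (fun z => cutconj m z * cut v z) =
    cint nu setT (fun z => cutconj m z * cut v (1%:C%C *: z)).
  by apply: eq_cint => z _; rewrite scale1r.
rewrite -[LHS]mul1r -(cintZ measurableT 1 (wi _ t0 t1)).
rewrite -(cintZ measurableT _ (wi _ ltr01 (lexx 1))).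
apply: (mulfI piN).
have E1 := circ_avg 1 m Av t0 t1.
have E2 := circ_avg (t ^+ deg m)%:C%C m Av ltr01 (lexx 1).
apply: etrans E1 _; apply: etrans _ (esym E2).
apply: cint_nu_ball => z Bz.
rewrite mul1r mulrAC [RHS]mulrC; congr (_ * _).
have z0 : 0 <= enorm z by exact: enorm_ge0.
have z1 : 0 < 1 + enorm z by rewrite ltr_wpDr.
have rho1 : 1 < 2 / (1 + enorm z).
  by rewrite ltr_pdivlMr// mul1r -[2]/(1 + 1) ltrD2l.
have := @circint_homogeneous R (fun x => v (0 + x *: z)) (deg m) t 1 _ t0 t1 rho1.
rewrite expr1n mul1r; apply => x hx; apply: holomorphic_line Av.1 _.
rewrite add0r /uball /= enormZ.
have [->|zN] := eqVneq (enorm z) 0; first by rewrite mulr0.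
have zp : 0 < enorm z by rewrite lt_neqAle eq_sym zN.
apply: (@lt_le_trans _ _ (2 / (1 + enorm z) * enorm z)); first by rewrite ltr_pM2r.
by rewrite mulrAC ler_pdivrMr// mul1r mulr2n mulrDl mul1r lerD2r ltW.
Qed.

End dilation.

Section radial_mean.
Context {R : realType} {n : nat}.
Local Notation V := 'rV[R[i]]_n.
Local Notation B := (@uball R n).
Local Notation nu := (@nu R n).
Implicit Types (z : V) (v : V -> R[i]) (m : 'I_n -> nat) (t : R).

Definition disc t : set V := [set z | enorm z < t].
Definition wdisc t z : R[i] := (\1_(disc t) z)%:C%C.

Lemma disc1E z : B z -> \1_(disc 1) z = 1 :> R.
Proof. by move=> Bz; rewrite indicE mem_set. Qed.

Lemma disc_ind t z : \1_(disc t) z = (enorm z < t)%R%:R :> R.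
Proof.
rewrite indicE; have [zt|zt] := boolP (enorm z < t); first by rewrite mem_set.
by rewrite memNset//; exact/negP.
Qed.

Lemma cbounded_wdisc t : cbounded (wdisc t).
Proof.
split; first by apply: cmeasurable_real; apply: measurable_indic; exact: measurable_ball.
by exists 1 => z; rewrite normc_real indicE; case: (_ \in _); rewrite ?normr1 ?normr0.
Qed.

Lemma wdiscM s t z : wdisc s z * wdisc t z = wdisc (Num.min s t) z.
Proof.
by rewrite /wdisc -rmorphM !disc_ind -natrM mulnb lt_min.
Qed.

Lemma absorbs_radial (phi : R -> R[i]) : cbounded phi ->
  absorbs nu wdisc (fun z => phi (enorm z)).
Proof.
move=> [[m1 m2] [K hK]]; have wb := cbounded_wdisc.
have aw t : absorbs nu wdisc (wdisc t).
  by apply: absorbs_family => // s s'; exists (Num.min s s') => z; exact: wdiscM.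
have ad t : absorbed nu wdisc [set z | enorm z < t].
  by split; [exact: measurable_ball|exact: aw].
have a1 : rabsorbs nu wdisc (fun z => Re (phi (enorm z))).
  apply: (rabsorbs_borel wb ad m1 (K := K)) => x.
  by apply: le_trans (hK x); exact: le_Re_normc.
have a2 : rabsorbs nu wdisc (fun z => Im (phi (enorm z))).
  apply: (rabsorbs_borel wb ad m2 (K := K)) => x.
  by apply: le_trans (hK x); exact: le_Im_normc.
have := absorbsD wb a1 (absorbsM (absorbs_cst nu wb (Complex 0 1)) a2).
suff -> : (fun z => phi (enorm z)) = (fun z => (Re (phi (enorm z)))%:C%C +
  Complex 0 1 * (Im (phi (enorm z)))%:C%C) by [].
apply/funext => z; apply: complex_eq; rewrite !(RecD, ImcD, RecM, ImcM) /=; ring.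
Qed.

Lemma annih_disc q : cintegrable nu setT q ->
  (forall t, 0 < t -> t <= 1 -> cint nu (disc t) q = 0) -> annih nu wdisc q.
Proof.
move=> qi q0; split => // t; rewrite cint_indic.
have [t0|t0] := leP t 0.
  rewrite -cint_indic (_ : (fun z => _) = (fun=> 0)); last first.
    apply/funext => z; rewrite indicE memNset ?mul0r// /disc /= => h.
    by have := le_lt_trans (enorm_ge0 z) h; rewrite ltNge t0.
  by apply: complex_eq; rewrite /= Rintegral_cst// mul0r.
have [t1|t1] := leP t 1; first exact: q0.
rewrite -(q0 1 ltr01 (lexx 1)) -[LHS]cint_indic -[RHS]cint_indic; apply: cint_nu_ball => z Bz.
by rewrite disc1E// indicE mem_set//; exact: lt_trans t1.
Qed.

Definition epow l : V -> R[i] := cut (fun z => (enorm z ^+ (2 * l))%:C%C).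

Lemma cbounded_epow l : cbounded (epow l).
Proof.
apply: (@cbounded_cut _ _ _ 1) => //.
  by apply: cmeasurable_real; apply: measurable_funX; exact: measurable_enorm.
move=> z Bz; rewrite normc_real ger0_norm ?exprn_ge0 ?enorm_ge0//.
by rewrite exprn_ile1 ?enorm_ge0// ltW.
Qed.

Lemma cbounded_cintegrable (f : V -> R[i]) : cbounded f -> cintegrable nu setT f.
Proof.
move=> [mf [K hK]]; apply: (cintegrable_bounded measurableT _ mf (fun z _ => hK z)).
by rewrite nu_setT ltry.
Qed.

Lemma disc_epow l t : 0 < t -> t <= 1 ->
  cint nu (disc t) (epow l) = (t ^+ (2 * n + 2 * l))%:C%C * cint nu setT (epow l).
Proof.
move=> t0 t1; have ei := cbounded_cintegrable (@cbounded_epow l).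
have [_ ->] := cint_nu_scale t0 t1 (cbounded_epow l).1 ei.
rewrite exprD rmorphM -mulrA -(cintZ measurableT _ ei); congr (_ * _).
apply: cint_nu_ball => z Bz; rewrite /epow !cutE//.
  by rewrite enormZ normc_real ger0_norm ?(ltW t0)// exprMn rmorphM.
by apply: uballZ => //; rewrite normc_real ger0_norm// ltW.
Qed.

Lemma disc_cutconj v m t : A2 v -> 0 < t -> t <= 1 ->
  cint nu (disc t) (fun z => cutconj m z * cut v z) =
  (t ^+ (2 * n + 2 * deg m))%:C%C * cint nu setT (fun z => cutconj m z * cut v z).
Proof.
move=> Av t0 t1; have bp := @cbounded_cutconj R n m; have vi := A2_cintegrable Av.
have pvi : cintegrable nu setT (fun z => cutconj m z * cut v z) by exact: cintegrableM.
have [_ ->] := cint_nu_scale t0 t1 (cintegrable_measurable pvi) pvi.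
rewrite exprD rmorphM -mulrA; congr (_ * _).
rewrite mul2n -addnn exprD rmorphM -mulrA -cint_dilate//.
have [vti _] := cint_nu_scale t0 t1 (cintegrable_measurable vi) vi.
rewrite -(cintZ measurableT _ (cintegrableM bp vti)).
apply: cint_nu_ball => z Bz; rewrite mulrA; congr (_ * _).
rewrite /cutconj !cutE//.
  have tE : t%:C%C ^+ deg m = (t ^+ deg m)%:C%C :> R[i] by rewrite rmorphXn.
  by rewrite monZ tE rmorphM; congr (_ * _); exact: conjc_real.
by apply: uballZ => //; rewrite normc_real ger0_norm// ltW.
Qed.

Definition radint l : R[i] := cint nu setT (epow l).

Definition radmean (phi : R -> R[i]) l : R[i] := cint nu setT (fun z => phi (enorm z) * epow l z).

(** Over the ball of radius [t], both [z |-> v z * conjc (z ^ m)] and a suitable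
   multiple of [z |-> enorm z ^+ (2 * deg m)] integrate to the same multiple of
   [t ^+ (2 * n + 2 * deg m)]; so radial functions do not distinguish them. *)
Lemma radial_meanE v m (phi : R -> R[i]) : A2 v -> cbounded phi ->
  radint (deg m) * cint nu setT (fun z => phi (enorm z) * (cutconj m z * cut v z)) =
  cint nu setT (fun z => cutconj m z * cut v z) * radmean phi (deg m).
Proof.
move=> Av bphi; have bp := @cbounded_cutconj R n m; have vi := A2_cintegrable Av.
have pvi : cintegrable nu setT (fun z => cutconj m z * cut v z) by exact: cintegrableM.
set S := radint _; set C := cint nu setT (fun z => cutconj m z * cut v z).
have ei := cbounded_cintegrable (cbounded_epow (deg m)).
have i1 := cintegrableZ measurableT S pvi; have i2 := cintegrableZ measurableT C ei.
pose q z := S * (cutconj m z * cut v z) - C * epow (deg m) z.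
have qi : cintegrable nu setT q by exact: cintegrableB.
have bf : cbounded (fun z : V => phi (enorm z)).
  case: bphi => mphi [K hK]; split; last by exists K.
  exact: cmeasurable_comp (@measurable_enorm R n) mphi.
have qA : annih nu wdisc q.
  apply: annih_disc => // t t0 t1.
  have mD : measurable (disc t) by exact: measurable_ball.
  have rs (f : V -> R[i]) : cintegrable nu setT f -> cintegrable nu (disc t) f.
    by move=> [f1 f2]; split; [exact: integrableS f1|exact: integrableS f2].
  rewrite /q cintB//; [|exact: rs|exact: rs].
  rewrite (cintZ mD _ (rs _ pvi)) (cintZ mD _ (rs _ ei)) disc_epow// disc_cutconj//.
  by rewrite -/C -/(radint (deg m)) -/S; ring.
have [_ a] := absorbs_radial bphi; have [_ /(_ 1)] := a _ qA.
have -> : cint nu setT (fun z => wdisc 1 z * (phi (enorm z) * q z)) =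
    cint nu setT (fun z => S * (phi (enorm z) * (cutconj m z * cut v z)) -
      C * (phi (enorm z) * epow (deg m) z)).
  by apply: cint_nu_ball => z Bz; rewrite /wdisc disc1E// mul1r /q; ring.
have j1 := cintegrableM bf pvi; have j2 := cintegrableM bf ei.
rewrite cintB//; [|exact: cintegrableZ|exact: cintegrableZ].
by rewrite (cintZ measurableT _ j1) (cintZ measurableT _ j2) => /eqP; rewrite subr_eq0 => /eqP.
Qed.

End radial_mean.

Lemma integral_indicT d (X : measurableType d) (R : realType)
    (m : {measure set X -> \bar R}) (A : set X) : measurable A ->
  (\int[m]_z (\1_A z)%:E = m A)%E.
Proof. by move=> mA; rewrite integral_indic// setIT. Qed.

Section dilation_null.
Context {R : realType} {n : nat}.
Local Notation V := 'rV[R[i]]_n.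
Local Notation B := (@uball R n).
Local Notation nu := (@nu R n).
Local Notation T := (measurableTypeR R).
Local Notation mu := (@lebesgue_measure R).
Local Notation pos := (`]0, +oo[%classic : set T).
Implicit Types (A : set V) (z : V) (t : R).

Lemma measurable_dilate : measurable_fun setT (fun q : T * V => q.1%:C%C *: q.2).
Proof.
apply: measurable_fun_Cn => j; have [mx my] := measurable_coord (R := R) (n := n) j.
have mx' : measurable_fun setT (fun p : T * V => Re (p.2 0 j)).
  exact: (measurableT_comp mx measurable_snd).
have my' : measurable_fun setT (fun p : T * V => Im (p.2 0 j)).
  exact: (measurableT_comp my measurable_snd).
apply: measurable_fun_pair.
  under eq_fun do rewrite /= mxE RecM /= mul0r subr0; exact: measurable_funM.
by under eq_fun do rewrite /= mxE ImcM /= mul0r addr0; exact: measurable_funM.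
Qed.

Lemma pos_ind t : \1_pos t = (0 < t)%R%:R :> R.
Proof.
rewrite indicE; have [h|h] := boolP (0 < t); first by rewrite mem_set//= in_itv /= h.
by rewrite memNset//= in_itv /= (negbTE h).
Qed.

(** The integral of [ray A] over [t] is the length of the part of the open half-line
   through [z] that lies in [A], in the parametrization [t |-> t *: z]. *)
Definition ray A (q : T * V) : \bar R := (\1_pos q.1 * \1_A (q.1%:C%C *: q.2))%:E.

Lemma ray_ge0 A q : (0 <= ray A q)%E.
Proof. by rewrite lee_fin mulr_ge0// indicE ler0n. Qed.

Lemma measurable_ray A : measurable A -> measurable_fun setT (ray A).
Proof.
move=> mA; apply/measurable_EFinP; apply: measurable_funM.
  by apply: (measurableT_comp (measurable_indic _) measurable_fst) => //; exact: measurable_itv.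
exact: (measurableT_comp (measurable_indic mA) measurable_dilate).
Qed.

Lemma leb_dilate A t : measurable A -> 0 < t ->
  leb n A = (((t ^+ 2) ^+ n)%:E * \int[leb n]_z (\1_A (t%:C%C *: z))%:E)%E.
Proof.
move=> mA t0; have tN : t%:C%C != 0 :> R[i] by rewrite eq_complex /= eqxx andbT gt_eqF.
have mi : measurable_fun setT (fun z : V => (\1_A z : R)%:E).
  by apply/measurable_EFinP; exact: measurable_indic.
rewrite -(integral_indicT (leb n) mA).
rewrite (integral_affine_Cn 0 tN mi); last by move=> z; rewrite lee_fin indicE ler0n.
rewrite normc_real gtr0_norm//; congr (_ * _)%E.
by apply: eq_integral => z _; rewrite addr0.
Qed.

Lemma ray_inner A t : measurable A -> 0 < t ->
  (\int[leb n]_z ray A (t, z) = \int[leb n]_z (\1_A (t%:C%C *: z))%:E)%E.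
Proof.
move=> mA t0; by apply: eq_integral => z _; rewrite /ray pos_ind t0 mul1r.
Qed.

Lemma ray_swap A : measurable A ->
  (\int[mu]_t \int[leb n]_z ray A (t, z) = \int[leb n]_z \int[mu]_t ray A (t, z))%E.
Proof.
by move=> mA; exact: (fubini_tonelli (m1 := mu) _ (measurable_ray mA) (ray_ge0 A)).
Qed.

(** Polar coordinates without spheres: dilations multiply Lebesgue measure by a
   constant, so by Tonelli a set is null if and only if almost every ray meets it in
   a null set. This lemma and [ray_null] are the two directions. *)
Lemma null_ray A : measurable A -> leb n A = 0%E ->
  {ae leb n, forall z, (\int[mu]_t ray A (t, z) = 0)%E}.
Proof.
move=> mA A0.
have mG : measurable_fun setT (fun z => \int[mu]_t ray A (t, z))%E.
  exact: (measurable_fun_fubini_tonelli_G (m1 := mu) _ (measurable_ray mA) (ray_ge0 A)).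
have /(ae_eq_integral_abs _ measurableT mG) : (\int[leb n]_z `|\int[mu]_t ray A (t, z)| = 0)%E.
  transitivity (\int[leb n]_z \int[mu]_t ray A (t, z))%E.
    apply: eq_integral => z _; rewrite gee0_abs//.
    by apply: integral_ge0 => t _; exact: ray_ge0.
  rewrite -ray_swap//; apply: integral0_eq => t _.
  have [t0|t0] := ltP 0 t.
    rewrite ray_inner//; have := leb_dilate mA t0; rewrite A0 => /esym/eqP.
    rewrite mule_eq0 => /orP[|/eqP//]; rewrite eqe => /eqP h.
    by have := exprn_gt0 n (exprn_gt0 2 t0); rewrite h ltxx.
  by apply: integral0_eq => z _; rewrite /ray /= pos_ind ltNge t0 mul0r.
by apply: filterS => z /(_ Logic.I).
Qed.

Lemma ray_null A : measurable A -> (forall z, \int[mu]_t ray A (t, z) = 0)%E -> leb n A = 0%E.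
Proof.
move=> mA A0; have : (\int[mu]_t \int[leb n]_z ray A (t, z) = 0)%E.
  by rewrite ray_swap//; apply: integral0_eq => z _; exact: A0.
pose J : set T := `]0, 1]%classic; have mJ : measurable J by exact: measurable_itv.
have J1 : (\int[mu]_t ((\1_J t)%:E * leb n A) = leb n A)%E.
  rewrite ge0_integralZr//; last by apply/measurable_EFinP; exact: measurable_indic.
  rewrite (integral_indic _ measurableT mJ) setIT.
  have muJ : mu J = 1%E.
    by rewrite lebesgue_measure_itv /= lte_fin ltr01 oppr0 adde0.
  by rewrite [X in (X * _)%E](_ : _ = 1%E) ?mul1e.
move=> I0; apply/eqP; rewrite eq_le measure_ge0 andbT -[leLHS]J1 -[leRHS]I0.
apply: ge0_le_integral => //.
- by move=> t _; apply: mule_ge0 => //; rewrite lee_fin indicE ler0n.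
- by apply: emeasurable_funM => //; apply/measurable_EFinP; exact: measurable_indic.
- apply: (measurable_fun_fubini_tonelli_F (m2 := leb n) (ray A)); last exact: ray_ge0.
  exact: measurable_ray.
move=> t _; rewrite indicE; have [tJ|tJ] := pselect (J t); last first.
  by rewrite memNset// mul0e; apply: integral_ge0 => z _; exact: ray_ge0.
rewrite mem_set// mul1e; move: tJ; rewrite /J /= in_itv /= => /andP[t0 t1].
have I0' : (0 <= \int[leb n]_z (\1_A (t%:C%C *: z))%:E)%E.
  by apply: integral_ge0 => z _; rewrite lee_fin indicE ler0n.
rewrite ray_inner// (leb_dilate mA t0) -[leRHS]mul1e; apply: lee_wpmul2r => //.
by rewrite lee_fin exprn_ile1 ?exprn_ge0 ?exprn_ile1// ltW.
Qed.

(** Halving the radius leaves this set unchanged and divides its measure by [4 ^ n]. *)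
Lemma leb_origin : (0 < n)%N -> leb n [set z : V | enorm z = 0] = 0%E.
Proof.
move=> n0; set Z := [set z : V | _].
have mZ : measurable Z.
  rewrite (_ : Z = @enorm R n @^-1` [set 0])//.
  by rewrite -[X in measurable X]setTI; apply: measurable_enorm.
have h0 : 0 < 1 / 2 :> R by [].
have := leb_dilate mZ h0.
have -> : (\int[leb n]_z (\1_Z ((1 / 2)%:C%C *: z))%:E = leb n Z)%E.
  rewrite -(integral_indicT (leb n) mZ).
  apply: eq_integral => z _; congr (_%:E); rewrite !indicE; congr ((nat_of_bool _)%:R).
  apply/idP/idP; rewrite !inE /Z /= enormZ normc_real gtr0_norm//.
    by move/eqP; rewrite mulf_eq0 => /orP[|/eqP//]; rewrite gt_eqF.
  by move=> ->; rewrite mulr0.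
have Zoo : leb n Z \is a fin_num.
  rewrite ge0_fin_numE//; apply: le_lt_trans (leb_uball_lty n).
  by apply: le_measure; rewrite ?inE//; [exact: measurable_uball|move=> z; rewrite /Z /uball /= => ->].
rewrite -(fineK Zoo) -EFinM => -[E]; congr (_%:E); apply/eqP.
move/eqP: E; rewrite -subr_eq0 -[X in X - _]mul1r -mulrBl mulf_eq0 => /orP[|//].
rewrite subr_eq0 -exprM => /eqP E1; have : (1 / 2 : R) ^+ (2 * n) < 1.
  have h1 : 1 / 2 < 1 :> R by lra.
  by rewrite (exprn_ilt1 _ (ltW h0) h1) muln_eq0 /= -lt0n.
by rewrite -E1 ltxx.
Qed.

Lemma nu_null A : measurable A -> leb n A = 0%E -> {ae nu, forall z, ~ A z}.
Proof.
move=> mA A0; exists A; split => //; last by move=> z /= /contrapT.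
transitivity ((volB n)%:num^-1%:E * leb n (A `&` B))%E; first by [].
have -> : leb n (A `&` B) = 0%E; last by rewrite mule0.
apply/eqP; rewrite eq_le measure_ge0 andbT -A0.
by apply: le_measure; rewrite ?inE//; apply: measurableI => //; exact: measurable_uball.
Qed.

(** A radial function that is measurable for the completed sigma-algebra is a.e. a
   Borel function of the radius: on almost every ray it agrees a.e. with a given
   Borel version, and one such ray determines it. *)
Lemma radial_borel (g : V -> R[i]) : (0 < n)%N -> lebesgue_measurable g ->
  bounded_on_ball g -> radial g ->
  exists2 phi : R -> R[i], cbounded phi & {ae nu, forall z, g z = phi (enorm z)}.
Proof.
move=> n0 [g0 [mg1 mg2 [N [mN N0 gg0]]]] [K gK] [ft gft].
have mg0 : cmeasurable setT g0 by split.
have mB : measurable B := @measurable_uball R n.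
pose A := N `&` B; have mA : measurable A by exact: measurableI.
have A0 : leb n A = 0%E.
  have : ((volB n)%:num^-1%:E * leb n A = 0)%E by exact: N0.
  move/eqP; rewrite mule_eq0 => /orP[|/eqP//]; rewrite eqe invr_eq0 => /eqP h.
  by have := @volB_gt0 R n; move: h => -> /=; rewrite ltxx.
have mZ : measurable [set z : V | enorm z = 0].
  rewrite (_ : [set z | _] = @enorm R n @^-1` [set 0])//.
  by rewrite -[X in measurable X]setTI; apply: measurable_enorm.
have [z0 z0N zA] : exists2 z0 : V, enorm z0 != 0 & (\int[mu]_t ray A (t, z0) = 0)%E.
  have [N1 [mN1 N10 sub1]] := null_ray mA A0.
  apply: contrapT => nex; have : B `<=` N1 `|` [set z | enorm z = 0].
    move=> z _; have [zz|zN] := eqVneq (enorm z) 0; first by right.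
    by left; apply: sub1 => /= zz; apply: nex; exists z.
  move=> BN; have := @leb_uball_gt0 R n.
  rewrite ltNge => /negP; apply; apply: (@le_trans _ _ (leb n (N1 `|` [set z | enorm z = 0]))).
    by apply: le_measure; rewrite ?inE//; exact: measurableU.
  by rewrite (le_trans (measureU2 _ _ _))//= ?N10 ?leb_origin ?adde0.
pose r0 := enorm z0; have r0p : 0 < r0 by rewrite lt_neqAle eq_sym z0N enorm_ge0.
pose y (s : T) : V := (s / r0)%:C%C *: z0.
have yE s : 0 <= s -> enorm (y s) = s.
  move=> s0; rewrite /y enormZ normc_real ger0_norm ?divr_ge0 ?(ltW r0p)//.
  by rewrite divfK// gt_eqF.
have my : measurable_fun setT y.
  have := measurableT_comp measurable_dilate (pair2_measurable z0) => m1.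
  have m2 : measurable_fun setT (fun s : T => s / r0).
    by apply: measurable_funM => //; exact: measurable_cst.
  exact: (measurableT_comp m1 m2).
have mgy : cmeasurable setT (fun s : T => g0 (y s)) by exact: cmeasurable_comp my mg0.
pose E := [set s : T | normc (g0 (y s)) <= K].
have mE : measurable E.
  rewrite (_ : E = (fun s : T => normc (g0 (y s))) @^-1` `]-oo, K]).
    by rewrite -[X in measurable X]setTI; apply: (measurable_normc mgy).
  by apply/seteqP; split => z /=; rewrite in_itv.
exists (fun s : T => (\1_E s)%:C%C * g0 (y s)).
  split; first by apply: cmeasurableM => //; apply: cmeasurable_real; exact: measurable_indic.
  exists `|K| => s; rewrite normcM normc_real indicE.
  have [sE|sE] := pselect (E s); last by rewrite memNset// normr0 mul0r.
  by rewrite mem_set// normr1 mul1r; apply: le_trans (ler_norm K).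
pose C := [set z : V | enorm z != 0] `&` (fun z : V => y (enorm z)) @^-1` A.
have mC : measurable C.
  apply: measurableI; last first.
    rewrite -[X in measurable X]setTI; exact: (measurableT_comp my (@measurable_enorm R n)).
  rewrite (_ : [set z | _] = ~` [set z : V | enorm z = 0]); first exact: measurableC.
  by apply/seteqP; split => z /= /eqP.
have C0 : leb n C = 0%E.
  apply: ray_null => // z; have [zz|zN] := eqVneq (enorm z) 0.
    apply: integral0_eq => t _; rewrite /ray /= [\1_C _]indicE memNset ?mulr0//.
    by rewrite /C /= enormZ zz mulr0 => -[/eqP].
  pose a := enorm z / r0; have a0 : 0 < a by rewrite divr_gt0// lt_neqAle eq_sym zN enorm_ge0.
  have mf : measurable_fun setT (fun t : T => ray A (t, z0)).
    exact: (measurableT_comp (measurable_ray mA) (pair2_measurable z0)).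
  have Ea := @integral_affine_R R a 0 _ (lt0r_neq0 a0) mf (fun t => ray_ge0 A _).
  have /eqP : (`|a|%:E * \int[mu]_t ray A ((a * t + 0)%R, z0) = 0)%E by exact: etrans (esym Ea) zA.
  rewrite mule_eq0 => /orP[|/eqP H].
    by rewrite eqe normr_eq0 => /eqP h; move: a0; rewrite h ltxx.
  rewrite -[RHS]H; apply: eq_integral => t _; rewrite addr0.
  have [t0|t0] := ltP 0 t; last first.
    by rewrite /ray !pos_ind /= pmulr_rgt0// ltNge t0 !mul0r.
  rewrite /ray !pos_ind /= pmulr_rgt0// t0 !mul1r; congr (_%:E); rewrite !indicE; congr ((nat_of_bool _)%:R).
  have yt : y (enorm (t%:C%C *: z)) = (a * t)%:C%C *: z0.
    rewrite /y enormZ normc_real gtr0_norm//; congr (_%:C%C *: _).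
    by rewrite /a; ring.
  apply/idP/idP; rewrite !in_setE /C /preimage /= yt; first by case.
  by split => //; rewrite enormZ normc_real mulf_neq0// normr_eq0 gt_eqF.
move: (nu_null mZ (leb_origin n0)) (nu_null mC C0).
have : {ae nu, forall z, B z} by apply: ae_ball.
apply: filterS3 => z Bz zN zC.
have Byz : B (y (enorm z)) by rewrite /uball /= yE ?enorm_ge0.
have yA : ~ N (y (enorm z)).
  by move=> h; apply: zC; split; [exact/eqP|split].
have gy : g (y (enorm z)) = g0 (y (enorm z)).
  by apply: contrapT => h; apply: yA; apply: gg0.
have gz : g z = g (y (enorm z)) by rewrite !gft// yE ?enorm_ge0.
rewrite gz gy indicE mem_set ?rmorph1 ?mul1r//.
by rewrite /E /= -gy; exact: gK.
Qed.

End dilation_null.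

(** * Zero sets of radial eigenvalues *)

Section harmonic_sums.
Context {R : realType}.
Implicit Types (P Q : pred nat) (a : nat).

(** These sets of exponents form an ideal, invariant under shifts, that does not
   contain the set of all exponents. *)
Definition bounded_sum P := exists C : R, forall K,
  \sum_(0 <= l < K | P l) (l.+1%:R^-1 : R) <= C.

Lemma sparse_bounded P : ~ divergent (R := R) P -> bounded_sum P.
Proof.
move=> nd; apply: contrapT => nb; apply: nd => C.
apply: contrapT => nex; apply: nb; exists C => K.
by rewrite leNgt; apply/negP => h; apply: nex; exists K; exact: ltW.
Qed.

Lemma le_bounded_sum P Q : (forall l, P l -> Q l) -> bounded_sum Q -> bounded_sum P.
Proof.
move=> PQ [C hC]; exists C => K; apply: le_trans (hC K).
rewrite big_mkcond [leRHS]big_mkcond /=; apply: ler_sum => l _.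
by case: ifPn => [/PQ ->//|_]; case: ifP => // _; rewrite invr_ge0.
Qed.

Lemma bounded_sumU P Q : bounded_sum P -> bounded_sum Q -> bounded_sum (fun l => P l || Q l).
Proof.
move=> [C hC] [D hD]; exists (C + D) => K; apply: le_trans (lerD (hC K) (hD K)).
rewrite big_mkcond [X in _ <= X + _]big_mkcond [X in _ <= _ + X]big_mkcond /= -big_split /=.
apply: ler_sum => l _; have l0 : 0 <= (l.+1%:R^-1 : R) by rewrite invr_ge0.
by case: (P l); case: (Q l) => /=; rewrite ?addr0 ?add0r ?lerDl.
Qed.

(** Shifting costs a factor [a.+1], since [(a + l).+1 <= a.+1 * l.+1]. *)
Lemma bounded_sum_shift P a : bounded_sum P -> bounded_sum (fun l => P (a + l)%N).
Proof.
move=> [C hC]; exists (a.+1%:R * C) => K.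
apply: (@le_trans _ _ (a.+1%:R * \sum_(0 <= l < K | P (a + l)%N) ((a + l).+1%:R^-1 : R))).
  rewrite mulr_sumr; apply: ler_sum => l _.
  rewrite ler_pdivlMr// mulrC ler_pdivrMr// -natrM ler_nat.
  by rewrite mulSn mulnS addSn ltnS addnA [(l + a)%N]addnC leq_addr.
rewrite ler_wpM2l//; apply: le_trans (hC (a + K)%N).
elim: K => [|K IH]; first by rewrite big_geq// sumr_ge0// => l _; rewrite invr_ge0.
move: IH; rewrite big_mkcond [leRHS]big_mkcond addnS => IH.
by rewrite big_mkcond [leRHS]big_mkcond !big_nat_recr//= lerD2r.
Qed.

Lemma divergentC P : bounded_sum P -> divergent (R := R) (fun l => ~~ P l).
Proof.
move=> bP; apply: contrapT => /sparse_bounded bN.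
have [C hC] := bounded_sumU bP bN.
apply: (@dvg_harmonic R); apply: nondecreasing_is_cvgn.
  apply/nondecreasing_seqP => k; rewrite /series /= big_nat_recr//= lerDl.
  by rewrite invr_ge0.
exists C => _ [k _ <-]; apply: le_trans (hC k).
rewrite /series /= [leRHS](eq_bigl xpredT)//.
by move=> l; rewrite orbN.
Qed.

End harmonic_sums.

Section radial_zeros.
Context {R : realType} {n : nat}.
Local Notation V := 'rV[R[i]]_n.
Local Notation B := (@uball R n).
Local Notation nu := (@nu R n).
Implicit Types (z : V) (m k : 'I_n -> nat) (phi : R -> R[i]) (h : V -> R[i]).
Hypothesis n_gt0 : (0 < n)%N.

Lemma ae_enorm_neq0 : {ae nu, forall z, enorm z <> 0}.
Proof.
have mZ : measurable [set z : V | enorm z = 0].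
  rewrite (_ : [set z | _] = @enorm R n @^-1` [set 0])//.
  by rewrite -[X in measurable X]setTI; apply: measurable_enorm.
exact: nu_null mZ (leb_origin n_gt0).
Qed.

(** The integrand is positive off the origin, which is a null set because [n > 0]. *)
Lemma radint_neq0 l : @radint R n l != 0.
Proof.
apply/eqP => r0; have [e1 _] := cbounded_cintegrable (@cbounded_epow R n l).
have e0 z : Re (epow l z) = `|Re (epow l z)|.
  rewrite ger0_norm// /epow /cut; case: ifP => //= _.
  by rewrite exprn_ge0// enorm_ge0.
have me : measurable_fun setT (EFin \o (fun z : V => Re (epow l z))) := measurable_int _ e1.
have : (\int[nu]_z `|(EFin \o (fun z : V => Re (epow l z))) z| = 0)%E.
  under eq_integral do rewrite /= -e0.
  rewrite -[LHS]fineK; last exact: integrable_fin_num e1.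
  by have /(congr1 (@complex.Re R)) /= := r0; rewrite /Rintegral => ->.
move=> /(ae_eq_integral_abs _ measurableT me) H.
have [N [mN N0 sub]] : {ae nu, forall z : V, False}.
  move: (ae_enorm_neq0) H (ae_ball (fun z (Bz : B z) => Bz)); apply: filterS3 => z zN /(_ Logic.I) [].
  rewrite /= => E Bz; move: E; rewrite /epow cutE//= => /eqP.
  by rewrite expf_eq0 => /andP[_ /eqP].
have : (nu setT <= nu N)%E by apply: le_measure; rewrite ?inE// => z _; exact: sub.
by rewrite nu_setT N0 lee_fin ler10.
Qed.

(** The eigenvalue, on monomials of degree [l], of the Toeplitz operator whose symbol
   is [z |-> phi (enorm z)]. *)
Definition eigen phi l : R[i] := @radmean R n phi l / @radint R n l.

Lemma radial_eigen v m phi : A2 v -> cbounded phi ->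
  cint nu setT (fun z => phi (enorm z) * (cutconj m z * cut v z)) =
  eigen phi (deg m) * cint nu setT (fun z => cutconj m z * cut v z).
Proof.
move=> Av bphi; apply: (mulfI (radint_neq0 (deg m))).
rewrite (radial_meanE m Av bphi) /eigen mulrA [_ * (_ / _)]mulrC.
by rewrite divfK ?radint_neq0// mulrC.
Qed.

Lemma cbounded_radial phi : cbounded phi -> cbounded (fun z : V => phi (enorm z)).
Proof.
case=> mphi [K hK]; split; last by exists K.
exact: cmeasurable_comp (@measurable_enorm R n) mphi.
Qed.

(** Integrate [h] against the polynomials of [muntz] in [enorm z ^+ 2]: only the term
   of exponent [q] contributes, while the integral is as small as desired. *)
Lemma muntz_radial h L q : cintegrable nu setT h -> divergent (R := R) L ->
  (forall l, L l -> cint nu setT (fun z => epow l z * h z) = 0) -> (0 < q)%N ->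
  cint nu setT (fun z => epow q z * h z) = 0.
Proof.
move=> hi Ld h0 q0; set X := cint _ _ _.
have ehi l : cintegrable nu setT (fun z => epow l z * h z).
  by apply: cintegrableM => //; exact: cbounded_epow.
set S := \int[nu]_z normc (h z).
have S0 : 0 <= S by apply: Rintegral_ge0 => z _; exact: normc_ge0.
suff small (e : R) : 0 < e -> normc X <= 2 * (e * S).
  apply/eqP; rewrite -normc_eq0 eq_le normc_ge0 andbT; apply/ler_addgt0Pr => e e0.
  rewrite add0r; have e1 : 0 < e / (2 * (S + 1)) by rewrite divr_gt0// mulr_gt0// ltr_wpDl.
  apply: le_trans (small _ e1) _.
  have S1 : 0 < S + 1 by rewrite ltr_wpDl.
  rewrite (_ : 2 * _ = e * (S / (S + 1))); last first.
    by have := lt0r_neq0 S1; move: (S) => s s0; field.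
  by rewrite ler_piMr ?(ltW e0)// ler_pdivrMr// mul1r lerDl.
move=> e0; have [p [pq pL pe]] := muntz q0 Ld e0.
have [si sE] := cint_sum measurableT (index_enum 'I_(size p))
  (fun i : 'I_(size p) => cintegrableZ measurableT (p`_i)%:C%C (ehi i)).
have qs : (q < size p)%N.
  by rewrite ltnNge; apply/negP => /leq_sizeP /(_ q (leqnn q)); rewrite pq => /eqP; rewrite oner_eq0.
have XE : X = cint nu setT (fun z => \sum_(i < size p) (p`_i)%:C%C * (epow i z * h z)).
  rewrite sE (bigD1 (Ordinal qs))//= big1 ?addr0.
    by rewrite cintZ// pq rmorph1 mul1r.
  move=> i iq; rewrite cintZ//; have [->|pi0] := eqVneq p`_i 0; first by rewrite rmorph0 mul0r.
  have [iE|Li] := pL i pi0; last by rewrite h0 ?mulr0.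
  by move: iq; rewrite -val_eqE /= iE eqxx.
pose G z := cut (fun z => (p.[enorm z ^+ 2])%:C%C) z * h z.
have GE : X = cint nu setT G.
  rewrite XE; apply: cint_nu_ball => z Bz; rewrite /G cutE// horner_coef rmorph_sum mulr_suml.
  apply: eq_bigr => i _; rewrite /epow cutE// mulrA; congr (_ * _).
  by rewrite rmorphM -exprM.
have bp : cbounded (cut (fun z : V => (p.[enorm z ^+ 2])%:C%C)).
  apply: (@cbounded_cut _ _ _ e); last exact: ltW.
    apply: cmeasurable_real; under eq_fun do rewrite horner_coef.
    apply: measurable_sum => i; apply: measurable_funM => //.
    by apply: measurable_funX; exact: measurable_sqr_enorm.
  move=> z Bz; rewrite normc_real pe// sqr_ge0 /=.
  by rewrite exprn_ile1 ?enorm_ge0// ltW.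
have Gi : cintegrable nu setT G by exact: cintegrableM.
have hn := cintegrable_normc measurableT hi.
rewrite GE; apply: le_trans (normc_cint measurableT Gi) _; rewrite ler_wpM2l//.
rewrite /S -RintegralZl//; apply: le_Rintegral => //.
- exact: cintegrable_normc.
- by apply: eq_integrable (integrableZl measurableT e hn).
move=> z _; rewrite /G normcM ler_wpM2r ?normc_ge0//.
rewrite /cut; case: ifPn => [Bz|_]; last by rewrite ComplexField.Normc.normc0 ltW.
by rewrite normc_real pe// sqr_ge0 /= exprn_ile1 ?enorm_ge0// ltW.
Qed.

Lemma cisX y j : cis y ^+ j = cis (y *+ j) :> R[i].
Proof.
elim: j => [|j IH]; first by rewrite mulr0n cis0.
by rewrite exprS IH mulrS cisD.
Qed.

(** The rotation by [pi / d], with [d] the difference of the degrees, preserves the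
   integral and changes its sign. *)
Lemma rotation_eq0 m k phi : cbounded phi -> deg m <> deg k ->
  cint nu setT (fun z => moment (m, k) z * phi (enorm z)) = 0.
Proof.
move=> bphi mk; set X := cint _ _ _.
have bf : cbounded (fun z => moment (m, k) z * phi (enorm z)).
  by apply: cboundedM; [exact: cbounded_moment|exact: cbounded_radial].
have fi := cbounded_cintegrable bf.
have rot c : normc c = 1 -> X = c ^+ deg m * conjc c ^+ deg k * X.
  move=> c1; have [_ E] := cint_nu_rot c1 bf.1 fi.
  rewrite [LHS]E -cintZ//; apply: cint_nu_ball => z Bz.
  have Bc : B (c *: z) by rewrite ball_rot.
  rewrite /moment !cutE//= !monZ enormZ c1 mul1r.
  have -> : conjc (c ^+ deg k * mon k z) = conjc c ^+ deg k * conjc (mon k z).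
    by rewrite rmorphM rmorphXn.
  ring.
have half d : (0 < d)%N -> cis (pi / d%:R) ^+ d = -1 :> R[i].
  move=> d0; rewrite cisX (_ : pi / d%:R *+ d = pi); last first.
    by rewrite -[LHS]mulr_natr divfK// pnatr_eq0 -lt0n.
  by apply: complex_eq; rewrite /= ?cospi ?sinpi ?oppr0.
have X0 : X = - X -> X = 0.
  move=> h; have : X *+ 2 = 0 by rewrite mulr2n {1}h addNr.
  by move/eqP; rewrite mulrn_eq0 /= => /eqP.
have conj1 (c : R[i]) j : c * conjc c = 1 -> c ^+ j * conjc c ^+ j = 1.
  by move=> cc; rewrite -exprMn cc expr1n.
move/eqP: mk; rewrite neq_ltn => /orP[] lt.
  pose d := (deg k - deg m)%N; have d0 : (0 < d)%N by rewrite subn_gt0.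
  pose c : R[i] := conjc (cis (pi / d%:R)).
  have c1 : normc c = 1 by rewrite normc_conj normc_cis.
  have cc : c * conjc c = 1 by rewrite /c conjcK mulrC; exact: cis_conjK.
  apply: X0; rewrite {1}(rot _ c1) -{1}(subnKC (ltnW lt)) exprD mulrA conj1// mul1r -/d.
  by rewrite /c conjcK half// mulN1r.
pose d := (deg m - deg k)%N; have d0 : (0 < d)%N by rewrite subn_gt0.
pose c : R[i] := cis (pi / d%:R).
have c1 : normc c = 1 by rewrite normc_cis.
have cc : c * conjc c = 1 by exact: cis_conjK.
apply: X0; rewrite {1}(rot _ c1) -{1}(subnKC (ltnW lt)) exprD -/d half//.
by rewrite mulrN1 !mulNr conj1// mul1r.
Qed.

(** If the zeros were not sparse then, by Müntz's theorem, all eigenvalues of positive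
   degree would vanish, and so would all moments of the symbol times
   [enorm z ^+ 2]. *)
Lemma eigen_zeros_sparse phi : cbounded phi -> ~ {ae nu, forall z : V, phi (enorm z) = 0} ->
  bounded_sum (R := R) (fun l => eigen phi l == 0).
Proof.
move=> bphi nz; apply: sparse_bounded => div; apply: nz.
have bpe := cbounded_radial bphi.
have mean0 q : (0 < q)%N -> @radmean R n phi q = 0.
  move=> q0; have := @muntz_radial _ _ q (cbounded_cintegrable bpe) div _ q0.
  rewrite /radmean; under eq_cint do rewrite mulrC; apply => l.
  rewrite /eigen mulf_eq0 invr_eq0 (negbTE (radint_neq0 l)) orbF => /eqP <-.
  by apply: eq_cint => z _; rewrite mulrC.
pose J : set R := `]-1, 1[%classic.
have mJ : measurable (J : set (measurableTypeR R)) by exact: measurable_itv.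
(* The cut-off makes [psi] bounded on the line; on the ball it is invisible. *)
pose psi (s : R) : R[i] := (\1_J s * s ^+ 2)%:C%C * phi s.
have bpsi : cbounded psi.
  apply: cboundedM => //; split.
    apply: cmeasurable_real; apply: measurable_funM; first exact: measurable_indic.
    exact: measurable_funX.
  exists 1 => s; rewrite normc_real indicE; have [sJ|sJ] := pselect (J s); last first.
    by rewrite memNset// mul0r normr0.
  rewrite mem_set// mul1r ger0_norm ?sqr_ge0// -[s ^+ 2]real_normK ?num_real//.
  rewrite exprn_ile1//; move: sJ; rewrite /J /= in_itv /= -ltr_norml; exact: ltW.
have psiE z : B z -> psi (enorm z) = epow 1 z * phi (enorm z).
  move=> Bz; rewrite /psi /epow cutE// indicE mem_set ?mul1r//.
  rewrite /J /= in_itv /=; apply/andP; split => //.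
  by apply: lt_le_trans (enorm_ge0 z); rewrite oppr_lt0.
have mean_psi l : @radmean R n psi l = 0.
  rewrite -(mean0 l.+1 isT); apply: cint_nu_ball => z Bz; rewrite psiE//.
  by rewrite /epow !cutE// mulrAC mulrC -rmorphM -exprD -mulnDr add1n.
have : {ae nu, forall z : V, psi (enorm z) = 0}.
  apply: moments_eq0; first exact: cbounded_cintegrable (cbounded_radial bpsi).
  move=> m k; have [mk|/eqP mk] := eqVneq (deg m) (deg k).
    apply: (mulfI (radint_neq0 (deg k))).
    have := radial_meanE k (A2_mon m) bpsi; rewrite mean_psi mulr0 mulr0 => <-.
    congr (_ * _); apply: cint_nu_ball => z Bz; rewrite /cutconj !cutE//; ring.
  rewrite -[RHS](rotation_eq0 bpsi mk); apply: cint_nu_ball => z Bz.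
  by rewrite /moment cutE.
move: ae_enorm_neq0 (ae_ball (fun z (Bz : B z) => Bz)); apply: filterS3 => z zN Bz.
rewrite psiE// => /eqP; rewrite mulf_eq0 => /orP[|/eqP//].
by rewrite /epow cutE// eq_complex /= eqxx andbT expf_eq0 /= => /eqP.
Qed.

End radial_zeros.

(** * Toeplitz operators with radial symbols *)

Lemma conjcM (R : rcfType) (x y : R[i]) : conjc (x * y) = conjc x * conjc y.
Proof. exact: rmorphM. Qed.

Lemma bounded_sum_has (R : realType) (I : Type) (s : seq I) (P : I -> pred nat) :
  (forall i, bounded_sum (R := R) (P i)) -> bounded_sum (R := R) (fun l => has (P ^~ l) s).
Proof.
move=> bP; elim: s => [|i s IH]; last exact: bounded_sumU.
by exists 0 => K; rewrite big_pred0.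
Qed.

Section toeplitz.
Context {R : realType} {n : nat}.
Local Notation V := 'rV[R[i]]_n.
Local Notation B := (@uball R n).
Local Notation nu := (@nu R n).
Implicit Types (z : V) (m k : 'I_n -> nat) (phi : R -> R[i]) (f g h u v : V -> R[i]).
Hypothesis n_gt0 : (0 < n)%N.

Lemma cint0 : cint nu setT (fun=> 0) = 0.
Proof. by apply: complex_eq; rewrite /= Rintegral_cst// mul0r. Qed.

Lemma cbounded_borelL2M (b : V -> R[i]) u : cbounded b -> borelL2 nu u ->
  borelL2 nu (fun z => b z * u z).
Proof.
move=> [mb [K hK]] uL; have KuL := borelL2Z K%:C%C uL.
have [] // := borelL2_le (cmeasurableM mb uL.1) KuL KuL.
move=> z; rewrite !normcM normc_real.
have K0 : 0 <= K := le_trans (normc_ge0 _) (hK z).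
rewrite (ger0_norm K0); have h : (normc (b z) * normc (u z)) ^+ 2 <= (K * normc (u z)) ^+ 2.
  by rewrite lerXn2r ?nnegrE ?mulr_ge0 ?normc_ge0// ler_wpM2r ?normc_ge0.
by have := sqr_ge0 (K * normc (u z)); lra.
Qed.

Lemma cbounded_borelL2 (b : V -> R[i]) : cbounded b -> borelL2 nu b.
Proof.
move=> bb; have := cbounded_borelL2M bb (A2_cut (A2_mon (fun=> 0%N))).
move=> L; split; first exact: bb.1.
rewrite (@sqint_ae _ _ _ (fun z => b z * cut (mon (fun=> 0%N)) z)); first exact: L.2.
by apply: ae_ball => z Bz; rewrite cutE// mon0 mulr1.
Qed.

Lemma A2Z v (c : R[i]) : A2 v -> A2 (fun z => c * v z).
Proof. by move=> Av; have := A2DZ c (@A2_0 R n) Av; under [X in A2 X]eq_fun do rewrite add0r. Qed.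

(** [h] minus its projection is orthogonal to A^2, in particular to the monomials. *)
Lemma inner_proj_mon h k : L2 h -> inner (bergman_proj h) (mon k) = inner h (mon k).
Proof.
move=> hL; have [Au hu] := bergman_projP hL; have [g gL hg] := L2_borel hL.
have kae := ae_sym (ae_cut (mon (R := R) k)); have uae := ae_sym (ae_cut (bergman_proj h)).
have := hu _ (A2_mon k); rewrite (inner_ae (ae_sub hg uae) kae).
rewrite (inner_ae uae kae) (inner_ae hg kae) /ip => H.
have kL := A2_cut (A2_mon (R := R) k); have uL := A2_cut Au.
apply/esym/eqP; rewrite -subr_eq0 -cintB//; try exact: ip_integrable.
by apply/eqP; rewrite -[RHS]H; apply: eq_cint => z _; rewrite mulrBl.
Qed.

Definition radial_symbol g phi := cbounded phi /\ {ae nu, forall z, g z = phi (enorm z)}.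

Lemma symbol_ae g phi u : radial_symbol g phi ->
  {ae nu, forall z, g z * u z = phi (enorm z) * cut u z}.
Proof. by move=> [_ gphi]; move: gphi (ae_cut u); apply: filterS2 => z -> ->. Qed.

Lemma symbol_L2 g phi u : radial_symbol g phi -> A2 u -> L2 (fun z => g z * u z).
Proof.
move=> gphi Au; apply: borel_L2 (symbol_ae u gphi).
by apply: cbounded_borelL2M (A2_cut Au); exact: cbounded_radial gphi.1.
Qed.

Lemma toeplitz_A2 g phi u : radial_symbol g phi -> A2 u -> A2 (toeplitz g u).
Proof. by move=> gphi Au; have [] := bergman_projP (symbol_L2 gphi Au). Qed.

Lemma inner_mon u k : inner u (mon k) = cint nu setT (fun z => cutconj k z * cut u z).
Proof.
rewrite (inner_ae (ae_sym (ae_cut u)) (ae_sym (ae_cut (mon k)))).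
by apply: cint_nu_ball => z Bz; rewrite /cutconj !cutE// mulrC.
Qed.

(** A Toeplitz operator with radial symbol multiplies the Taylor coefficients of any
   [u] in A^2 by its eigenvalues. *)
Lemma toeplitz_coef g phi u k : radial_symbol g phi -> A2 u ->
  inner (toeplitz g u) (mon k) = eigen (n := n) phi (deg k) * inner u (mon k).
Proof.
move=> gphi Au; rewrite inner_proj_mon; last exact: symbol_L2 gphi Au.
rewrite (inner_ae (symbol_ae u gphi) (ae_sym (ae_cut (mon k)))) inner_mon.
rewrite -(radial_eigen n_gt0 k Au gphi.1); apply: cint_nu_ball => z Bz.
by rewrite /cutconj !cutE//; ring.
Qed.

Lemma eigen_conj phi l : cbounded phi ->
  eigen (n := n) (fun s => conjc (phi s)) l = conjc (eigen (n := n) phi l).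
Proof.
move=> bphi; have e_real z : conjc (@epow R n l z) = epow l z.
  by rewrite /epow /cut; case: ifP => _; rewrite ?conjc_real ?rmorph0.
have ei := cbounded_cintegrable (@cbounded_epow R n l).
have pei := cintegrableM (cbounded_radial (n := n) bphi) ei.
have E1 : @radint R n l = conjc (@radint R n l).
  by rewrite /radint -(cint_conj measurableT ei); apply: eq_cint => z _; rewrite e_real.
have -> : conjc (eigen (n := n) phi l) = conjc (@radmean R n phi l) / conjc (@radint R n l).
  by rewrite /eigen rmorphM fmorphV.
rewrite -E1 /eigen; congr (_ / _).
rewrite /radmean -(cint_conj measurableT pei); apply: eq_cint => z _.
by rewrite -[in LHS]e_real rmorphM.
Qed.

(** Up to conjugation this is [radial_eigen]: the projection is tested against
   arbitrary elements of A^2. *)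
Lemma toeplitz_mon g phi (c : R[i]) m u : radial_symbol g phi -> A2 u ->
  (forall z, B z -> u z = c * mon m z) ->
  forall z, B z -> toeplitz g u z = eigen (n := n) phi (deg m) * c * mon m z.
Proof.
move=> gphi Au um; have bphi := gphi.1; set w := eigen _ _.
apply: bergman_proj_eq (symbol_L2 gphi Au) _; split; first exact: A2Z (A2_mon m).
move=> v Av; pose D (z : V) := cutconj m z * cut v z.
have Di : cintegrable nu setT D.
  by apply: cintegrableM; [exact: cbounded_cutconj|exact: A2_cintegrable].
have bc := cbounded_conj bphi.
have Pi := cintegrableM (cbounded_radial (n := n) bc) Di.
have := radial_eigen n_gt0 m Av bc; rewrite eigen_conj// -/w -/D.
move/(congr1 (@conjc R)); rewrite -(cint_conj measurableT Pi) conjcM conjcK -(cint_conj measurableT Di) => H.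
have ae1 : {ae nu, forall z, g z * u z - w * c * mon m z =
    phi (enorm z) * cut u z - cut (fun z => w * c * mon m z) z}.
  exact: ae_sub (symbol_ae u gphi) (ae_sym (ae_cut _)).
rewrite (inner_ae ae1 (ae_sym (ae_cut v))).
transitivity (cint nu setT (fun z => c * conjc (conjc (phi (enorm z)) * D z) - w * c * conjc (D z))).
  apply: cint_nu_ball => z Bz; rewrite /D /cutconj !cutE// um// !conjcM !conjcK.
  ring.
have i1 := cintegrable_conj measurableT Pi; have i2 := cintegrable_conj measurableT Di.
rewrite cintB//; [|exact: cintegrableZ|exact: cintegrableZ].
rewrite (cintZ measurableT _ i1) (cintZ measurableT _ i2) H; ring.
Qed.

Context (I : Type) (F : I -> V -> R[i]) (Phi : I -> R -> R[i]).
Hypothesis symbols : forall i, radial_symbol (F i) (Phi i).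

Definition eigens (s : seq I) l : R[i] := \prod_(i <- s) eigen (n := n) (Phi i) l.

Lemma toeplitz_foldr_A2 s u : A2 u -> A2 (foldr (fun i => toeplitz (F i)) u s).
Proof. by move=> Au; elim: s => //= i s; exact: toeplitz_A2. Qed.

Lemma toeplitz_foldr_mon s m z : B z ->
  foldr (fun i => toeplitz (F i)) (mon m) s z = eigens s (deg m) * mon m z.
Proof.
rewrite /eigens; elim: s z => [|i s IH] z Bz /=; first by rewrite big_nil mul1r.
by rewrite big_cons (toeplitz_mon (symbols i) (toeplitz_foldr_A2 s (A2_mon m)) IH).
Qed.

Lemma toeplitz_foldr_coef s u k : A2 u ->
  inner (foldr (fun i => toeplitz (F i)) u s) (mon k) = eigens s (deg k) * inner u (mon k).
Proof.
move=> Au; rewrite /eigens; elim: s => [|i s IH] /=; first by rewrite big_nil mul1r.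
rewrite (toeplitz_coef _ (symbols i)); last exact: toeplitz_foldr_A2.
by rewrite IH big_cons mulrA.
Qed.

Lemma eigens_zeros_sparse s : (forall i, ~ zero_ae (F i)) ->
  bounded_sum (R := R) (fun l => eigens s l == 0).
Proof.
move=> F0; apply: (@le_bounded_sum _ _ (fun l => has (fun i => eigen (n := n) (Phi i) l == 0) s)).
  by move=> l; rewrite /eigens; elim: s => [|i s IH]; rewrite ?big_nil ?oner_eq0// big_cons mulf_eq0
    /= => /orP[->//|/IH ->]; rewrite orbT.
apply: bounded_sum_has => i; have [bphi gphi] := symbols i.
apply: (eigen_zeros_sparse n_gt0 bphi) => h; apply: (F0 i).
by move: h gphi; apply: filterS2 => z -> ->.
Qed.

End toeplitz.

Section moment_recursion.
Context {R : realType} {n : nat}.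
Local Notation V := 'rV[R[i]]_n.
Local Notation B := (@uball R n).
Local Notation nu := (@nu R n).
Implicit Types (z : V) (m k : 'I_n -> nat) (h : V -> R[i]).

Definition unit_exp (j i : 'I_n) : nat := (i == j).

Lemma mon_unit_exp j z : mon (unit_exp j) z = z 0 j.
Proof.
rewrite /mon (bigD1 j)//= /unit_exp eqxx expr1 big1 ?mulr1// => i /negbTE ->.
by rewrite expr0.
Qed.

Lemma deg_unit_exp j : deg (unit_exp j) = 1%N.
Proof. by rewrite /deg (bigD1 j)//= /unit_exp eqxx big1 ?addn0// => i /negbTE ->. Qed.

(** Expanding [enorm z ^+ 2] as the sum of the [z 0 j * conjc (z 0 j)]: the
   vanishing of moments propagates to moments weighted by powers of [enorm z]. *)
Lemma epow_moment_eq0 h (PF PG : pred nat) : cintegrable nu setT h ->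
  (forall m k, PF (deg k) -> PG (deg m) -> cint nu setT (fun z => moment (m, k) z * h z) = 0) ->
  forall l m k, PF (deg k + l)%N -> PG (deg m + l)%N ->
  cint nu setT (fun z => epow l z * (moment (m, k) z * h z)) = 0.
Proof.
move=> hi h0; elim=> [|l IH] m k kl ml.
  rewrite addn0 in kl; rewrite addn0 in ml; rewrite -[RHS](h0 m k kl ml).
  by apply: cint_nu_ball => z Bz; rewrite /epow cutE// muln0 expr0 mul1r.
pose s j m i := (m i + unit_exp j i)%N.
have degs j p : deg (s j p) = (deg p).+1 by rewrite degD deg_unit_exp addn1.
have ji j : cintegrable nu setT (fun z => epow l z * (moment (s j m, s j k) z * h z)).
  by apply: cintegrableM (cbounded_epow l) _; apply: cintegrableM => //; exact: cbounded_moment.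
have [_ E] := cint_sum measurableT (index_enum 'I_n) ji.
transitivity (\sum_(j < n) cint nu setT (fun z => epow l z * (moment (s j m, s j k) z * h z))).
  rewrite -E; apply: cint_nu_ball => z Bz; rewrite /epow /moment !cutE//=.
  have -> : (enorm z ^+ (2 * l.+1))%:C%C =
      \sum_(j < n) (enorm z ^+ (2 * l))%:C%C * (z 0 j * conjc (z 0 j)).
    rewrite -mulr_sumr mulnS addnC exprD rmorphM; congr (_ * _).
    rewrite sqr_enorm rmorph_sum; apply: eq_bigr => j _.
    by rewrite sqr_normcE; apply: complex_eq; rewrite /= ?(RecM, ImcM, Rec_conj, Imc_conj); ring.
  rewrite mulr_suml; apply: eq_bigr => j _; rewrite !cutE//= !monD !mon_unit_exp.
  by rewrite !conjcM; ring.
by apply: big1 => j _; apply: IH; rewrite degs addSnnS.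
Qed.

End moment_recursion.

(** * Zero products *)

Theorem theorem2p1 (R : realType) (n N M : nat)
  (n_gt0 : (0 < n)%N) (N_gt0 : (0 < N)%N) (M_gt0 : (0 < M)%N)
  (F : 'I_N -> 'rV[R[i]]_n -> R[i]) (G : 'I_M -> 'rV[R[i]]_n -> R[i])
  (F_meas : forall k, lebesgue_measurable (F k))
  (F_bounded : forall k, bounded_on_ball (F k))
  (F_radial : forall k, radial (F k))
  (F_neq0 : forall k, ~ zero_ae (F k))
  (G_meas : forall k, lebesgue_measurable (G k))
  (G_bounded : forall k, bounded_on_ball (G k))
  (G_radial : forall k, radial (G k))
  (G_neq0 : forall k, ~ zero_ae (G k))
  (f : 'rV[R[i]]_n -> R[i]) (f_L2 : L2 f)
  (prod_eq0 : forall phi : 'rV[R[i]]_n -> R[i], A2 phi ->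
     holomorphic (toeplitz_prod G phi) ->
     bounded_on_ball (toeplitz_prod G phi) ->
     forall z, uball n z ->
       toeplitz_prod F (toeplitz f (toeplitz_prod G phi)) z = 0%R) :
  zero_ae f.
Proof.
have exF i : exists phi, radial_symbol (F i) phi.
  by have [phi ? ?] := radial_borel n_gt0 (F_meas i) (F_bounded i) (F_radial i); exists phi.
have exG i : exists phi, radial_symbol (G i) phi.
  by have [phi ? ?] := radial_borel n_gt0 (G_meas i) (G_bounded i) (G_radial i); exists phi.
have [Phi hPhi] := choice exF; have [Psi hPsi] := choice exG.
pose eF := eigens (n := n) Phi (enum 'I_N); pose eG := eigens (n := n) Psi (enum 'I_M).
have sF : bounded_sum (R := R) (fun l => eF l == 0) by exact: eigens_zeros_sparse hPhi _ F_neq0.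
have sG : bounded_sum (R := R) (fun l => eG l == 0) by exact: eigens_zeros_sparse hPsi _ G_neq0.
(* [f0] is a Borel version of [f]. *)
have [f0 f0L ff0] := L2_borel f_L2.
have f0i : cintegrable (nu n) setT f0.
  have b1 : cbounded (fun _ : 'rV[R[i]]_n => 1 : R[i]) by exact: cbounded_cst.
  have := ip_integrable f0L (cbounded_borelL2 b1).
  by under [X in cintegrable _ _ X -> _]eq_fun do rewrite rmorph1 mulr1.
have mom0 (m k : 'I_n -> nat) : eF (deg k) != 0 -> eG (deg m) != 0 ->
    cint (nu n) setT (fun z => moment (m, k) z * f0 z) = 0.
  move=> Fk Gm; set U := toeplitz_prod G (mon m); set c := eG (deg m) in Gm.
  have AU : A2 U by exact: toeplitz_foldr_A2 hPsi _ _ (A2_mon m).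
  have UE z : uball n z -> U z = c * mon m z by exact: toeplitz_foldr_mon hPsi _ _ _.
  have Ub : forall z, uball n z -> normc (U z) <= normc c.
    move=> z Bz; rewrite UE// ComplexField.Normc.normcM.
    by rewrite -[leRHS]mulr1 ler_wpM2l ?normc_ge0 ?normc_mon_le1.
  have bU : cbounded (cut U).
    split; first by have [] := A2_cut AU.
    exists (normc c) => z; rewrite /cut; case: ifPn => [/Ub//|_].
    by rewrite ComplexField.Normc.normc0 normc_ge0.
  have hae : {ae nu n, forall z, f z * U z = cut U z * f0 z}.
    by move: ff0 (ae_cut U); apply: filterS2 => z -> ->; rewrite mulrC.
  have hL : L2 (fun z => f z * U z) := borel_L2 (cbounded_borelL2M bU f0L) hae.
  have Au : A2 (toeplitz f U) by have [] := bergman_projP hL.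
  have z0 : forall z, uball n z -> toeplitz_prod F (toeplitz f U) z = 0.
    by apply: prod_eq0; [exact: A2_mon|exact: AU.1|exists (normc c)].
  (* Pair the vanishing product with the monomial of exponent [k]. *)
  have := toeplitz_foldr_coef n_gt0 hPhi (enum 'I_N) k Au.
  have -> : inner (foldr (fun i => toeplitz (F i)) (toeplitz f U) (enum 'I_N)) (mon k) = 0.
    rewrite -(@cint0 R n); apply: cint_nu_ball => z Bz.
    by rewrite [X in X * _]z0// mul0r.
  rewrite inner_proj_mon// (inner_ae hae (ae_sym (ae_cut (mon k)))) -/(eF _).
  move=> /esym/eqP; rewrite mulf_eq0 (negbTE Fk) /= => /eqP H.
  have bm := cintegrableM (cbounded_moment (m, k)) f0i.
  apply: (mulfI Gm); rewrite mulr0 -[RHS]H -(cintZ measurableT _ bm).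
  apply: cint_nu_ball => z Bz; rewrite /moment !cutE// UE//=; ring.
have e1i : cintegrable (nu n) setT (fun z => epow 1 z * f0 z).
  by apply: cintegrableM => //; exact: cbounded_epow.
have : {ae nu n, forall z, epow 1 z * f0 z = 0}.
  apply: moments_eq0 => // m k.
  have := @muntz_radial R n (fun z => moment (m, k) z * f0 z)
    (fun l => ~~ ((eF (deg k + l)%N == 0) || (eG (deg m + l)%N == 0))) 1.
  have mi := cintegrableM (cbounded_moment (m, k)) f0i.
  have bs := bounded_sumU (bounded_sum_shift (deg k) sF) (bounded_sum_shift (deg m) sG).
  move=> /(_ mi (divergentC bs)) H; rewrite -[RHS]H//; last first.
    move=> l; rewrite negb_or => /andP[kl ml].
    exact: (@epow_moment_eq0 _ _ _ (fun l => eF l != 0) (fun l => eG l != 0) f0i).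
  by apply: cint_nu_ball => z Bz; rewrite /moment cutE//= mulrCA.
have ball : {ae nu n, forall z : 'rV[R[i]]_n, uball n z} by exact: ae_ball.
have ae0 : {ae nu n, forall z : 'rV[R[i]]_n, enorm z <> 0 /\ uball n z}.
  by move: (@ae_enorm_neq0 R n n_gt0) ball; apply: filterS2.
move=> h; move: ae0 h ff0; apply: filterS3.
move=> z [zN Bz] /eqP h ->; move: h; rewrite mulf_eq0 => /orP[|/eqP//].
by rewrite /epow cutE// eq_complex /= eqxx andbT expf_eq0 /= => /eqP.
Qed.
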